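(* Let $n\ge1$, $p>1$, $Q=2n+2$, $0\le u_0\in L^1(\mathbb{H}^n)\cap C_0(\mathbb{H}^n)$, and let $k:(0,\infty)\to(0,\infty)$ satisfy $k\in L^\infty(0,\infty)$ and $\inf_{t>0}k(t)>0$. Let $u$ be a non-negative nontrivial global mild solution of $$u_t-\Delta_{\mathbb{H}}u=-k(t)u^p\ \ (\eta\in\mathbb{H}^n,\ t>0),\qquad u(0,\eta)=u_0(\eta)\ \ (\eta\in\mathbb{H}^n),$$ and let $M_\infty=\lim_{t\to\infty}\int_{\mathbb{H}^n}u(t,\eta)\,d\eta$. Then: (1) If $p>1+\frac2Q$, then $M_\infty>0$. Moreover, for all $q\in[1,\infty)$, $$t^{\frac Q2\left(1-\frac1q\right)}\left\|u(t)-M_\infty h_t\right\|_{L^q(\mathbb{H}^n)}\longrightarrow0\quad\text{as }t\to\infty,$$ where $h_t$ is the heat kernel associated to $-\Delta_{\mathbb{H}}$. (2) If $1<p\le1+\frac2Q$, then $M_\infty=0$.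
   Context: Heisenberg group: $\mathbb{H}^n=\mathbb{R}^n\times\mathbb{R}^n\times\mathbb{R}$ with group law $\eta\circ\eta'=(x+x',y+y',\tau+\tau'+2(x\cdot y'-x'\cdot y))$ for $\eta=(x,y,\tau)$, $\eta'=(x',y',\tau')$; inverse $\eta^{-1}=-\eta$; integration is with respect to Lebesgue measure on $\mathbb{R}^{2n+1}$ (which is Haar measure). $Q=2n+2$ is the homogeneous dimension. $C_0(\mathbb{H}^n)$ is the space of continuous functions tending to zero at infinity, with the sup norm. The left-invariant vector fields are $X_i=\partial_{x_i}-2y_i\partial_\tau$, $Y_i=\partial_{y_i}+2x_i\partial_\tau$, and the Heisenberg Laplacian is $\Delta_{\mathbb{H}}=\sum_{i=1}^n(X_i^2+Y_i^2)$. Heat semigroup: $(S_{\mathbb{H}}(t))_{t\ge0}$ denotes the semigroup generated by (the closure of) $\Delta_{\mathbb{H}}$; it is a contraction semigroup on $L^q(\mathbb{H}^n)$, $1\le q\le\infty$, strongly continuous for $q<\infty$ and on $C_0(\mathbb{H}^n)$. For $t>0$ it is given by $S_{\mathbb{H}}(t)f(\eta)=\int_{\mathbb{H}^n}f(\xi)h_t(\xi^{-1}\circ\eta)\,d\xi$, where $h_t$ is the heat kernel: $h_t\ge0$ is smooth, $\int h_t=1$, $h_t(\eta)=h_t(\eta^{-1})$, and $h_{r^2t}(rx,ry,r^2\tau)=r^{-Q}h_t(x,y,\tau)$ for $r,t>0$. Mild solution: $u\in C([0,T),C_0(\mathbb{H}^n))$ is a mild solution on $[0,T)$ if $$u(t,\eta)=S_{\mathbb{H}}(t)u_0(\eta)-\int_0^tS_{\mathbb{H}}(t-s)\,k(s)\,|u|^{p-1}u(s,\eta)\,ds\quad\text{for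 all }\eta\in\mathbb{H}^n,\ t\in[0,T).$$ It is a global mild solution if this holds for all $T>0$. For $u_0\in L^1(\mathbb{H}^n)\cap C_0(\mathbb{H}^n)$, $u_0\ge0$, the global mild solution belongs to $C([0,\infty),L^1(\mathbb{H}^n)\cap C_0(\mathbb{H}^n))$ and the mass $\int_{\mathbb{H}^n}u(t,\eta)\,d\eta$ is finite, non-negative and non-increasing in $t$, so $M_\infty$ exists. Nontrivial means $u\not\equiv0$. *)

(* Defs.v *)
From HB Require Import structures.
From mathcomp Require Import all_boot all_order all_algebra.
From mathcomp Require Import all_classical all_reals all_analysis.
Set Implicit Arguments.
Unset Strict Implicit.
Unset Printing Implicit Defensive.
Import Order.TTheory GRing.Theory Num.Theory numFieldNormedType.Exports.
Local Open Scope classical_set_scope.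
Local Open Scope ring_scope.

(* The sigma-algebra on 'rV[T]_n generated by the coordinates; for T a realType
   it is the Borel sigma-algebra. *)
Section row_measurable.
Context d (T : measurableType d) (n : nat).

Definition row_coord (i : 'I_n) (v : 'rV[T]_n) : T := v ord0 i.

Let row_measurable0 : g_sigma_preimage row_coord set0.
Proof. exact: sigma_algebra0. Qed.

Let row_measurableC A :
  g_sigma_preimage row_coord A -> g_sigma_preimage row_coord (~` A).
Proof. exact: sigma_algebraC. Qed.

Let row_measurable_bigcup (F : (set 'rV[T]_n)^nat) :
  (forall i, g_sigma_preimage row_coord (F i)) ->
  g_sigma_preimage row_coord (\bigcup_i F i).
Proof. exact: sigma_algebra_bigcup. Qed.

HB.instance Definition _ := @isMeasurable.Build (measure_tuple_display d)
  'rV[T]_n (g_sigma_preimage row_coord)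
  row_measurable0 row_measurableC row_measurable_bigcup.

Lemma measurable_row_coord (i : 'I_n) :
  measurable_fun [set: 'rV[T]_n] (row_coord i).
Proof.
move=> _ Y mY; rewrite setTI; apply: sub_sigma_algebra => /=.
rewrite -bigcup_seq/=; exists i => /=; first by rewrite mem_index_enum.
by exists Y => //; rewrite setTI.
Qed.

Lemma measurable_fun_row d' (S : measurableType d') (f : S -> 'rV[T]_n) :
  (forall i, measurable_fun [set: S] (fun x => f x ord0 i)) ->
  measurable_fun [set: S] f.
Proof.
move=> mf; apply: measurability; first by [].
move=> _ [B + <-]; rewrite -bigcup_seq => -[i _ [C mC <-]].
by rewrite !setTI -[X in measurable X]setTI; exact: (mf i _ C mC).
Qed.

End row_measurable.

(* The library declares this fact as an instance, but canonical inference does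
   not find it. *)
Lemma product_measure1_sigma_finite d1 d2 (T1 : measurableType d1)
    (T2 : measurableType d2) (R : realType)
    (m1 : {measure set T1 -> \bar R})
    (m2 : {sigma_finite_measure set T2 -> \bar R}) :
  sigma_finite setT m1 -> sigma_finite setT (m1 \x m2)%E.
Proof.
move=> /sigma_finiteP[F [TF ndF Foo]].
have /sigma_finiteP[G [TG ndG Goo]] := sigma_finiteT m2.
exists (fun k => F k `*` G k).
  rewrite -setXTT TF TG predeqE => -[x y]; split.
    move=> [/= [n _ Fnx] [k _ Gky]]; exists (maxn n k) => //; split.
    - by move: x Fnx; exact/subsetPset/ndF/leq_maxl.
    - by move: y Gky; exact/subsetPset/ndG/leq_maxr.
  by move=> [n _ []/= ? ?]; split; exists n.
move=> k; have [? ?] := Foo k; have [? ?] := Goo k.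
split; first exact: measurableX.
by rewrite product_measure1E// lte_mul_pinfty// ge0_fin_numE.
Qed.

Section lebesgue_row.
Context {R : realType}.

(* The library's Lebesgue measure lives on measurableTypeR R, an alias of R with
   another measure display; this is the same measure on R itself. *)
Definition lebesgue_line : set R -> \bar R := @lebesgue_measure R.

Let lebesgue_line0 : lebesgue_line set0 = 0%E.
Proof. exact: (measure0 (@lebesgue_measure R)). Qed.

Let lebesgue_line_ge0 A : (0 <= lebesgue_line A)%E.
Proof. exact: (measure_ge0 (@lebesgue_measure R)). Qed.

Let lebesgue_line_sigma_additive : semi_sigma_additive lebesgue_line.
Proof. exact: (@measure_semi_sigma_additive _ _ _ (@lebesgue_measure R)). Qed.

HB.instance Definition _ := isMeasure.Build _ _ _ lebesgue_line
  lebesgue_line0 lebesgue_line_ge0 lebesgue_line_sigma_additive.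

Let lebesgue_line_sigma_finite : sigma_finite setT lebesgue_line.
Proof. exact: (sigma_finiteT (@lebesgue_measure R)). Qed.

HB.instance Definition _ := Measure_isSigmaFinite.Build _ _ _ lebesgue_line
  lebesgue_line_sigma_finite.

Definition row_cons m (x : R * 'rV[R]_m) : 'rV[R]_m.+1 :=
  \row_i oapp (x.2 ord0) x.1 (unlift ord0 i).

Definition row_uncons m (v : 'rV[R]_m.+1) : R * 'rV[R]_m :=
  (v ord0 ord0, \row_j v ord0 (lift ord0 j)).

Lemma row_consK m : cancel (@row_cons m) (@row_uncons m).
Proof.
move=> [a v]; rewrite /row_cons /row_uncons mxE unlift_none /=; congr pair.
by apply/rowP => j; rewrite !mxE liftK.
Qed.

Lemma measurable_row_cons m : measurable_fun setT (@row_cons m).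
Proof.
apply: measurable_fun_row => i; rewrite /row_cons.
case: (unliftP ord0 i) => [j|] ->.
- rewrite (_ : (fun _ => _) = row_coord j \o snd).
    exact: measurableT_comp (measurable_row_coord j) measurable_snd.
  by apply/funext => x; rewrite mxE liftK.
- rewrite (_ : (fun _ => _) = fst); first exact: measurable_fst.
  by apply/funext => x; rewrite mxE unlift_none.
Qed.

Lemma measurable_row_uncons m : measurable_fun setT (@row_uncons m).
Proof.
apply/measurable_fun_pairP; split; first exact: measurable_row_coord.
apply: measurable_fun_row => i.
rewrite (_ : (fun _ => _) = row_coord (lift ord0 i)).
  exact: measurable_row_coord.
by apply/funext => v /=; rewrite mxE.
Qed.

Section step.
Context m (mu : {sigma_finite_measure set 'rV[R]_m -> \bar R}).

Definition lebesgue_row_cons : set 'rV[R]_m.+1 -> \bar R :=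
  pushforward (lebesgue_line \x mu)%E (@row_cons m).

Let preimage_row_cons A : measurable A -> measurable (@row_cons m @^-1` A).
Proof.
by move=> mA; rewrite -[X in measurable X]setTI; exact: measurable_row_cons.
Qed.

Let lebesgue_row_cons0 : lebesgue_row_cons set0 = 0%E.
Proof. by rewrite /lebesgue_row_cons /pushforward preimage_set0 measure0. Qed.

Let lebesgue_row_cons_ge0 A : (0 <= lebesgue_row_cons A)%E.
Proof. by rewrite /lebesgue_row_cons /pushforward; exact: measure_ge0. Qed.

Let lebesgue_row_cons_sigma_additive : semi_sigma_additive lebesgue_row_cons.
Proof.
move=> F mF tF mUF; rewrite /lebesgue_row_cons /pushforward preimage_bigcup.
apply: measure_semi_sigma_additive.
- by move=> k; exact: preimage_row_cons.
- apply/trivIsetP => /= i j _ _ ij; rewrite -preimage_setI.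
  by move/trivIsetP : tF => /(_ _ _ _ _ ij) ->//; rewrite preimage_set0.
- by rewrite -preimage_bigcup; exact: preimage_row_cons.
Qed.

HB.instance Definition _ := isMeasure.Build _ _ _ lebesgue_row_cons
  lebesgue_row_cons0 lebesgue_row_cons_ge0 lebesgue_row_cons_sigma_additive.

Let lebesgue_row_cons_sigma_finite : sigma_finite setT lebesgue_row_cons.
Proof.
have [F TF Ffin] :=
  product_measure1_sigma_finite mu (sigma_finiteT lebesgue_line).
exists (fun k => @row_uncons m @^-1` F k).
  by rewrite -preimage_bigcup -TF preimage_setT.
move=> k; have [mF F_fin] := Ffin k; split.
  by rewrite -[X in measurable X]setTI; exact: measurable_row_uncons.
rewrite /lebesgue_row_cons /pushforward -comp_preimage.
by rewrite (_ : _ \o _ = id) ?preimage_id//; apply/funext; exact: row_consK.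
Qed.

HB.instance Definition _ := Measure_isSigmaFinite.Build _ _ _ lebesgue_row_cons
  lebesgue_row_cons_sigma_finite.
End step.

(* Lebesgue measure on R^n *)
Fixpoint lebesgue_row n : {sigma_finite_measure set 'rV[R]_n -> \bar R} :=
  if n is m.+1 then lebesgue_row_cons (lebesgue_row m)
  else \d_(0 : 'rV[R]_0).

End lebesgue_row.

Notation heis R n := ('rV[R]_n * 'rV[R]_n * R)%type.

Section heisenberg.
Context {R : realType} {n : nat}.
Implicit Types (x y : 'rV[R]_n) (a b : heis R n) (f g : heis R n -> R).

Definition dot x y : R := \sum_i x ord0 i * y ord0 i.

(* The inverse of a for this law is - a, computed componentwise. *)
Definition hmul a b : heis R n :=
  (a.1.1 + b.1.1, a.1.2 + b.1.2,
   a.2 + b.2 + 2 * (dot a.1.1 b.1.2 - dot b.1.1 a.1.2)).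

Definition hdil (r : R) a : heis R n :=
  (r *: a.1.1, r *: a.1.2, r ^+ 2 * a.2).

(* homogeneous dimension Q *)
Definition hdim : nat := (2 * n + 2)%N.

Definition lebesgue_heis : set (heis R n) -> \bar R :=
  ((lebesgue_row n \x lebesgue_row n) \x lebesgue_line)%E.

HB.instance Definition _ := Measure.on lebesgue_heis.

Let lebesgue_heis_sigma_finite : sigma_finite setT lebesgue_heis.
Proof.
do 2 apply: product_measure1_sigma_finite.
exact: sigma_finiteT.
Qed.

HB.instance Definition _ := Measure_isSigmaFinite.Build _ _ _ lebesgue_heis
  lebesgue_heis_sigma_finite.

Definition C0 f : Prop :=
  continuous f /\
  forall e : R, 0 < e ->
    exists2 K : set (heis R n), compact K & forall a, ~ K a -> `|f a| < e.

Fixpoint Ck (m : nat) f : Prop :=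
  if m is m'.+1 then
    continuous f /\
    forall v : heis R n, (forall a, derivable f a v) /\ Ck m' ('D_v f)
  else continuous f.

Definition smooth f : Prop := forall m, Ck m f.

Definition test_function f : Prop :=
  smooth f /\ compact (closure [set a | f a != 0]).

Definition vec_x (i : 'I_n) : heis R n := (delta_mx ord0 i, 0, 0).
Definition vec_y (i : 'I_n) : heis R n := (0, delta_mx ord0 i, 0).
Definition vec_t : heis R n := (0, 0, 1).

Definition field_X (i : 'I_n) f : heis R n -> R := fun a =>
  'D_(vec_x i) f a - 2 * a.1.2 ord0 i * 'D_vec_t f a.

Definition field_Y (i : 'I_n) f : heis R n -> R := fun a =>
  'D_(vec_y i) f a + 2 * a.1.1 ord0 i * 'D_vec_t f a.

Definition heis_laplacian f : heis R n -> R := fun a =>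
  \sum_(i < n) (field_X i (field_X i f) a + field_Y i (field_Y i f) a).

(* The graph, in C_0 x C_0, of the closure of the Heisenberg Laplacian with
   initial domain the compactly supported smooth functions. *)
Definition heis_laplacian_closure f g : Prop :=
  [/\ C0 f, C0 g &
    exists phi : nat -> heis R n -> R,
    [/\ forall m, test_function (phi m),
        {uniform, phi @ \oo --> f} &
        {uniform, (fun m => heis_laplacian (phi m)) @ \oo --> g}]].

(* The graph of the generator on C_0 of a semigroup S. *)
Definition generator (S : R -> (heis R n -> R) -> heis R n -> R) f g : Prop :=
  [/\ C0 f, C0 g &
    {uniform, (fun t a => t^-1 * (S t f a - f a)) @ 0^'+ --> g}].

Definition heat_semigroup (h : R -> heis R n -> R) (t : R) f : heis R n -> R :=
  fun a => if t == 0 then f a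
           else (\int[lebesgue_heis]_b (f b * h t (hmul (- b) a)))%R.

(* The last three clauses say that convolution with h is the strongly continuous
   semigroup on C_0 generated by the closure of the Heisenberg Laplacian; they
   determine h. The others are the standard positivity, regularity, mass,
   symmetry and homogeneity of this kernel. *)
Record heat_kernel (h : R -> heis R n -> R) : Prop := {
  heat_kernel_ge0 : forall t a, 0 < t -> 0 <= h t a;
  heat_kernel_smooth : forall t, 0 < t -> smooth (h t);
  heat_kernel_mass : forall t, 0 < t ->
    (\int[lebesgue_heis]_a (h t a)%:E = 1)%E;
  heat_kernel_sym : forall t a, 0 < t -> h t a = h t (- a);
  heat_kernel_dil : forall r t a, 0 < r -> 0 < t ->
    h (r ^+ 2 * t) (hdil r a) = r ^- hdim * h t a;
  heat_kernel_semigroup : forall s t f, 0 <= s -> 0 <= t -> C0 f ->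
    heat_semigroup h (s + t) f = heat_semigroup h s (heat_semigroup h t f);
  heat_kernel_strong : forall f, C0 f ->
    {uniform, (heat_semigroup h)^~ f @ 0^'+ --> f};
  heat_kernel_generator : forall f g,
    generator (heat_semigroup h) f g <-> heis_laplacian_closure f g
}.

Definition continuous_C0 (T : R) (u : R -> heis R n -> R) : Prop :=
  (forall t, 0 <= t < T -> C0 (u t)) /\
  {within `[0, T[, continuous (u : R -> {uniform heis R n -> R})}.

(* k is only meaningful on (0, +oo), so the time integral runs over the open
   interval. *)
Definition mild_solution (h : R -> heis R n -> R) (k : R -> R) (p : R)
    (u0 : heis R n -> R) (T : R) (u : R -> heis R n -> R) : Prop :=
  continuous_C0 T u /\
  forall t a, 0 <= t < T ->
    u t a = heat_semigroup h t u0 a -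
      (\int[@lebesgue_measure R]_(s in `]0%R, t[)
        heat_semigroup h (t - s)
          (fun b => k s * (`|u s b| `^ (p - 1) * u s b)) a)%R.

Definition global_mild_solution (h : R -> heis R n -> R) (k : R -> R) (p : R)
    (u0 : heis R n -> R) (u : R -> heis R n -> R) : Prop :=
  forall T, 0 < T -> mild_solution h k p u0 T u.

Definition mass (u : R -> heis R n -> R) (t : R) : \bar R :=
  (\int[lebesgue_heis]_a (u t a)%:E)%E.

End heisenberg.
Arguments hdim : clear implicits.

(* Main.v *)
From HB Require Import structures.
Require Import Defs.
From mathcomp Require Import all_boot all_order all_algebra.
From mathcomp Require Import all_classical all_reals all_analysis.
From mathcomp Require Import measurable_realfun ring lra.
Set Implicit Arguments.
Unset Strict Implicit.
Unset Printing Implicit Defensive.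
Import Order.TTheory GRing.Theory Num.Theory numFieldNormedType.Exports.
Local Open Scope classical_set_scope.
Local Open Scope ring_scope.

(** Mass balance gives [M(t) = M(0) - (total absorption before t)], so the limit
    mass exists.  The semigroup identity [h_2 = h_1 * h_1], tested on an
    approximate identity, first bounds [|h_1|_2] by Fatou's lemma at the origin and
    then [h_2] everywhere by Cauchy-Schwarz; by scaling [h_t <= C t^(-Q/2)].

    - [L^1] asymptotics: [u(t) - M_oo h_t] is a superposition, with weights [u_0]
      and [k u^p], of the differences [h_(t-s)(b^-1 a) - h_t(a)]; each of them tends
      to [0] in [L^1] by scaling and Scheffe's lemma, and has norm at most [2], so
      dominated convergence applies.  Interpolation with the [L^oo] bound gives [L^q].
    - [p > 1 + 2/Q]: since [u <= S(t)u_0 <= C t^(-Q/2)], the mass loses between [t]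
      and [2t] at most the fraction [C t^(1 - Q(p-1)/2)], which is geometric along
      [t = 2^j].
    - [p <= 1 + 2/Q]: for a level [l = e t^(-Q/2)] one has
      [u <= min(S(t)u_0, l) + l^(1-p) u^p].  If [M_oo > 0], the first term carries at
      most half of the mass for [e] small and [t] large, so [int u^p >= c / t]; then
      the mass loses a fixed amount on each [[t, 2t]], a contradiction. *)

(** * Lebesgue measure on the Heisenberg group *)

(** The record [heat_kernel] contains no pointwise bound, and its semigroup law concerns functions
    of C_0 only. Hence h_2 = h_1 * h_1 is used in integrated form, against dilates of a compactly
    supported function, which is cut out of u_0 itself.

    The other obstacle is measurability: u is continuous in time for the sup norm, k is merely
    measurable, and every exchange of integrals needs joint measurability in time and space.
    Continuous functions are therefore rounded to grids, and h is expressed through h_1 by scaling.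
    With kernel and absorption extended by 0, the Duhamel term is a single space-time integral of
    the same form as S(t)u_0, so both are handled as superpositions of kernels with an abstract
    weight.

    The exponent 1 + 2/Q is where t^(-Q(p-1)/2) becomes 1/t. Above it the relative losses on dyadic
    intervals are summable, but the first ones may exceed 1; extinction in finite time is excluded
    separately, by the boundedness of k and u. At equality, 1/t still integrates to a constant over
    [t, 2t], so the critical case belongs to the vanishing regime. *)

Section affine_change_of_variables.
Context {R : realType}.
Implicit Types (r c : R) (f : R -> \bar R).
Local Open Scope ereal_scope.

Lemma measurable_affine r c :
  measurable_fun [set: R] (fun x : R => r * x + c : R)%R.
Proof. by apply: measurable_funD => //; exact: measurable_funM. Qed.

(** Uniqueness of Lebesgue measure: [r] times the pushforward by x -> rx + c gives each interval ]a,
    b] its length. *)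
Lemma lebesgue_measure_affine r c (A : set R) : (0 < r)%R -> measurable A ->
  lebesgue_measure ((fun x => r * x + c)%R @^-1` A) =
    (r^-1)%:E * lebesgue_measure A.
Proof.
move=> r0 mA.
pose phi := (fun x => r * x + c : measurableTypeR R)%R.
have mphi : measurable_fun [set: measurableTypeR R] phi by exact: measurable_affine.
pose nu := mscale (NngNum (ltW r0))
  (measure_function_pushforward__canonical__measure_function_Measure
    (@lebesgue_measure R) mphi).
have -> : lebesgue_measure A = nu A.
  apply: lebesgue_measure_unique => // X [[a b]] _ <-.
  rewrite [RHS](_ : _ =
      r%:E * lebesgue_measure `](a - c) / r, (b - c) / r]%classic%R); last first.
    congr (_ * lebesgue_measure _).
    apply/seteqP; split => x /=; rewrite !in_itv/= /phi.
      by rewrite ltr_pdivrMr// ler_pdivlMr// ltrBlDr lerBrDr mulrC.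
    by rewrite ltr_pdivrMr// ler_pdivlMr// ltrBlDr lerBrDr mulrC.
  rewrite !lebesgue_measure_itv/= !lte_fin ltr_pM2r ?invr_gt0// ltrD2r.
  case: ifPn => ab; last by rewrite mule0.
  rewrite -EFinB -EFinM; congr EFin; field; exact/lt0r_neq0.
rewrite /nu /mscale/= muleA -EFinM mulVf ?mul1e//; exact: lt0r_neq0.
Qed.

Lemma ge0_integral_line_affine r c f : (0 < r)%R ->
  measurable_fun [set: R] f -> (forall x, 0 <= f x) ->
  \int[@lebesgue_line R]_x f (r * x + c)%R =
    (r^-1)%:E * \int[@lebesgue_line R]_x f x.
Proof.
move=> r0 mf f0; have mphi := measurable_affine r c.
rewrite -[LHS](ge0_integral_pushforward mphi lebesgue_line (D := setT))//.
have r1 : (0 <= r^-1)%R by rewrite invr_ge0 ltW.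
rewrite -(ge0_integral_mscale lebesgue_line measurableT (NngNum r1))//.
apply: eq_measure_integral => A mA _.
exact: lebesgue_measure_affine.
Qed.
End affine_change_of_variables.

Section lebesgue_row_change_of_variables.
Context {R : realType}.
Local Open Scope ereal_scope.

Lemma ge0_integral_lebesgue_row_cons m (f : 'rV[R]_m.+1 -> \bar R) :
  measurable_fun setT f -> (forall v, 0 <= f v) ->
  \int[lebesgue_row m.+1]_v f v =
    \int[lebesgue_line]_x \int[lebesgue_row m]_v f (row_cons (x, v)).
Proof.
move=> mf f0.
rewrite [LHS](ge0_integral_pushforward (@measurable_row_cons R m)
  (lebesgue_line \x lebesgue_row m) (D := setT))//.
rewrite preimage_setT fubini_tonelli1//=.
  exact: measurableT_comp mf (@measurable_row_cons R m).
Qed.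

Lemma measurable_row_affine m (r : R) (c : 'rV[R]_m) :
  measurable_fun setT (fun v : 'rV[R]_m => r *: v + c)%R.
Proof.
apply: measurable_fun_row => i; under eq_fun do rewrite !mxE.
apply: measurable_funD => //; apply: measurable_funM => //.
exact: measurable_row_coord.
Qed.

Lemma row_cons_affine m (r x : R) (v : 'rV[R]_m) (c : 'rV[R]_m.+1) :
  (r *: row_cons (x, v) + c = row_cons
    (r * x + (row_uncons c).1, r *: v + (row_uncons c).2))%R.
Proof.
apply/rowP => i; rewrite !mxE /=; case: (unliftP ord0 i) => [j|] -> /=.
  by rewrite !mxE.
by [].
Qed.

(** These maps act coordinatewise, so induction splits off the first coordinate and each dimension
    contributes one factor 1/r. *)
Lemma ge0_integral_row_affine m (r : R) (c : 'rV[R]_m) (f : 'rV[R]_m -> \bar R) :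
  (0 < r)%R -> measurable_fun setT f -> (forall v, 0 <= f v) ->
  \int[lebesgue_row m]_v f (r *: v + c)%R =
    (r ^- m)%:E * \int[lebesgue_row m]_v f v.
Proof.
move=> r0; elim: m c f => [|m IHm] c f mf f0.
  rewrite expr0 invr1 mul1e; apply: eq_integral => v _; congr f.
  by apply/rowP => -[].
have mfc : measurable_fun setT (fun v : 'rV[R]_m.+1 => f (r *: v + c)%R).
  exact: measurableT_comp mf (measurable_row_affine r c).
have mfr : measurable_fun setT (fun z : R * 'rV[R]_m => f (row_cons z)).
  exact: measurableT_comp mf (@measurable_row_cons R m).
have mF : measurable_fun setT
    (fun x => \int[lebesgue_row m]_v f (row_cons (x, v))).
  exact: (measurable_fun_fubini_tonelli_F
    (m2 := lebesgue_row m) (fun z => f (row_cons z))).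
rewrite !ge0_integral_lebesgue_row_cons//.
under eq_integral do under eq_integral do rewrite row_cons_affine.
under eq_integral => x _.
  rewrite (IHm _ (fun v => f (row_cons (r * x + (row_uncons c).1, v))))%R//.
    over.
  exact: (measurableT_comp mfr (measurable_pair1 _)).
have r0m : 0 <= (r ^- m)%:E by rewrite lee_fin invr_ge0 exprn_ge0// ltW.
have F0 x : 0 <= \int[lebesgue_row m]_v f (row_cons (x, v)) by exact: integral_ge0.
rewrite [LHS](ge0_integralZl lebesgue_line measurableT
  (measurableT_comp mF (measurable_affine r (row_uncons c).1)) (fun x _ => F0 _) r0m).
rewrite (ge0_integral_line_affine _ r0 mF F0).
by rewrite muleA -EFinM -invfM exprSr.
Qed.

End lebesgue_row_change_of_variables.

(* A named product measure, so that canonical inference sees that it is again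
   sigma-finite. *)
Section sigma_finite_product.
Context d1 d2 (T1 : measurableType d1) (T2 : measurableType d2) (R : realType).
Variables (m1 : {sigma_finite_measure set T1 -> \bar R})
          (m2 : {sigma_finite_measure set T2 -> \bar R}).

Definition prod_measure : set (T1 * T2) -> \bar R := (m1 \x m2)%E.

HB.instance Definition _ := Measure.on prod_measure.

Let prod_measure_sigma_finite : sigma_finite setT prod_measure.
Proof. by apply: product_measure1_sigma_finite; exact: sigma_finiteT. Qed.

HB.instance Definition _ := Measure_isSigmaFinite.Build _ _ _ prod_measure
  prod_measure_sigma_finite.

End sigma_finite_product.

Section lebesgue_heis_change_of_variables.
Context {R : realType} {n : nat}.
Implicit Types (a b : heis R n) (f : heis R n -> \bar R).
Local Open Scope ereal_scope.

Lemma ge0_integral_lebesgue_heis f : measurable_fun setT f ->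
  (forall a, 0 <= f a) ->
  \int[lebesgue_heis]_a f a = \int[lebesgue_row n]_x \int[lebesgue_row n]_y
    \int[lebesgue_line]_t f (x, y, t).
Proof.
move=> mf f0.
pose g z := \int[lebesgue_line]_t f (z, t).
have mg : measurable_fun setT g.
  exact: (measurable_fun_fubini_tonelli_F (m2 := lebesgue_line) f).
rewrite [LHS](fubini_tonelli1
  (m1 := prod_measure (lebesgue_row n) (lebesgue_row n))
  (m2 := lebesgue_line) f mf)//.
rewrite [LHS](fubini_tonelli1 g mg)// => z; exact: integral_ge0.
Qed.

Lemma measurable_dot d (T : measurableType d) (g h : T -> 'rV[R]_n) :
  measurable_fun setT g -> measurable_fun setT h ->
  measurable_fun setT (fun z => dot (g z) (h z)).
Proof.
move=> mg mh; rewrite /dot; apply: measurable_sum => i; apply: measurable_funM.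
  exact: measurableT_comp (measurable_row_coord i) mg.
exact: measurableT_comp (measurable_row_coord i) mh.
Qed.

Lemma measurable_funD_row d (T : measurableType d) (g h : T -> 'rV[R]_n) :
  measurable_fun setT g -> measurable_fun setT h ->
  measurable_fun setT (fun z => g z + h z)%R.
Proof.
move=> mg mh; apply: measurable_fun_row => i; under eq_fun do rewrite mxE.
apply: measurable_funD.
  exact: measurableT_comp (measurable_row_coord i) mg.
exact: measurableT_comp (measurable_row_coord i) mh.
Qed.

Lemma measurable_funZ_row d (T : measurableType d) (r : T -> R) (g : T -> 'rV[R]_n) :
  measurable_fun setT r ->
  measurable_fun setT g ->
  measurable_fun setT (fun z => r z *: g z)%R.
Proof.
move=> mr mg; apply: measurable_fun_row => i; under eq_fun do rewrite mxE.
apply: measurable_funM => //.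
exact: measurableT_comp (measurable_row_coord i) mg.
Qed.

Lemma measurable_hmul d (T : measurableType d) (g h : T -> heis R n) :
  measurable_fun setT g -> measurable_fun setT h ->
  measurable_fun setT (fun z => hmul (g z) (h z)).
Proof.
move=> mg mh.
have mg1 := measurableT_comp measurable_fst mg.
have mh1 := measurableT_comp measurable_fst mh.
apply/measurable_fun_pairP; split; first apply/measurable_fun_pairP; first split.
- apply: measurable_funD_row.
    exact: measurableT_comp measurable_fst mg1.
  exact: measurableT_comp measurable_fst mh1.
- apply: measurable_funD_row.
    exact: measurableT_comp measurable_snd mg1.
  exact: measurableT_comp measurable_snd mh1.
- apply: measurable_funD; first apply: measurable_funD.
  + exact: measurableT_comp measurable_snd mg.
  + exact: measurableT_comp measurable_snd mh.
  + apply: measurable_funM => //; apply: measurable_funB; apply: measurable_dot.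
    * exact: measurableT_comp measurable_fst mg1.
    * exact: measurableT_comp measurable_snd mh1.
    * exact: measurableT_comp measurable_fst mh1.
    * exact: measurableT_comp measurable_snd mg1.
Qed.

Lemma measurable_hdil d (T : measurableType d) (r : T -> R) (g : T -> heis R n) :
  measurable_fun setT r ->
  measurable_fun setT g -> measurable_fun setT (fun z => hdil (r z) (g z)).
Proof.
move=> mr mg.
have mg1 := measurableT_comp measurable_fst mg.
apply/measurable_fun_pairP; split; first apply/measurable_fun_pairP; first split.
- apply: measurable_funZ_row => //.
  exact: measurableT_comp measurable_fst mg1.
- apply: measurable_funZ_row => //.
  exact: measurableT_comp measurable_snd mg1.
- apply: measurable_funM; first exact: measurable_funX.
  exact: measurableT_comp measurable_snd mg.
Qed.

Lemma measurable_hopp d (T : measurableType d) (g : T -> heis R n) :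
  measurable_fun setT g -> measurable_fun setT (fun z => - g z)%R.
Proof.
move=> mg.
rewrite (_ : (fun z => _) =
    fun z => (((-1) *: (g z).1.1, (-1) *: (g z).1.2, -1 * (g z).2) : heis R n))%R.
  have mg1 := measurableT_comp measurable_fst mg.
  apply/measurable_fun_pairP; split; first apply/measurable_fun_pairP; first split.
  - apply: measurable_funZ_row => //.
    exact: measurableT_comp measurable_fst mg1.
  - apply: measurable_funZ_row => //.
    exact: measurableT_comp measurable_snd mg1.
  - apply: measurable_funM => //.
    exact: measurableT_comp measurable_snd mg.
by apply/funext => z; case: (g z) => -[x y] t /=; rewrite !scaleN1r mulN1r.
Qed.

(** For fixed x and y the twisted term of the group law is a constant, so left translation is a
    translation in tau, then in y, then in x. *)
Lemma ge0_integral_hmul b f : measurable_fun setT f -> (forall a, 0 <= f a) ->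
  \int[lebesgue_heis]_a f (hmul b a) = \int[lebesgue_heis]_a f a.
Proof.
move=> mf f0.
have mfb : measurable_fun setT (fun a : heis R n => f (hmul b a)).
  by apply: (measurableT_comp mf); exact: measurable_hmul.
rewrite (ge0_integral_lebesgue_heis mf f0).
rewrite (ge0_integral_lebesgue_heis mfb (fun a => f0 _)).
pose g z := \int[lebesgue_line]_t f (z, t).
have mg : measurable_fun setT g.
  exact: (measurable_fun_fubini_tonelli_F (m2 := lebesgue_line) f).
have g0 z : 0 <= g z by exact: integral_ge0.
pose k x := \int[lebesgue_row n]_y g (x, y).
have mk : measurable_fun setT k.
  exact: (measurable_fun_fubini_tonelli_F (m2 := lebesgue_row n) g).
have k0 x : 0 <= k x by exact: integral_ge0.
transitivity (\int[lebesgue_row n]_x k (1 *: x + b.1.1)%R); last first.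
  by rewrite (ge0_integral_row_affine _ ltr01 mk k0) expr1n invr1 mul1e.
apply: eq_integral => x _.
transitivity (\int[lebesgue_row n]_y g (1 *: x + b.1.1, 1 *: y + b.1.2)%R);
  last first.
  have mgx : measurable_fun setT (fun y => g (1 *: x + b.1.1, y)%R).
    exact: (measurableT_comp mg (measurable_pair1 _)).
  rewrite (ge0_integral_row_affine _ ltr01 mgx (fun y => g0 _)).
  by rewrite expr1n invr1 mul1e.
apply: eq_integral => y _.
have mft z : measurable_fun setT (fun t => f (z, t)).
  exact: (measurableT_comp mf (measurable_pair1 _)).
rewrite -[RHS]mul1e -{1}(@invr1 R).
rewrite -(ge0_integral_line_affine (b.2 + 2 * (dot b.1.1 y - dot x b.1.2))%R
  ltr01 (mft _) (fun t => f0 _)).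
apply: eq_integral => t _; congr f.
by rewrite /hmul/= !scale1r mul1r ![(b.1.1 + _)%R]addrC ![(b.1.2 + _)%R]addrC
  addrA (addrC b.2).
Qed.

(** The factors are r^-2 from tau and r^-n from each of y and x; their product is r^-Q. *)
Lemma ge0_integral_hdil (r : R) f : (0 < r)%R ->
  measurable_fun setT f -> (forall a, 0 <= f a) ->
  \int[lebesgue_heis]_a f (hdil r a) =
    (r ^- hdim n)%:E * \int[lebesgue_heis]_a f a.
Proof.
move=> r0 mf f0.
have mfb : measurable_fun setT (fun a : heis R n => f (hdil r a)).
  apply: (measurableT_comp mf).
  exact: measurable_hdil.
rewrite (ge0_integral_lebesgue_heis mf f0).
rewrite (ge0_integral_lebesgue_heis mfb (fun a => f0 _)).
pose g z := \int[lebesgue_line]_t f (z, t).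
have mg : measurable_fun setT g.
  exact: (measurable_fun_fubini_tonelli_F (m2 := lebesgue_line) f).
have g0 z : 0 <= g z by exact: integral_ge0.
pose k x := \int[lebesgue_row n]_y g (x, y).
have mk : measurable_fun setT k.
  exact: (measurable_fun_fubini_tonelli_F (m2 := lebesgue_row n) g).
have k0 x : 0 <= k x by exact: integral_ge0.
have rV (m : nat) : 0 <= (r ^- m)%:E by rewrite lee_fin invr_ge0 exprn_ge0// ltW.
transitivity (\int[lebesgue_row n]_x ((r ^- (n + 2))%:E * k (r *: x + 0)%R));
    last first.
  rewrite [LHS](ge0_integralZl (lebesgue_row n) measurableT
    (measurableT_comp mk (measurable_row_affine r 0)) (fun x _ => k0 _) (rV _)).
  rewrite (ge0_integral_row_affine _ r0 mk k0) muleA -EFinM -invfM -exprD.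
  by rewrite /hdim mul2n -addnn addnAC.
apply: eq_integral => x _.
transitivity (\int[lebesgue_row n]_y ((r ^- 2)%:E * g (r *: x + 0, r *: y + 0)%R));
    last first.
  have mgx : measurable_fun setT (fun y => g (r *: x + 0, y)%R).
    exact: (measurableT_comp mg (measurable_pair1 _)).
  rewrite [LHS](ge0_integralZl (lebesgue_row n) measurableT
    (measurableT_comp mgx (measurable_row_affine r 0)) (fun y _ => g0 _) (rV _)).
  rewrite (ge0_integral_row_affine _ r0 mgx (fun y => g0 _)).
  by rewrite muleA -EFinM -invfM -exprD addnC.
apply: eq_integral => y _.
have mft z : measurable_fun setT (fun t => f (z, t)).
  exact: (measurableT_comp mf (measurable_pair1 _)).
rewrite -(ge0_integral_line_affine 0%R (exprn_gt0 2 r0) (mft _) (fun t => f0 _)).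
by apply: eq_integral => t _; congr f; rewrite /hdil/= !addr0.
Qed.

End lebesgue_heis_change_of_variables.

(* A continuous function is the limit of its compositions with rounding to finer and
   finer grids, each of which factors through a countable type. *)
Section countable_discretization.
Context {R : realType}.

Lemma measurable_fun_countable_param d (T : measurableType d) (C : countType)
    (code : T -> C) (F : C -> T -> R) :
  (forall c, measurable (code @^-1` [set c])) ->
  (forall c, measurable_fun setT (F c)) ->
  measurable_fun setT (fun x => F (code x) x).
Proof.
move=> mcode mF _ Y mY; rewrite setTI.
rewrite (_ : _ @^-1` Y = \bigcup_c (code @^-1` [set c] `&` F c @^-1` Y)).
  apply: countable_bigcupT_measurable => [|c]; first exact: countableP.
  apply: measurableI => //; rewrite -[X in measurable X]setTI; exact: mF.
apply/seteqP; split => [x Yx|x [c _ [/= <-]]]; last by [].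
by exists (code x).
Qed.

Definition grid_floor (m : nat) (x : R) : int := Num.floor (x * m.+1%:R).

Definition grid_round m (z : int) : R := z%:~R / m.+1%:R.

Lemma cvg_grid_round x : grid_round m (grid_floor m x) @[m --> \oo] --> x.
Proof.
apply/cvgrPdist_le => e e0; near=> m.
rewrite /grid_round /grid_floor.
have m0 : 0 < m.+1%:R :> R by [].
have /andP[lex ltx] := floor_itv (x * m.+1%:R).
have -> : x - (Num.floor (x * m.+1%:R))%:~R / m.+1%:R =
    (x * m.+1%:R - (Num.floor (x * m.+1%:R))%:~R) / m.+1%:R.
  by field; rewrite lt0r_neq0.
rewrite ger0_norm ?divr_ge0 ?subr_ge0//.
apply: (@le_trans _ _ m.+1%:R^-1).
  rewrite ler_pdivrMr// mulVf ?gt_eqF// lerBlDl.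
  by move: ltx; rewrite intrD => /ltW.
apply/ltW; near: m; exact: (near_infty_natSinv_lt (PosNum e0)).
Unshelve. all: by end_near. Qed.

Lemma measurable_grid_floor m (z : int) : measurable (grid_floor m @^-1` [set z]).
Proof.
rewrite (_ : _ @^-1` _ = (fun x : R => m.+1%:R * x + 0) @^-1` `[z%:~R, (z + 1)%:~R[).
  by rewrite -[X in measurable X]setTI; exact: measurable_affine.
apply/seteqP; split => x; rewrite /grid_floor/= in_itv/= addr0 (mulrC m.+1%:R).
  by move=> <-; exact: floor_itv.
exact: floor_def.
Qed.

Lemma cvg_row T (F : set_system T) (FF : Filter F) n (g : T -> 'rV[R]_n) (v : 'rV[R]_n) :
  (forall i, g z ord0 i @[z --> F] --> v ord0 i) -> g z @[z --> F] --> v.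
Proof.
move=> gv; apply/cvg_ballP => e e0.
suff : \forall z \near F, forall i, ball (v ord0 i) e (g z ord0 i).
  apply: filterS => z vz; split => // i j; rewrite !ord1; exact: vz.
apply: filter_forall => i; move/cvg_ballP : (gv i); exact.
Qed.

End countable_discretization.

(** * Topology of the Heisenberg group and its coordinate sigma-algebra *)

Section heisenberg_continuity.
Context {R : realType} {n : nat}.
Implicit Types (f : heis R n -> R).

Definition heis_floor m (a : heis R n) : 'rV[int]_n * 'rV[int]_n * int :=
  (map_mx (grid_floor m) a.1.1, map_mx (grid_floor m) a.1.2, grid_floor m a.2).

Definition heis_round m (c : 'rV[int]_n * 'rV[int]_n * int) : heis R n :=
  (map_mx (grid_round m) c.1.1, map_mx (grid_round m) c.1.2, grid_round m c.2).

Lemma measurable_heis_floor m c : measurable (heis_floor m @^-1` [set c]).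
Proof.
have mrow d (T : measurableType d) (g : T -> 'rV[R]_n) (z : 'rV[int]_n) :
    measurable_fun setT g ->
    measurable [set x | map_mx (grid_floor m) (g x) = z].
  move=> mg.
  rewrite (_ : [set x | _] =
      \bigcap_(i in [set: 'I_n]) (fun x => g x ord0 i) @^-1`
        (grid_floor m @^-1` [set z ord0 i])).
    apply: fin_bigcap_measurable => // i _; rewrite -[X in measurable X]setTI.
    apply: (measurableT_comp (measurable_row_coord i) mg) => //.
    exact: measurable_grid_floor.
  apply/seteqP; split => x /=; first by move=> <- i _ /=; rewrite mxE.
  by move=> xz; apply/rowP => i; rewrite mxE; exact: xz.
case: c => -[c1 c2] c3.
rewrite (_ : _ @^-1` _ =
    [set a : heis R n | map_mx (grid_floor m) a.1.1 = c1] `&`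
    [set a : heis R n | map_mx (grid_floor m) a.1.2 = c2] `&`
    snd @^-1` (grid_floor m @^-1` [set c3])).
  apply: measurableI; first apply: measurableI.
  - apply: mrow; exact: (measurableT_comp measurable_fst measurable_fst).
  - apply: mrow; exact: (measurableT_comp measurable_snd measurable_fst).
  - rewrite -[X in measurable X]setTI; apply: measurable_snd => //.
    exact: measurable_grid_floor.
apply/seteqP; split => a /=; rewrite /heis_floor.
  by move=> [-> -> ->].
by move=> [[-> ->] ->].
Qed.

Lemma cvg_heis T (F : set_system T) (FF : Filter F) (g : T -> heis R n) (a : heis R n) :
  ((g z).1.1 @[z --> F] --> a.1.1) -> ((g z).1.2 @[z --> F] --> a.1.2) ->
  ((g z).2 @[z --> F] --> a.2) -> g z @[z --> F] --> a.
Proof.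
case: a => -[x y] t /= gx gy gt.
rewrite [X in X @ F](_ : _ = fun z => ((g z).1.1, (g z).1.2, (g z).2)).
  exact: cvg_pair (cvg_pair gx gy) gt.
by apply/funext => z; case: (g z) => -[].
Qed.

Lemma cvg_heis_round (a : heis R n) : heis_round m (heis_floor m a) @[m --> \oo] --> a.
Proof.
apply: cvg_heis; [apply: cvg_row => i|apply: cvg_row => i|] => /=.
- under eq_cvg do rewrite !mxE; exact: cvg_grid_round.
- under eq_cvg do rewrite !mxE; exact: cvg_grid_round.
- exact: cvg_grid_round.
Qed.

(** The sigma-algebra is generated by the coordinates, not by the open sets, so measurability is
    obtained by rounding to grids: the rounded function is constant on countably many measurable
    cells. *)
Lemma continuous_measurable_heis f : continuous f -> measurable_fun setT f.
Proof.
move=> cf; apply: (measurable_fun_cvg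
  (h := fun m a => f (heis_round m (heis_floor m a)))).
  move=> m; apply: (measurable_fun_countable_param
    (F := fun c _ => f (heis_round m c))) => //.
  exact: measurable_heis_floor.
move=> a _; apply: continuous_cvg; [exact: cf|exact: cvg_heis_round].
Qed.

Lemma cvg_heis_components T (F : set_system T) (FF : Filter F)
    (g : T -> heis R n) (a : heis R n) :
  g z @[z --> F] --> a -> [/\ (g z).1.1 @[z --> F] --> a.1.1,
  (g z).1.2 @[z --> F] --> a.1.2 & (g z).2 @[z --> F] --> a.2].
Proof.
move=> ga.
have g1 : (g z).1 @[z --> F] --> a.1 by apply: (cvg_comp _ _ ga); exact: cvg_fst.
split.
- by apply: (cvg_comp _ _ g1); exact: cvg_fst.
- by apply: (cvg_comp _ _ g1); exact: cvg_snd.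
- by apply: (cvg_comp _ _ ga); exact: cvg_snd.
Qed.

Lemma cvg_dot T (F : set_system T) (FF : Filter F) (g h : T -> 'rV[R]_n)
    (x y : 'rV[R]_n) :
  g z @[z --> F] --> x -> h z @[z --> F] --> y ->
  dot (g z) (h z) @[z --> F] --> dot x y.
Proof.
move=> gx hy; apply: cvg_big => [|i _]; first exact: add_continuous.
apply: cvgM.
  exact: (cvg_comp g (fun v : 'rV[R]_n => v ord0 i) gx (@coord_continuous _ _ _ _ _ x)).
exact: (cvg_comp h (fun v : 'rV[R]_n => v ord0 i) hy (@coord_continuous _ _ _ _ _ y)).
Qed.

Lemma cvg_hmul T (F : set_system T) (FF : Filter F) (g h : T -> heis R n)
    (a b : heis R n) :
  g z @[z --> F] --> a -> h z @[z --> F] --> b ->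
  hmul (g z) (h z) @[z --> F] --> hmul a b.
Proof.
move=> /cvg_heis_components[g1 g2 g3] /cvg_heis_components[h1 h2 h3].
apply: cvg_heis => /=; [exact: cvgD|exact: cvgD|].
apply: cvgD; first exact: cvgD.
by apply: cvgM; [exact: cvg_cst|apply: cvgB; exact: cvg_dot].
Qed.

Lemma cvg_hdil T (F : set_system T) (FF : Filter F) (r : T -> R) (r0 : R)
    (g : T -> heis R n) (a : heis R n) :
  r z @[z --> F] --> r0 -> g z @[z --> F] --> a ->
  hdil (r z) (g z) @[z --> F] --> hdil r0 a.
Proof.
move=> rr /cvg_heis_components[g1 g2 g3].
apply: cvg_heis => /=; [exact: cvgZ|exact: cvgZ|].
by apply: cvgM => //; exact: cvgM.
Qed.

End heisenberg_continuity.

Section nonnegative_integrals.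
Context d (T : measurableType d) (R : realType).
Variable mu : {measure set T -> \bar R}.
Local Open Scope ereal_scope.

Lemma ge0_integrable (f : T -> R) : measurable_fun setT f ->
  (forall x, 0 <= f x)%R -> \int[mu]_x (f x)%:E < +oo ->
  mu.-integrable setT (EFin \o f).
Proof.
move=> mf f0 foo; apply/integrableP; split; first exact/measurable_EFinP.
by under eq_integral => x _ do rewrite /= ger0_norm//.
Qed.

(* Scheffe's lemma: [|g - f| = g - f + 2 (f - g)^+], and [(f - g)^+ <= f]. *)
Lemma scheffe (f_ : nat -> T -> R) (f : T -> R) :
  (forall k, measurable_fun setT (f_ k)) -> measurable_fun setT f ->
  (forall k x, 0 <= f_ k x)%R -> (forall x, 0 <= f x)%R ->
  mu.-integrable setT (EFin \o f) ->
  (forall k, \int[mu]_x (f_ k x)%:E = \int[mu]_x (f x)%:E) ->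
  (forall x, f_ k x @[k --> \oo] --> f x) ->
  \int[mu]_x `|f_ k x - f x|%:E @[k --> \oo] --> 0.
Proof.
move=> mf_ mf f_0 f0 intf mass cvgf.
have ifin : \int[mu]_x (f x)%:E \is a fin_num by exact: integrable_fin_num.
pose g k x := ((`|f_ k x - f x| + (f x - f_ k x)) / 2)%R.
have mg k : measurable_fun setT (g k).
  apply: measurable_funM => //; apply: measurable_funD; last exact: measurable_funB.
  by apply: measurableT_comp => //; exact: measurable_funB.
have g0 k x : (0 <= g k x)%R.
  by rewrite divr_ge0//; have := ler_norm (f_ k x - f x)%R; lra.
have gf k x : (g k x <= f x)%R.
  rewrite /g ler_pdivrMr//; have := f_0 k x; have := f0 x.
  by case: (ler0P (f_ k x - f x)%R); lra.
have E k : \int[mu]_x `|f_ k x - f x|%:E = 2%:E * \int[mu]_x (g k x)%:E.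
  have mfE : measurable_fun setT (EFin \o f) by exact/measurable_EFinP.
  have mgE : measurable_fun setT (EFin \o g k) by exact/measurable_EFinP.
  have mabs : measurable_fun setT (fun x => `|f_ k x - f x|%:E).
    apply/measurable_EFinP; apply: measurableT_comp => //.
    exact: measurable_funB.
  have : \int[mu]_x (`|f_ k x - f x|%:E + (f x)%:E) =
         \int[mu]_x ((f_ k x)%:E + 2%:E * (g k x)%:E).
    apply: eq_integral => x _; rewrite -EFinM -!EFinD; congr EFin.
    by rewrite /g; field.
  rewrite (ge0_integralD mu measurableT _ mabs _ mfE); last 2 first.
  - by move=> x _; rewrite lee_fin.
  - by move=> x _; rewrite lee_fin.
  rewrite (ge0_integralD mu measurableT); last 4 first.
  - by move=> x _; rewrite lee_fin.
  - exact/measurable_EFinP.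
  - by move=> x _; rewrite -EFinM lee_fin mulr_ge0.
  - exact: measurable_funeM.
  rewrite mass (ge0_integralZl_EFin mu measurableT _ mgE)//; last first.
    by move=> x _; rewrite lee_fin.
  rewrite [in RHS]addeC => /(congr1 (fun z => z - \int[mu]_x (f x)%:E)).
  by rewrite !addeK.
rewrite (eq_cvg _ _ E) -(mule0 2%:E).
suff cvg0 : \int[mu]_x (g k x)%:E @[k --> \oo] --> 0 by
  exact: (@cvgeZl _ _ _ _ 0 2%:E isT cvg0).
have gto0 x : (g k x)%:E @[k --> \oo] --> 0.
  apply/fine_cvgP; split; first exact: nearW.
  have f_f : (f_ k x - f x)%R @[k --> \oo] --> (f x - f x)%R.
    by apply: cvgB => //; exact: cvg_cst.
  have -> : 0%R = ((`|f x - f x| + (f x - f x)) / 2)%R :> R.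
    by rewrite subrr normr0 addr0 mul0r.
  apply: cvgM; last exact: cvg_cst.
  apply: cvgD; first exact: cvg_norm.
  by apply: cvgB => //; exact: cvg_cst.
have mgE k : measurable_fun setT (EFin \o g k) by exact/measurable_EFinP.
have gle k x : setT x -> `|(g k x)%:E| <= (f x)%:E.
  by rewrite /= lee_fin ger0_norm.
have [_ _] := dominated_convergence measurableT mgE (measurable_cst 0)
  (aeW mu (fun x _ => gto0 x)) intf (aeW mu (fun x k => gle k x)).
by rewrite integral0.
Qed.

End nonnegative_integrals.

(** * The heat kernel *)

Section inverse_square_root.
Context {R : realType}.

(** The dilation factor that carries time t to time 1. As a real power it is measurable in t, and
    [isqrt_powR] turns its powers into powers of t. *)
Definition isqrt (t : R) : R := t `^ (- 2^-1).

Lemma isqrt_gt0 t : 0 < t -> 0 < isqrt t.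
Proof. by move=> t0; exact: powR_gt0. Qed.

Lemma sqr_isqrt t : 0 < t -> isqrt t ^+ 2 = t^-1.
Proof.
move=> t0; rewrite /isqrt expr2 -powRD; last by rewrite (gt_eqF t0) implybT.
by rewrite -opprD -[X in (X + X)]mul1r -splitr powR_inv1// ltW.
Qed.

Lemma isqrtE t : 0 <= t -> isqrt t = (Num.sqrt t)^-1.
Proof. by move=> t0; rewrite /isqrt powRN powR12_sqrt. Qed.

Lemma cvg_isqrt (F : set_system nat) (FF : Filter F) (t_ : nat -> R) (t : R) :
  0 < t -> t_ k @[k --> F] --> t -> isqrt (t_ k) @[k --> F] --> isqrt t.
Proof.
move=> t0 tt; rewrite (isqrtE (ltW t0)).
apply: cvg_trans.
  apply: (near_eq_cvg (f := fun k => (Num.sqrt (t_ k))^-1)).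
  near=> k; rewrite isqrtE// ltW//; near: k; exact: cvgr_gt tt _ t0.
apply: cvgV; first by rewrite gt_eqF// sqrtr_gt0.
apply: continuous_cvg => //; exact: sqrt_continuous.
Unshelve. all: by end_near. Qed.

Lemma cvg_sqr_isqrt_pinfty (t_ : nat -> R) :
  t_ k @[k --> \oo] --> +oo -> isqrt (t_ k) ^+ 2 @[k --> \oo] --> 0.
Proof.
move=> ty.
have t_gt0 : \forall k \near \oo, 0 < t_ k by exact: cvgry_gt.
have /(gtr0_cvgV0 t_gt0) tV := ty.
apply: cvg_trans tV; apply: near_eq_cvg; near=> k.
by rewrite sqr_isqrt//; near: k.
Unshelve. all: by end_near. Qed.

Lemma cvg_isqrt_pinfty (t_ : nat -> R) :
  t_ k @[k --> \oo] --> +oo -> isqrt (t_ k) @[k --> \oo] --> 0.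
Proof.
move=> /cvg_sqr_isqrt_pinfty t0; rewrite -(@sqrtr0 R).
have E k : isqrt (t_ k) = Num.sqrt (isqrt (t_ k) ^+ 2).
  by rewrite sqrtr_sqr ger0_norm// powR_ge0.
rewrite (eq_cvg _ _ E).
apply: continuous_cvg => //; exact: sqrt_continuous.
Qed.

End inverse_square_root.

Section heisenberg_algebra.
Context {R : realType} {n : nat}.
Implicit Types (a b : heis R n) (r s : R).

Lemma dotZl r (x y : 'rV[R]_n) : dot (r *: x) y = r * dot x y.
Proof. by rewrite /dot mulr_sumr; apply: eq_bigr => i _; rewrite mxE mulrA. Qed.

Lemma dotC (x y : 'rV[R]_n) : dot x y = dot y x.
Proof. by apply: eq_bigr => i _; rewrite mulrC. Qed.

Lemma dotZr r (x y : 'rV[R]_n) : dot x (r *: y) = r * dot x y.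
Proof. by rewrite dotC dotZl dotC. Qed.

Lemma dotNl (x y : 'rV[R]_n) : dot (- x) y = - dot x y.
Proof. by rewrite -scaleN1r dotZl mulN1r. Qed.

Lemma dotNr (x y : 'rV[R]_n) : dot x (- y) = - dot x y.
Proof. by rewrite dotC dotNl dotC. Qed.

Lemma dot0l (x : 'rV[R]_n) : dot 0 x = 0.
Proof. by rewrite -(scale0r (0 : 'rV[R]_n)) dotZl mul0r. Qed.

Lemma dot0r (x : 'rV[R]_n) : dot x 0 = 0.
Proof. by rewrite dotC dot0l. Qed.

Lemma hmul0l a : hmul 0 a = a.
Proof.
by case: a => -[x y] t; rewrite /hmul /= dot0l dot0r subrr mulr0 addr0 !add0r.
Qed.

Lemma hmul_hdil r a b : hmul (hdil r a) (hdil r b) = hdil r (hmul a b).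
Proof.
rewrite /hmul /hdil /= !dotZl !dotZr !scalerDr; congr (_, _, _); ring.
Qed.

Lemma hdilA r s a : hdil r (hdil s a) = hdil (r * s) a.
Proof. by rewrite /hdil /= !scalerA; congr (_, _, _); rewrite mulrA exprMn. Qed.

Lemma hdil1 a : hdil 1 a = a.
Proof. by case: a => -[x y] t; rewrite /hdil /= !scale1r expr1n mul1r. Qed.

Lemma hdil0 a : hdil 0 a = 0.
Proof. by rewrite /hdil !scale0r expr0n /= mul0r. Qed.

(** The inverse of b^-1 o a is a^-1 o b; with the symmetry of the kernel this exchanges source and
    target in [heat_ext_sym]. *)
Lemma hmulN a b : - hmul (- b) a = hmul (- a) b.
Proof.
case: a b => -[x y] t [[x' y'] t']; rewrite /hmul /=.
rewrite !dotNl !dotNr; congr (_, _, _).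
- by rewrite opprD opprK addrC.
- by rewrite opprD opprK addrC.
- by rewrite /=; ring.
Qed.

End heisenberg_algebra.

Section heat_kernel_theory.
Context {R : realType} {n : nat} (h : R -> heis R n -> R).
Hypothesis hk : heat_kernel h.
Implicit Types (a b : heis R n) (s t : R).

(* Extending the kernel by [0] to non-positive times makes the Duhamel integral
   over [0 < s < t] an integral over all [s > 0]. *)
Definition heat_ext t a := if 0 < t then h t a else 0.

Lemma heat_ext_ge0 t a : 0 <= heat_ext t a.
Proof. by rewrite /heat_ext; case: ifPn => // t0; exact: heat_kernel_ge0. Qed.

Lemma heat_ext_gt0 t a : 0 < t -> heat_ext t a = h t a.
Proof. by rewrite /heat_ext => ->. Qed.

Lemma continuous_heat_kernel t : 0 < t -> continuous (h t).
Proof. by move=> t0; exact: (heat_kernel_smooth hk t0 0%N). Qed.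

Lemma heat_ext_dil r t a : 0 < r ->
  heat_ext (r ^+ 2 * t) (hdil r a) = r ^- hdim n * heat_ext t a.
Proof.
move=> r0; rewrite /heat_ext pmulr_rgt0 ?exprn_gt0//.
by case: ifPn => t0; [exact: heat_kernel_dil|rewrite mulr0].
Qed.

(** Homogeneity with r = t^(1/2). The whole kernel is a rescaling of [h 1], which reduces joint
    measurability and continuity in time and space to the continuity of [h 1]. *)
Lemma heat_kernel_scale t a : 0 < t ->
  h t a = isqrt t ^+ hdim n * h 1 (hdil (isqrt t) a).
Proof.
move=> t0; have c0 := isqrt_gt0 t0.
have := @heat_ext_dil (isqrt t)^-1 1 (hdil (isqrt t) a).
rewrite invr_gt0 => /(_ c0).
rewrite hdilA mulVf ?gt_eqF// hdil1 mulr1 exprVn sqr_isqrt// invrK.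
by rewrite !heat_ext_gt0// -exprVn invrK.
Qed.

Lemma measurable_heat_ext d (T : measurableType d) (t : T -> R) (g : T -> heis R n) :
  measurable_fun setT t -> measurable_fun setT g ->
  measurable_fun setT (fun z => heat_ext (t z) (g z)).
Proof.
move=> mt mg.
rewrite (_ : (fun z => _) = fun z => if 0 < t z then
    isqrt (t z) ^+ hdim n * h 1 (hdil (isqrt (t z)) (g z)) else 0); last first.
  by apply/funext => z; rewrite /heat_ext; case: ifPn => // t0; exact: heat_kernel_scale.
have mi : measurable_fun setT (fun z => isqrt (t z)).
  exact: measurableT_comp (measurable_powR _) mt.
apply: measurable_fun_ifT; first exact: measurable_fun_ltr.
- apply: measurable_funM; first exact: measurable_funX.
  apply: (measurableT_comp (continuous_measurable_heis (continuous_heat_kernel ltr01))).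
  exact: measurable_hdil.
- exact: measurable_cst.
Qed.

Lemma cvg_heat_ext (t_ : nat -> R) (a_ : nat -> heis R n) (t : R)
    (a : heis R n) : 0 < t ->
  t_ k @[k --> \oo] --> t -> a_ k @[k --> \oo] --> a ->
  heat_ext (t_ k) (a_ k) @[k --> \oo] --> heat_ext t a.
Proof.
move=> t0 tt aa; rewrite heat_ext_gt0// heat_kernel_scale//.
apply: cvg_trans.
  apply: (near_eq_cvg (f := fun k =>
    isqrt (t_ k) ^+ hdim n * h 1 (hdil (isqrt (t_ k)) (a_ k)))).
  near=> k.
  have tk : 0 < t_ k by near: k; exact: cvgr_gt tt _ t0.
  by rewrite heat_ext_gt0// [RHS]heat_kernel_scale.
have ci : isqrt (t_ k) @[k --> \oo] --> isqrt t by exact: cvg_isqrt.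
apply: cvgM.
  exact: (cvg_comp _ (fun x : R => x ^+ hdim n) ci (@exprn_continuous _ _ _)).
apply: continuous_cvg; first exact: continuous_heat_kernel.
exact: cvg_hdil.
Unshelve. all: by end_near. Qed.

Lemma heat_ext_sym t a b : heat_ext t (hmul (- b) a) = heat_ext t (hmul (- a) b).
Proof.
rewrite -hmulN /heat_ext; case: ifPn => // t0.
by rewrite [RHS](heat_kernel_sym hk _ t0).
Qed.

Lemma heat_ext_mass t b : 0 < t ->
  (\int[lebesgue_heis]_a (heat_ext t (hmul b a))%:E = 1)%E.
Proof.
move=> t0.
have mh : measurable_fun setT (fun a => (heat_ext t a)%:E).
  apply/measurable_EFinP; exact: measurable_heat_ext.
rewrite (ge0_integral_hmul b mh) => [|a]; last by rewrite lee_fin heat_ext_ge0.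
by rewrite -(heat_kernel_mass hk t0); apply: eq_integral => a _; rewrite heat_ext_gt0.
Qed.

Lemma heat_ext_mass_le t b :
  (\int[lebesgue_heis]_a (heat_ext t (hmul b a))%:E <= 1)%E.
Proof.
have [t0|t0] := ltP 0 t; first by rewrite heat_ext_mass.
rewrite (_ : (fun a => _) = cst 0%E) ?integral0 ?lee01//.
by apply/funext => a; rewrite /heat_ext ltNge t0.
Qed.

End heat_kernel_theory.

(** * Long-time insensitivity of the kernel to its source *)

Section heat_kernel_asymptotics.
Context {R : realType} {n : nat} (h : R -> heis R n -> R).
Hypothesis hk : heat_kernel h.
Local Notation H := (heat_ext h).
Local Open Scope ereal_scope.

(** L^1 distance at time t between the kernel emitted at time s from the point -b and the kernel
    emitted at time 0 from the origin. *)
Definition heat_defect (t s : R) (b : heis R n) : \bar R :=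
  \int[lebesgue_heis]_a `|H (t - s) (hmul b a) - H t a|%:E.

Lemma measurable_heat_diff d (T : measurableType d) (t s : R)
    (r : T -> R) (g a : T -> heis R n) :
  measurable_fun setT r -> measurable_fun setT g -> measurable_fun setT a ->
  measurable_fun setT (fun z => `|H (t - r z) (hmul (g z) (a z)) - H s (a z)|%:E).
Proof.
move=> mr mg ma; apply/measurable_EFinP; apply: measurableT_comp => //.
apply: measurable_funB; apply: measurable_heat_ext => //.
- exact: measurable_funB.
- exact: measurable_hmul.
Qed.

(** Dilating by t^(1/2) brings time t to 1, replaces the delay s by s/t and contracts the point b by
    the ratio t^(-1/2): both shifts vanish as t grows. *)
Lemma heat_defect_scale t s b : (0 < t)%R ->
  heat_defect t s b = \int[lebesgue_heis]_a
    `|H (1 - s * isqrt t ^+ 2) (hmul (hdil (isqrt t) b) a) - H 1 a|%:E.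
Proof.
move=> t0; have c0 := isqrt_gt0 t0; set c := isqrt t in c0 *.
have c20 : (c^-1 ^+ 2 = t)%R by rewrite exprVn sqr_isqrt// invrK.
have ci0 : (0 < c^-1)%R by rewrite invr_gt0.
have mF : measurable_fun setT
    (fun a : heis R n => `|H (t - s) (hmul b a) - H t a|%:E).
  by apply: (measurable_heat_diff t t (measurable_cst s)).
have rV : (0 <= c^-1 ^+ hdim n)%R by rewrite exprn_ge0// ltW.
have := ge0_integral_hdil ci0 mF (fun a => normr_ge0 _).
move=> /(congr1 (fun z => (c^-1 ^+ hdim n)%:E * z)).
rewrite muleA -EFinM divff ?mul1e ?gt_eqF ?exprn_gt0//.
rewrite /heat_defect => <-.
have mG : measurable_fun setT
    (fun a : heis R n => `|H (t - s) (hmul b (hdil c^-1 a)) - H t (hdil c^-1 a)|%:E).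
  apply: (measurable_heat_diff t t (measurable_cst s)) => //; exact: measurable_hdil.
rewrite -(ge0_integralZl_EFin _ measurableT _ mG rV); last first.
  by move=> x _; rewrite lee_fin.
apply: eq_integral => a _.
have -> : (t - s = c^-1 ^+ 2 * (1 - s * c ^+ 2))%R.
  by rewrite mulrBr mulr1 mulrCA -exprMn mulVf ?gt_eqF// expr1n mulr1 c20.
have -> : hmul b (hdil c^-1 a) = hdil c^-1 (hmul (hdil c b) a).
  by rewrite -hmul_hdil hdilA mulVf ?gt_eqF// hdil1.
have -> : H t (hdil c^-1 a) = H (c^-1 ^+ 2 * 1) (hdil c^-1 a) by rewrite mulr1 c20.
rewrite !heat_ext_dil// -mulrBr normrM -EFinM mulrA.
by rewrite ger0_norm ?invr_ge0// divff ?mul1r ?gt_eqF ?exprn_gt0.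
Qed.

Lemma heat_defect_cvg s b (t_ : nat -> R) : t_ k @[k --> \oo] --> +oo%R ->
  heat_defect (t_ k) s b @[k --> \oo] --> 0.
Proof.
move=> ty.
pose th k : R := (1 - s * isqrt (t_ k) ^+ 2)%R.
have th1 : th k @[k --> \oo] --> (1 : R)%R.
  rewrite -[X in _ --> X]subr0 -(mulr0 s).
  apply: cvgB; first exact: cvg_cst.
  by apply: cvgM; [exact: cvg_cst|exact: cvg_sqr_isqrt_pinfty].
have t_gt0 : \forall k \near \oo, (0 < t_ k)%R by exact: cvgry_gt.
have th_gt0 : \forall k \near \oo, (0 < th k)%R by exact: cvgr_gt th1 _ ltr01.
have [N _ tN] := filterI t_gt0 th_gt0.
(* Scheffe's lemma asks for equal masses at every index, and [heat_ext] has mass 1 only at positive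
   times, so the sequence is started at [N]. *)
rewrite -(cvg_shiftn N).
rewrite (_ : (fun k => _) = fun k => \int[lebesgue_heis]_a
    `|H (th (k + N)%N) (hmul (hdil (isqrt (t_ (k + N)%N)) b) a) - H 1 a|%:E);
    last first.
  apply/funext => k; rewrite heat_defect_scale//.
  by have [] := tN (k + N)%N (leq_addl _ _).
have mass1 : \int[lebesgue_heis]_a (H 1 a)%:E = 1.
  rewrite -[RHS](heat_ext_mass hk 0%R ltr01).
  by apply: eq_integral => a _; rewrite hmul0l.
apply: scheffe.
- move=> k; apply: measurable_heat_ext => //; exact: measurable_hmul.
- exact: measurable_heat_ext.
- by move=> k a; exact: heat_ext_ge0.
- by move=> a; exact: heat_ext_ge0.
- apply: ge0_integrable; [exact: measurable_heat_ext| |by rewrite mass1 ltry].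
  by move=> a; exact: heat_ext_ge0.
- move=> k; rewrite heat_ext_mass ?mass1//.
  by have [] := tN (k + N)%N (leq_addl _ _).
- move=> a; apply: cvg_heat_ext => //.
  + by rewrite (cvg_shiftn N th).
  + rewrite -[X in _ --> X]hmul0l; apply: cvg_hmul; last exact: cvg_cst.
    rewrite -(hdil0 b); apply: cvg_hdil; last exact: cvg_cst.
    rewrite (cvg_shiftn N (isqrt \o t_)); exact: cvg_isqrt_pinfty.
Qed.

Lemma heat_defect_ge0 t s b : 0 <= heat_defect t s b.
Proof. by apply: integral_ge0 => a _; rewrite lee_fin. Qed.

Lemma heat_defect_le2 t s b : heat_defect t s b <= 2%:E.
Proof.
have m1 : measurable_fun setT (fun a : heis R n => (H (t - s) (hmul b a))%:E).
  apply/measurable_EFinP; apply: measurable_heat_ext => //; exact: measurable_hmul.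
have m2 : measurable_fun setT (fun a : heis R n => (H t a)%:E).
  by apply/measurable_EFinP; exact: measurable_heat_ext.
have h0 s' a : 0 <= (H s' a)%:E by rewrite lee_fin heat_ext_ge0.
apply: (@le_trans _ _ (\int[lebesgue_heis]_a
    ((H (t - s) (hmul b a))%:E + (H t a)%:E))).
  apply: ge0_le_integral => //.
  - by apply: (measurable_heat_diff t t (measurable_cst s)).
  - exact: emeasurable_funD.
  - move=> a _; rewrite -EFinD lee_fin (le_trans (ler_normB _ _))//.
    by rewrite !ger0_norm ?heat_ext_ge0.
rewrite (ge0_integralD _ measurableT (fun a _ => h0 _ _) m1 (fun a _ => h0 _ _) m2).
have -> : 2%:E = 1%:E + 1%:E :> \bar R by rewrite -EFinD; congr EFin; ring.
apply: leeD; first exact: heat_ext_mass_le.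
rewrite (_ : (fun a => _) = fun a => (H t (hmul 0%R a))%:E).
  exact: heat_ext_mass_le.
by apply/funext => a; rewrite hmul0l.
Qed.

Section weighted.
Context d (T : measurableType d) (mu : {sigma_finite_measure set T -> \bar R}).
Variables (w r : T -> R) (b : T -> heis R n).
Hypotheses (mw : measurable_fun setT w) (mr : measurable_fun setT r)
  (mb : measurable_fun setT b) (w0 : forall z, (0 <= w z)%R)
  (iw : mu.-integrable setT (EFin \o w)).

Lemma measurable_heat_defect t :
  measurable_fun setT (fun z => heat_defect t (r z) (- b z)%R).
Proof.
apply: (measurable_fun_fubini_tonelli_F (m2 := lebesgue_heis)
  (fun za : T * heis R n =>
    `|H (t - r za.1) (hmul (- b za.1)%R za.2) - H t za.2|%:E)) => //.
apply: (measurable_heat_diff t t (r := r \o fst) (g := fun za => - b za.1)%R) => //.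
- exact: measurableT_comp.
- apply: measurable_hopp; exact: measurableT_comp.
Qed.

(** The weight is abstract in order to serve twice: for u_0 on the group with [r] = 0, and for the
    absorption on space-time with [r] the time of emission. *)
Lemma weighted_heat_defect_cvg (t_ : nat -> R) :
  t_ k @[k --> \oo] --> +oo%R ->
  \int[mu]_z ((w z)%:E * heat_defect (t_ k) (r z) (- b z)%R) @[k --> \oo] --> 0.
Proof.
move=> ty.
have mwE : measurable_fun setT (EFin \o w) by exact/measurable_EFinP.
have m_ k : measurable_fun setT
    (fun z => (w z)%:E * heat_defect (t_ k) (r z) (- b z)%R).
  apply: emeasurable_funM => //; exact: measurable_heat_defect.
have c_ z : setT z -> (w z)%:E * heat_defect (t_ k) (r z) (- b z)%R @[k --> \oo] --> 0.
  move=> _; rewrite -(mule0 (w z)%:E).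
  exact: (@cvgeZl _ _ _ _ 0 (w z)%:E isT (heat_defect_cvg (r z) (- b z)%R ty)).
have b_ z k : setT z -> `|(w z)%:E * heat_defect (t_ k) (r z) (- b z)%R| <=
    2%:E * (w z)%:E.
  move=> _; rewrite gee0_abs ?mule_ge0 ?heat_defect_ge0 ?lee_fin// muleC.
  by apply: lee_wpmul2r; [rewrite lee_fin|exact: heat_defect_le2].
have i_ : mu.-integrable setT (fun z => 2%:E * (w z)%:E) by exact: integrableZl.
have [_ _] := dominated_convergence measurableT m_ (measurable_cst 0)
  (aeW mu c_) i_ (aeW mu b_).
by rewrite integral0.
Qed.

(** Minkowski's inequality by Tonelli: g - W h_t is the w-weighted integral of differences of two
    kernels, and integrating their absolute values in [a] first produces the defect. *)
Lemma weighted_heat_le (t W : R) (g : heis R n -> R) :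
  measurable_fun setT g ->
  \int[mu]_z (w z)%:E = W%:E ->
  (forall a, (g a)%:E = \int[mu]_z (w z * H (t - r z) (hmul (- b z)%R a))%:E) ->
  \int[lebesgue_heis]_a `|g a - W * H t a|%:E <=
    \int[mu]_z ((w z)%:E * heat_defect t (r z) (- b z)%R).
Proof.
move=> mg wW gE.
pose F (za : T * heis R n) :=
  (w za.1 * `|H (t - r za.1) (hmul (- b za.1)%R za.2) - H t za.2|)%:E.
have mF : measurable_fun setT F.
  apply/measurable_EFinP; apply: measurable_funM.
    exact: measurableT_comp.
  apply/measurable_EFinP.
  apply: (measurable_heat_diff t t (r := r \o fst) (g := fun za => - b za.1)%R) => //.
  - exact: measurableT_comp.
  - apply: measurable_hopp; exact: measurableT_comp.
have F0 za : 0 <= F za by rewrite lee_fin mulr_ge0.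
have mK a : measurable_fun setT (fun z => w z * H (t - r z) (hmul (- b z)%R a))%R.
  apply: measurable_funM => //; apply: measurable_heat_ext => //.
    exact: measurable_funB.
  apply: measurable_hmul => //; exact: measurable_hopp.
have K0 a z : (0 <= w z * H (t - r z) (hmul (- b z)%R a))%R.
  by rewrite mulr_ge0 ?heat_ext_ge0.
apply: (@le_trans _ _ (\int[lebesgue_heis]_a \int[mu]_z F (z, a))).
  apply: ge0_le_integral => //.
  - apply/measurable_EFinP; apply: measurableT_comp => //.
    apply: measurable_funB => //; apply: measurable_funM => //.
    exact: measurable_heat_ext.
  - exact: (measurable_fun_fubini_tonelli_G (m1 := mu) F).
  move=> a _.
  (* Integrability for every [a] comes from the representation itself: the integral equals the real
     number [g a]. *)
  have iK : mu.-integrable setT (fun z => (w z * H (t - r z) (hmul (- b z)%R a))%:E).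
    by apply: ge0_integrable => //; rewrite -gE ltry.
  have iH : mu.-integrable setT (fun z => (w z * H t a)%:E).
    rewrite (_ : (fun z => _) = fun z => (H t a)%:E * (w z)%:E); last first.
      by apply/funext => z; rewrite -EFinM mulrC.
    exact: integrableZl.
  rewrite (_ : `|g a - W * H t a|%:E = `|(g a - W * H t a)%:E|)//.
  have -> : (g a - W * H t a)%:E = \int[mu]_z
      ((w z * H (t - r z) (hmul (- b z)%R a))%:E - (w z * H t a)%:E).
    rewrite (integralB_EFin measurableT iK iH) -gE EFinB; congr (_ - _).
    rewrite EFinM -wW muleC.
    rewrite -(integralZl measurableT iw).
    by apply: eq_integral => z _; rewrite /= -EFinM mulrC.
  apply: (le_trans (le_abse_integral _ _ _)) => //.
    exact: emeasurable_funB (measurable_int _ iK) (measurable_int _ iH).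
  apply: ge0_le_integral => //.
  - apply: measurableT_comp => //.
    exact: emeasurable_funB (measurable_int _ iK) (measurable_int _ iH).
  - exact: (measurableT_comp mF (measurable_pair2 _)).
  - by move=> z _; rewrite -EFinB -mulrBr /= normrM ger0_norm.
rewrite -(fubini_tonelli (m1 := mu) (m2 := lebesgue_heis) F mF F0).
have : forall z, \int[lebesgue_heis]_a F (z, a) =
    (w z)%:E * heat_defect t (r z) (- b z)%R.
  move=> z; rewrite /heat_defect -(ge0_integralZl_EFin _ measurableT _ _ (w0 z)).
  - by apply: eq_integral => a _; rewrite -EFinM.
  - by move=> a _; rewrite lee_fin.
  - by apply: (measurable_heat_diff t t (measurable_cst (r z))).
by move=> E; under eq_integral => z _ do rewrite E.
Qed.

End weighted.
End heat_kernel_asymptotics.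

(** * A sup bound on the heat kernel *)

Section fatou_bound.
Context d (T : measurableType d) (R : realType).
Variable mu : {measure set T -> \bar R}.
Local Open Scope ereal_scope.

Lemma fatou_le (f_ : nat -> T -> \bar R) (f : T -> \bar R) (B : \bar R) :
  (forall k, measurable_fun setT (f_ k)) -> (forall k x, 0 <= f_ k x) ->
  (forall x, f_ k x @[k --> \oo] --> f x) ->
  (forall k, \int[mu]_x f_ k x <= B) -> \int[mu]_x f x <= B.
Proof.
move=> mf_ f_0 f_f leB.
rewrite (_ : f = fun x => limn_einf (f_^~ x)); last first.
  by apply/funext => x; have [-> _] := cvg_limn_einf_sup (f_f x).
apply: (le_trans (fatou mu measurableT mf_ (fun k x _ => f_0 k x))).
rewrite limn_einf_lim; apply: lime_le; first exact: is_cvg_einfs.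
apply: nearW => k; apply: le_trans (leB k).
by apply: ereal_inf_lbound; exists k => /=.
Qed.

End fatou_bound.

Section C0_functions.
Context {R : realType} {n : nat}.
Implicit Types (f : heis R n -> R).

Lemma compact_norm_bound (K : set (heis R n)) : compact K ->
  exists2 M : R, 0 < M & forall a, K a -> `|a| <= M.
Proof.
move=> /(@compact_bounded R (heis R n)) Kb.
have [M M0 KM] := pinfty_ex_gt0 Kb.
by exists M => // a Ka; exact: KM.
Qed.

Lemma continuous_compact_bound (K : set (heis R n)) f : continuous f ->
  compact K -> exists2 M : R, 0 < M & forall a, K a -> `|f a| <= M.
Proof.
move=> cf cK.
have cfK : compact (f @` K).
  by apply: continuous_compact => //; exact: continuous_subspaceT.
have [M M0 KM] := pinfty_ex_gt0 (@compact_bounded R R^o _ cfK).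
by exists M => // a Ka; apply: KM; exists a.
Qed.

Lemma C0_bound f : C0 f -> exists2 M : R, 0 < M & forall a, `|f a| <= M.
Proof.
move=> [cf] /(_ 1 ltr01)[K cK K1].
have [M M0 KM] := continuous_compact_bound cf cK.
exists (M + 1); first by rewrite addr_gt0.
move=> a; have [Ka|nKa] := pselect (K a).
  by apply: (le_trans (KM _ Ka)); rewrite lerDl.
by apply: (le_trans (ltW (K1 _ nKa))); rewrite lerDr ltW.
Qed.

Lemma continuous_hdil (r : R) : continuous (@hdil R n r).
Proof. by move=> a; apply: cvg_hdil; [exact: cvg_cst|exact: cvg_id]. Qed.

Lemma C0_hdil f (r : R) : 0 < r -> C0 f -> C0 (fun a => f (hdil r a)).
Proof.
move=> r0 [cf f0]; split.
  by move=> a; apply: continuous_comp; [exact: continuous_hdil|exact: cf].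
move=> e e0; have [K cK Ke] := f0 e e0.
exists (hdil r^-1 @` K).
  by apply: continuous_compact => //; apply: continuous_subspaceT; exact: continuous_hdil.
move=> a Ka; apply: Ke => Kr; apply: Ka; exists (hdil r a) => //.
by rewrite hdilA mulVf ?hdil1// gt_eqF.
Qed.

(** The vertical coordinate is scaled by r^2, and r^2 <= r because r <= 1. *)
Lemma norm_hdil_le (r : R) (a : heis R n) : 0 <= r <= 1 ->
  `|hdil r a| <= r * `|a|.
Proof.
move=> /andP[r0 r1]; case: a => -[x y] t.
rewrite !prod_normE /hdil /= !normrZ ?normrM ?normrX (ger0_norm r0).
rewrite ge_max; apply/andP; split.
  by rewrite -maxr_pMr// ler_wpM2l// le_max lexx.
rewrite -mulrA ler_wpM2l//.
apply: (@le_trans _ _ `|t|); first by rewrite ler_piMl.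
by rewrite le_max lexx orbT.
Qed.

End C0_functions.

Section heat_kernel_bound.
Context {R : realType} {n : nat} (h : R -> heis R n -> R).
Hypothesis hk : heat_kernel h.
Local Notation H := (heat_ext h).
Implicit Types (f : heis R n -> R) (a b : heis R n).
Local Open Scope ereal_scope.

Lemma measurable_heat_conv f t a : measurable_fun setT f ->
  measurable_fun setT (fun b => (f b * H t (hmul (- b) a))%:E).
Proof.
move=> mf; apply/measurable_EFinP; apply: measurable_funM => //.
apply: measurable_heat_ext => //; apply: measurable_hmul => //.
exact: measurable_hopp.
Qed.

(** The integral runs over the source [b]; symmetry turns it into an integral of the kernel over its
    target, of mass at most 1. *)
Lemma heat_conv_le f t a (M : R) : measurable_fun setT f ->
  (forall b, 0 <= f b <= M)%R ->
  \int[lebesgue_heis]_b (f b * H t (hmul (- b) a))%:E <= M%:E.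
Proof.
move=> mf fM.
have M0 : (0 <= M)%R by have /andP[] := fM 0%R; exact: le_trans.
have mK : measurable_fun setT (fun b => (H t (hmul (- a) b))%:E).
  apply/measurable_EFinP; apply: measurable_heat_ext => //; exact: measurable_hmul.
apply: (@le_trans _ _ (\int[lebesgue_heis]_b (M%:E * (H t (hmul (- a) b))%:E))).
  apply: ge0_le_integral => //.
  - by move=> b _; rewrite lee_fin mulr_ge0 ?heat_ext_ge0//; have /andP[] := fM b.
  - exact: measurable_heat_conv.
  - exact: measurable_funeM.
  - move=> b _; rewrite -EFinM lee_fin heat_ext_sym// ler_wpM2r ?heat_ext_ge0//.
    by have /andP[] := fM b.
rewrite (ge0_integralZl_EFin _ measurableT _ mK M0); last first.
  by move=> b _; rewrite lee_fin heat_ext_ge0.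
rewrite -[leRHS]mule1; apply: lee_wpmul2l; first by rewrite lee_fin.
exact: heat_ext_mass_le.
Qed.

(** The semigroup is defined by a real-valued integral, whose value is 0 when the true integral is
    infinite; the finiteness hypothesis rules this out. *)
Lemma heat_semigroupE f t a : (0 < t)%R ->
  (forall b, 0 <= f b)%R ->
  \int[lebesgue_heis]_b (f b * H t (hmul (- b) a))%:E < +oo ->
  (heat_semigroup h t f a)%:E =
    \int[lebesgue_heis]_b (f b * H t (hmul (- b) a))%:E.
Proof.
move=> t0 f0 foo; rewrite /heat_semigroup (gt_eqF t0) /Rintegral.
under [in LHS]eq_integral => b _ do rewrite -(heat_ext_gt0 h _ t0).
rewrite fineK// ge0_fin_numE//; apply: integral_ge0 => b _.
by rewrite lee_fin mulr_ge0 ?heat_ext_ge0.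
Qed.

(** The kernel of S(1)S(1) from [b] to [a]. It is compared with h_2 only after integration in [b]
    against a C_0 function. *)
Definition heat_conv2 b a : \bar R :=
  \int[lebesgue_heis]_c (H 1 (hmul (- b) c) * H 1 (hmul (- c) a))%:E.

Lemma measurable_heat_conv2_kernel a : measurable_fun setT
  (fun bc : heis R n * heis R n =>
    H 1 (hmul (- bc.1) bc.2) * H 1 (hmul (- bc.2) a))%R.
Proof.
apply: measurable_funM; apply: measurable_heat_ext => //;
  apply: measurable_hmul => //; apply: measurable_hopp;
  [exact: measurable_fst|exact: measurable_snd].
Qed.

Lemma measurable_heat_conv2 a : measurable_fun setT (heat_conv2 ^~ a).
Proof.
apply: (measurable_fun_fubini_tonelli_F (m2 := lebesgue_heis)
  (fun bc : heis R n * heis R n =>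
    (H 1 (hmul (- bc.1) bc.2) * H 1 (hmul (- bc.2) a))%:E)).
- by apply/measurable_EFinP; exact: measurable_heat_conv2_kernel.
- by move=> bc; rewrite lee_fin mulr_ge0// heat_ext_ge0.
Qed.

Lemma heat_semigroup2 f a : C0 f -> (forall b, 0 <= f b)%R ->
  \int[lebesgue_heis]_b (f b * H 2 (hmul (- b) a))%:E =
  \int[lebesgue_heis]_b ((f b)%:E * heat_conv2 b a).
Proof.
move=> cf f0; have [M M0 fM] := C0_bound cf.
have mf := continuous_measurable_heis cf.1.
have fM' b : (0 <= f b <= M)%R by rewrite f0 (le_trans (ler_norm _) (fM b)).
have f_fin t c : \int[lebesgue_heis]_b (f b * H t (hmul (- b) c))%:E < +oo.
  exact: le_lt_trans (heat_conv_le t c mf fM') (ltry _).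
pose g := heat_semigroup h 1 f.
have gE c : (g c)%:E = \int[lebesgue_heis]_b (f b * H 1 (hmul (- b) c))%:E.
  exact: heat_semigroupE.
have g0 c : (0 <= g c)%R.
  rewrite -lee_fin gE; apply: integral_ge0 => b _.
  by rewrite lee_fin mulr_ge0 ?heat_ext_ge0.
(* S(1) is applied a second time, to [g]; this bound makes that convolution finite. *)
have gM c : (0 <= g c <= M)%R by rewrite g0 -lee_fin gE; exact: heat_conv_le.
pose F (bc : heis R n * heis R n) :=
  (f bc.1 * (H 1 (hmul (- bc.1) bc.2) * H 1 (hmul (- bc.2) a)))%:E.
have mF : measurable_fun setT F.
  apply/measurable_EFinP; apply: measurable_funM.
    exact: measurableT_comp mf measurable_fst.
  exact: measurable_heat_conv2_kernel.
have F0 z : 0 <= F z by rewrite lee_fin !mulr_ge0 ?heat_ext_ge0.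
have mg : measurable_fun setT g.
  apply/measurable_EFinP.
  rewrite (_ : EFin \o g = fun c => \int[lebesgue_heis]_b (f b * H 1 (hmul (- b) c))%:E);
    last by apply/funext => c; exact: gE.
  apply: (measurable_fun_fubini_tonelli_G (m1 := lebesgue_heis)
    (fun bc : heis R n * heis R n => (f bc.1 * H 1 (hmul (- bc.1) bc.2))%:E)).
  - apply/measurable_EFinP; apply: measurable_funM.
      exact: measurableT_comp mf measurable_fst.
    apply: measurable_heat_ext => //; apply: measurable_hmul => //.
    by apply: measurable_hopp; exact: measurable_fst.
  - by move=> z; rewrite lee_fin mulr_ge0 ?heat_ext_ge0.
have l02 : (0 < 2 :> R)%R by [].
rewrite -(heat_semigroupE l02 f0 (f_fin 2%R a)).
rewrite (_ : (2 = 1 + 1 :> R)%R) // (heat_kernel_semigroup hk ler01 ler01 cf).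
rewrite (heat_semigroupE ltr01 g0); last first.
  exact: le_lt_trans (heat_conv_le 1 a mg gM) (ltry _).
transitivity (\int[lebesgue_heis]_c \int[lebesgue_heis]_b F (b, c)).
  apply: eq_integral => c _; rewrite EFinM gE.
  rewrite -(ge0_integralZr _ measurableT (measurable_heat_conv 1 c mf)).
  - by apply: eq_integral => b _; rewrite -EFinM /F /= mulrA.
  - by move=> b _; rewrite lee_fin mulr_ge0 ?heat_ext_ge0.
  - by rewrite lee_fin heat_ext_ge0.
rewrite -(fubini_tonelli (m1 := lebesgue_heis) (m2 := lebesgue_heis) F mF F0).
apply: eq_integral => b _.
rewrite /heat_conv2 -(ge0_integralZl_EFin _ measurableT _ _ (f0 b)).
- by apply: eq_integral => c _; rewrite -EFinM.
- by move=> c _; rewrite lee_fin mulr_ge0 ?heat_ext_ge0.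
- apply/measurable_EFinP; exact: (measurableT_comp
    (measurable_heat_conv2_kernel a) (measurable_pair1 _)).
Qed.

End heat_kernel_bound.

Section heat_kernel_sup.
Context {R : realType} {n : nat} (h : R -> heis R n -> R).
Hypothesis hk : heat_kernel h.
Local Notation H := (heat_ext h).
Implicit Types (f : heis R n -> R) (a b : heis R n).
Local Open Scope ereal_scope.

(** The squared L^2 norm of h_1; by symmetry it is also the value of h_1 * h_1 at the origin. *)
Definition heat_energy : \bar R := \int[lebesgue_heis]_c (H 1 c ^+ 2)%:E.

Lemma heat_energy_translate b :
  \int[lebesgue_heis]_c (H 1 (hmul b c) ^+ 2)%:E = heat_energy.
Proof.
apply: (ge0_integral_hmul b (f := fun c => (H 1 c ^+ 2)%:E)).
  by apply/measurable_EFinP; apply: measurable_funX; exact: measurable_heat_ext.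
by move=> c; rewrite lee_fin exprn_ge0 ?heat_ext_ge0.
Qed.

(** Translation invariance gives both squares the same integral, so 2XY <= X^2 + Y^2 yields the
    Cauchy-Schwarz constant, and it does so before the energy is known to be finite. *)
Lemma heat_conv2_le b a : heat_conv2 h b a <= heat_energy.
Proof.
have mH c0 : measurable_fun setT (fun c : heis R n => (2^-1 * H 1 (hmul c0 c) ^+ 2)%:E).
  apply/measurable_EFinP; apply: measurable_funM => //; apply: measurable_funX.
  by apply: measurable_heat_ext => //; exact: measurable_hmul.
have H0 c0 c : 0 <= (2^-1 * H 1 (hmul c0 c) ^+ 2)%:E.
  by rewrite lee_fin mulr_ge0 ?exprn_ge0 ?heat_ext_ge0.
have half c0 : \int[lebesgue_heis]_c (2^-1 * H 1 (hmul c0 c) ^+ 2)%:E =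
    2^-1%:E * heat_energy.
  rewrite -(heat_energy_translate c0).
  rewrite -(ge0_integralZl_EFin lebesgue_heis measurableT); last 3 first.
  - by move=> c _; rewrite lee_fin exprn_ge0 ?heat_ext_ge0.
  - apply/measurable_EFinP; apply: measurable_funX.
    by apply: measurable_heat_ext => //; exact: measurable_hmul.
  - by [].
  by apply: eq_integral => c _; rewrite EFinM.
apply: (@le_trans _ _ (\int[lebesgue_heis]_c
    ((2^-1 * H 1 (hmul (- b) c) ^+ 2)%:E + (2^-1 * H 1 (hmul (- a) c) ^+ 2)%:E))).
  apply: ge0_le_integral => //.
  - by move=> c _; rewrite lee_fin mulr_ge0 ?heat_ext_ge0.
  - apply/measurable_EFinP; exact: (measurableT_comp
      (measurable_heat_conv2_kernel hk a) (measurable_pair1 _)).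
  - exact: emeasurable_funD.
  - move=> c _; rewrite -EFinD lee_fin (heat_ext_sym hk 1 a c).
    (* AM-GM *)
    move: (H 1 (hmul (- b) c)%R) (H 1 (hmul (- a) c)%R) => X Y.
    have := sqr_ge0 (X - Y)%R; nra.
rewrite (ge0_integralD _ measurableT (fun c _ => H0 _ c) (mH _)
  (fun c _ => H0 _ c) (mH _)).
rewrite !half -ge0_muleDl ?lee_fin//.
by rewrite -EFinD -[X in (X + X)%R]mul1r -splitr mul1e.
Qed.

Section approximate_identity.
Variables (f : heis R n -> R) (K : set (heis R n)).
Hypotheses (Cf : C0 f) (f0 : forall a, (0 <= f a)%R) (cK : compact K)
  (fK : forall a, f a != 0%R -> K a)
  (f_gt0 : 0 < \int[lebesgue_heis]_a (f a)%:E)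
  (f_fin : \int[lebesgue_heis]_a (f a)%:E < +oo).

Let mf : measurable_fun setT f := continuous_measurable_heis Cf.1.

(** Averages against concentrating dilates of [f] are computed by keeping the weight [f] and
    contracting its argument, so that the weight does not depend on [k]. *)
Let dil (k : nat) b : heis R n := hdil k.+1%:R^-1 b.

Let mdil k : measurable_fun setT (dil k).
Proof. exact: measurable_hdil. Qed.

Let cvg_dil b : dil k b @[k --> \oo] --> (0 : heis R n)%R.
Proof.
rewrite -(hdil0 b); apply: cvg_hdil; [exact: cvg_harmonic|exact: cvg_cst].
Qed.

Let cvg_dilN b : (- dil k b)%R @[k --> \oo] --> (0 : heis R n)%R.
Proof. by rewrite -oppr0; apply: cvgN; exact: cvg_dil. Qed.

(** [heat_semigroup2] for the dilate f(hdil (k+1) b), again in C_0; the change of variables produces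
    the same Jacobian on both sides. *)
Lemma heat_semigroup2_dil k a :
  \int[lebesgue_heis]_b (f b * H 2 (hmul (- dil k b) a))%:E =
  \int[lebesgue_heis]_b ((f b)%:E * heat_conv2 h (dil k b) a).
Proof.
pose r : R := k.+1%:R; have r0 : (0 < r)%R by [].
have ri0 : (0 < r^-1)%R by rewrite invr_gt0.
have rK b : hdil r (dil k b) = b by rewrite hdilA divff ?hdil1// gt_eqF.
pose fr b := f (hdil r b).
have fr0 b : (0 <= fr b)%R by exact: f0.
have Cfr : C0 fr by exact: C0_hdil.
have mfr := continuous_measurable_heis Cfr.1.
have E := @heat_semigroup2 _ _ _ hk fr a Cfr (fun b => f0 _).
have m1 := measurable_heat_conv hk 2 a mfr.
have m2 : measurable_fun setT (fun b => (fr b)%:E * heat_conv2 h b a).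
  apply: emeasurable_funM; first exact/measurable_EFinP.
  exact: measurable_heat_conv2.
have p1 b : 0 <= (fr b * H 2 (hmul (- b) a))%:E.
  by rewrite lee_fin mulr_ge0 ?heat_ext_ge0.
have p2 b : 0 <= (fr b)%:E * heat_conv2 h b a.
  rewrite mule_ge0 ?lee_fin//; apply: integral_ge0 => c _.
  by rewrite lee_fin mulr_ge0 ?heat_ext_ge0.
have := ge0_integral_hdil ri0 m1 p1; have := ge0_integral_hdil ri0 m2 p2.
rewrite -E => <-.
under eq_integral => b _ do rewrite -/(dil k b) /fr rK.
by under [in RHS]eq_integral => b _ do rewrite -/(dil k b) /fr rK.
Qed.

(** The contracted points tend to 0 uniformly over the bounded set [K]; the margin 1 comes from the
    continuity of h_2 at 0. *)
Lemma near0_heat_le : exists N, forall k b, (N <= k)%N -> K b ->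
  (H 2 (- dil k b) <= H 2 0 + 1)%R.
Proof.
have l02 : (0 < 2 :> R)%R by [].
have [M M0 KM] := compact_norm_bound cK.
have cH : continuous (H 2).
  rewrite (_ : H 2 = h 2); first exact: continuous_heat_kernel.
  by apply/funext => a; rewrite heat_ext_gt0.
have /cvgrPdist_lt/(_ 1%R ltr01) := cH 0%R.
move=> /nbhs_ballP[e /= e0 He].
have Me : (0 < e / M)%R by rewrite divr_gt0.
have [N _ NP] := near_infty_natSinv_lt (PosNum Me).
exists N => k b Nk Kb.
have := He (- dil k b)%R; rewrite -ball_normE /= sub0r opprK.
have r1 : (0 <= (k.+1%:R : R)^-1 <= 1)%R.
  by rewrite invr_ge0 ler0n invf_le1// ler1n.
have -> : (`|dil k b| < e)%R.
  apply: (le_lt_trans (norm_hdil_le b r1)).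
  apply: (@le_lt_trans _ _ (k.+1%:R^-1 * M)%R).
    by rewrite ler_wpM2l// ?invr_ge0//; exact: KM.
  by rewrite -ltr_pdivlMr//; exact: NP.
move=> /(_ isT); rewrite ltr_norml => /andP[+ _]; lra.
Qed.

(* The averages of [heat_conv2 _ 0] near [0] are averages of [h_2], hence bounded; by
   Fatou the energy is at most their limit. *)
Lemma heat_energy_fin : heat_energy < +oo.
Proof.
have [N NP] := near0_heat_le.
have h0 : (0 <= H 2 0%R + 1)%R by rewrite addr_ge0 ?heat_ext_ge0.
pose If := \int[lebesgue_heis]_a (f a)%:E.
pose B := (H 2 0%R + 1)%:E * If.
have mfE : measurable_fun setT (EFin \o f) by exact/measurable_EFinP.
have bound k : \int[lebesgue_heis]_b
    ((f b)%:E * heat_conv2 h (dil (k + N) b) 0%R) <= B.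
  rewrite -heat_semigroup2_dil.
  rewrite /B -(ge0_integralZl_EFin _ measurableT _ mfE h0); last first.
    by move=> x _; rewrite lee_fin.
  apply: ge0_le_integral => //.
  - by move=> b _; rewrite lee_fin mulr_ge0 ?heat_ext_ge0.
  - apply/measurable_EFinP; apply: measurable_funM => //.
    apply: measurable_heat_ext => //; apply: measurable_hmul => //.
    exact: measurable_hopp.
  - exact: measurable_funeM.
  move=> b _; rewrite /= -EFinM lee_fin.
  have [->|fb] := eqVneq (f b) 0%R; first by rewrite mul0r mulr0.
  rewrite mulrC ler_wpM2r// heat_ext_sym//.
  have -> : hmul (- 0)%R (dil (k + N) b) = dil (k + N) b.
    by rewrite oppr0 hmul0l.
  have -> : H 2 (dil (k + N) b) = H 2 (- dil (k + N) b)%R.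
    by rewrite !heat_ext_gt0// (heat_kernel_sym hk).
  by apply: NP; [exact: leq_addl|exact: fK].
(* An integrand on pairs (b, c), so that Fatou's lemma is applied once; in the limit the variables
   separate. *)
pose F k (bc : heis R n * heis R n) :=
  (f bc.1 * (H 1 (hmul (- dil (k + N) bc.1) bc.2) * H 1 (hmul (- bc.2) 0)))%:E.
pose mu := prod_measure (@lebesgue_heis R n) (@lebesgue_heis R n).
have mF k : measurable_fun setT (F k).
  apply/measurable_EFinP; apply: measurable_funM.
    exact: measurableT_comp mf measurable_fst.
  apply: measurable_funM; apply: measurable_heat_ext => //;
    apply: measurable_hmul => //; apply: measurable_hopp => //.
  exact: measurableT_comp (mdil _) measurable_fst.
have F0 k z : 0 <= F k z by rewrite lee_fin !mulr_ge0 ?heat_ext_ge0.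
have FB k : \int[mu]_z F k z <= B.
  rewrite [leLHS](fubini_tonelli1 (m1 := lebesgue_heis) (m2 := lebesgue_heis)
    _ (mF k) (F0 k)).
  apply: le_trans (bound k).
  rewrite le_eqVlt; apply/orP; left; apply/eqP; apply: eq_integral => b _.
  rewrite /heat_conv2 -(ge0_integralZl_EFin _ measurableT _ _ (f0 b)).
  - by apply: eq_integral => c _; rewrite -EFinM.
  - by move=> c _; rewrite lee_fin mulr_ge0 ?heat_ext_ge0.
  - apply/measurable_EFinP; exact: (measurableT_comp
      (measurable_heat_conv2_kernel hk _) (measurable_pair1 _)).
pose G (bc : heis R n * heis R n) := (f bc.1 * H 1 bc.2 ^+ 2)%:E.
have mG : measurable_fun setT G.
  apply/measurable_EFinP; apply: measurable_funM.
    exact: measurableT_comp mf measurable_fst.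
  by apply: measurable_funX; exact: measurable_heat_ext.
have G0 z : 0 <= G z by rewrite lee_fin mulr_ge0 ?exprn_ge0 ?heat_ext_ge0.
have FG z : F k z @[k --> \oo] --> G z.
  have -> : G z = (f z.1 * (H 1 z.2 * H 1 (hmul (- z.2) 0)))%:E.
    rewrite /G expr2; congr (_ * (_ * _))%:E.
    by rewrite heat_ext_sym// oppr0 hmul0l.
  apply: cvg_EFin; first exact: nearW.
  apply: cvgM; first exact: cvg_cst.
  apply: cvgM; last exact: cvg_cst.
  apply: cvg_heat_ext => //; first exact: cvg_cst.
  rewrite -[X in _ --> X]hmul0l; apply: cvg_hmul; last exact: cvg_cst.
  by rewrite (cvg_shiftn N (fun k => - dil k z.1)%R); exact: cvg_dilN.
have := fatou_le mF F0 FG FB.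
rewrite [X in X <= _](fubini_tonelli1 (m1 := lebesgue_heis)
  (m2 := lebesgue_heis) _ mG G0).
have -> : \int[lebesgue_heis]_b \int[lebesgue_heis]_c G (b, c) = If * heat_energy.
  rewrite -(ge0_integralZr _ measurableT mfE); last 2 first.
  - by move=> b _; rewrite lee_fin.
  - by apply: integral_ge0 => c _; rewrite lee_fin exprn_ge0 ?heat_ext_ge0.
  apply: eq_integral => b _.
  rewrite /heat_energy -(ge0_integralZl_EFin _ measurableT _ _ (f0 b)).
  - by apply: eq_integral => c _; rewrite -EFinM.
  - by move=> c _; rewrite lee_fin exprn_ge0 ?heat_ext_ge0.
  - by apply/measurable_EFinP; apply: measurable_funX; exact: measurable_heat_ext.
(* An infinite energy times the positive integral of [f] would be infinite, whereas [B] is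
   finite. *)
rewrite ltNge leye_eq => FB'; apply/negP => /eqP Eoo; move: FB'.
rewrite Eoo gt0_muley// leye_eq /B => /eqP Boo.
have : B < +oo by rewrite lte_mul_pinfty// lee_fin.
by rewrite /B Boo ltxx.
Qed.

(** The same averages seen from an arbitrary point [a]: the left sides tend to h_2(a) times the
    weight, the right sides are controlled by [heat_conv2_le], and the finite positive integral of
    [f] cancels. *)
Lemma heat_ext2_le a : (H 2 a)%:E <= heat_energy.
Proof.
pose If := \int[lebesgue_heis]_a (f a)%:E.
have mfE : measurable_fun setT (EFin \o f) by exact/measurable_EFinP.
have e0 : 0 <= heat_energy.
  by apply: integral_ge0 => c _; rewrite lee_fin exprn_ge0 ?heat_ext_ge0.
have : \int[lebesgue_heis]_b (f b * H 2 a)%:E <= If * heat_energy.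
  apply: (fatou_le (f_ := fun k b => (f b * H 2 (hmul (- dil k b) a))%:E)).
  - move=> k; apply/measurable_EFinP; apply: measurable_funM => //.
    apply: measurable_heat_ext => //; apply: measurable_hmul => //.
    exact: measurable_hopp.
  - by move=> k b; rewrite lee_fin mulr_ge0 ?heat_ext_ge0.
  - move=> b; apply: cvg_EFin; first exact: nearW.
    apply: cvgM; first exact: cvg_cst.
    apply: cvg_heat_ext => //; first exact: cvg_cst.
    rewrite -[X in _ --> X]hmul0l; apply: cvg_hmul; last exact: cvg_cst.
    exact: cvg_dilN.
  - move=> k; rewrite heat_semigroup2_dil.
    rewrite -(ge0_integralZr _ measurableT mfE)//; last first.
      by move=> b _; rewrite lee_fin.
    apply: ge0_le_integral => //.
    + move=> b _; rewrite mule_ge0 ?lee_fin//; apply: integral_ge0 => c _.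
      by rewrite lee_fin mulr_ge0 ?heat_ext_ge0.
    + apply: emeasurable_funM => //.
      exact: (measurableT_comp (measurable_heat_conv2 hk a) (mdil k)).
    + exact: emeasurable_funM.
    + by move=> b _; apply: lee_wpmul2l; [rewrite lee_fin|exact: heat_conv2_le].
have -> : \int[lebesgue_heis]_b (f b * H 2 a)%:E = If * (H 2 a)%:E.
  rewrite -(ge0_integralZr _ measurableT mfE)//.
  - by move=> b _; rewrite lee_fin.
  - by rewrite lee_fin heat_ext_ge0.
have Ifin : If \is a fin_num by rewrite ge0_fin_numE ?ltW.
by rewrite lee_pmul2l.
Qed.

(** Time 2 is brought to time 1 by the dilation of ratio 2^(1/2), and time 1 to every t by
    scaling. *)
Lemma heat_kernel_bounded : exists2 C : R, (0 < C)%R &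
  forall t a, (0 < t)%R -> (h t a <= C * isqrt t ^+ hdim n)%R.
Proof.
have efin : heat_energy \is a fin_num.
  rewrite ge0_fin_numE ?heat_energy_fin//.
  by apply: integral_ge0 => c _; rewrite lee_fin exprn_ge0 ?heat_ext_ge0.
pose r : R := Num.sqrt 2; have r0 : (0 < r)%R by rewrite sqrtr_gt0.
have rQ : (0 < r ^+ hdim n)%R by exact: exprn_gt0.
pose C := (r ^+ hdim n * fine heat_energy)%R.
have hC a : (h 1 a <= C)%R.
  rewrite -(@heat_ext_gt0 _ _ h 1 a ltr01).
  have : (H 2 (hdil r a) <= fine heat_energy)%R.
    by rewrite -lee_fin fineK// heat_ext2_le.
  have -> : H 2 (hdil r a) = H (r ^+ 2 * 1)%R (hdil r a) by rewrite mulr1 sqr_sqrtr.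
  by rewrite heat_ext_dil// ler_pdivrMl// mulrC.
exists (C + 1)%R.
  have := hC 0%R; have := heat_kernel_ge0 hk 0%R (@ltr01 R); lra.
move=> t a t0; rewrite heat_kernel_scale// mulrC ler_wpM2r//.
  by rewrite exprn_ge0// ltW// isqrt_gt0.
by apply: (le_trans (hC _)); rewrite lerDl.
Qed.

End approximate_identity.
End heat_kernel_sup.

(** * Mild solutions *)

Section essential_bound.
Context d (T : measurableType d) (R : realType).
Variable mu : {measure set T -> \bar R}.

Lemma finite_norm_ae_bound (f : T -> R) : finite_norm mu +oo%E f ->
  exists2 C : R, 0 <= C & {ae mu, forall x, `|f x| <= C}.
Proof.
rewrite /finite_norm unlock; case: ifPn => [mu0 foo|mu0 _].
  exists `|fine (ess_sup_inf.ess_sup mu (abse \o (EFin \o f)))| => //.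
  have : (ess_sup_inf.ess_sup mu (abse \o (EFin \o f)) <=
      `|fine (ess_sup_inf.ess_sup mu (abse \o (EFin \o f)))|%:E)%E.
    move: foo; case: (ess_sup_inf.ess_sup _ _) => [r _| |_] //=.
      by rewrite lee_fin ler_norm.
    by rewrite leNye.
  by move=> /ess_sup_inf.ess_supP; apply: filterS => x /=; rewrite lee_fin.
(* On a space of measure zero the norm is 0 by convention, and any bound holds almost everywhere. *)
exists 0 => //; exists setT; split => //.
by apply/eqP; rewrite eq_le measure_ge0 andbT leNgt.
Qed.

End essential_bound.

(** * Joint measurability from continuity in time *)

Section time_regularity.
Context {R : realType} {n : nat}.
Implicit Types (u : R -> heis R n -> R).

Lemma continuous_C0_uniform (T : R) u : continuous_C0 T u ->
  forall t, 0 <= t < T -> forall e, 0 < e -> exists2 d : R, 0 < d &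
  forall s, 0 <= s < T -> `|t - s| < d -> forall a, `|u t a - u s a| < e.
Proof.
move=> [_ /subspace_continuousP cu] t tT e e0.
have /cu : [set` `[0, T[] t by rewrite /= in_itv.
move=> /(_ [set g : {uniform heis R n -> R} | forall a, `|u t a - g a| < e]).
have : nbhs (u t : {uniform heis R n -> R})
    [set g : {uniform heis R n -> R} | forall a, `|u t a - g a| < e].
  apply/uniform_nbhs; exists [set xy | ball xy.1 e xy.2]; split.
    exact: entourage_ball (PosNum e0).
  by move=> g ug a; exact: ug.
move=> nb /(_ nb) /nbhs_ballP[d /= d0 ud]; exists d => // s sT ts a.
by apply: (ud s) => //; rewrite /= in_itv.
Qed.

(** Only time is rounded: each [u t] is measurable in space, and continuity in the sup norm makes
    the rounded functions converge. *)
Lemma measurable_time_dependent d (S : measurableType d) (tau : S -> R)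
    (g : S -> heis R n) u :
  (forall T, 0 < T -> continuous_C0 T u) ->
  measurable_fun setT tau -> measurable_fun setT g -> (forall z, 0 <= tau z) ->
  measurable_fun setT (fun z => u (tau z) (g z)).
Proof.
move=> cu mtau mg tau0.
have cu0 t : 0 <= t -> C0 (u t).
  by move=> t0; apply: (cu (t + 1) _).1; [rewrite ltr_wpDl|rewrite t0 ltrDl ltr01].
(* Times are clipped at 0 because every grid value, negative ones included, must yield a measurable
   function of space. *)
have max0 (x : R) : 0 <= Num.max 0 x by rewrite le_max lexx.
apply: (measurable_fun_cvg
  (h := fun m z => u (Num.max 0 (grid_round m (grid_floor m (tau z)))) (g z))).
  move=> m; apply: (measurable_fun_countable_param
    (F := fun c z => u (Num.max 0 (grid_round m c)) (g z))).
    move=> c; rewrite -[X in measurable X]setTI.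
    rewrite (_ : _ @^-1` _ = tau @^-1` (grid_floor m @^-1` [set c]))//.
    by apply: mtau => //; exact: measurable_grid_floor.
  move=> c; apply: (measurableT_comp _ mg).
  by apply: continuous_measurable_heis; exact: (cu0 _ (max0 _)).1.
move=> z _; apply/cvgrPdist_lt => e e0.
have tz : 0 <= tau z < tau z + 1 by rewrite tau0 ltrDl ltr01.
have [|d' d0 ud] := continuous_C0_uniform (cu (tau z + 1) _) tz e0.
  by rewrite ltr_wpDl.
have dm : 0 < Num.min d' 1 by rewrite lt_min d0 ltr01.
move/cvgrPdist_lt : (@cvg_grid_round R (tau z)) => /(_ _ dm).
apply: filterS => m /=; rewrite lt_min => /andP[zd z1].
set r := grid_round m _ in zd z1 *.
have rz : `|tau z - Num.max 0 r| <= `|tau z - r|.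
  have := tau0 z; case: (leP 0 r) => r0 // t0.
  rewrite subr0 !ger0_norm//; first by rewrite lerBrDl gerDr ltW.
  by rewrite subr_ge0 (le_trans (ltW r0)).
apply: ud.
- rewrite max0 /=.
  have := le_lt_trans rz z1; rewrite ltr_norml => /andP[+ _].
  by rewrite ltrBrDr addrC ltrBlDr addrC.
- exact: le_lt_trans rz zd.
Qed.

End time_regularity.

Section weighted_mass.
Context {R : realType} {n : nat} (h : R -> heis R n -> R).
Hypothesis hk : heat_kernel h.
Context d (T : measurableType d) (mu : {sigma_finite_measure set T -> \bar R}).
Variables (w r : T -> R) (b : T -> heis R n).
Hypotheses (mw : measurable_fun setT w) (mr : measurable_fun setT r)
  (mb : measurable_fun setT b) (w0 : forall z, 0 <= w z).
Local Open Scope ereal_scope.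

(** By Tonelli each source [z] contributes its weight times the mass of a kernel: 1 if it is emitted
    before t, and 0 otherwise since [heat_ext] vanishes at non-positive times. *)
Lemma weighted_heat_mass (t : R) :
  \int[lebesgue_heis]_a \int[mu]_z
    (w z * heat_ext h (t - r z) (hmul (- b z) a))%:E =
  \int[mu]_z (w z * (r z < t)%R%:R)%:E.
Proof.
pose F (za : T * heis R n) :=
  (w za.1 * heat_ext h (t - r za.1) (hmul (- b za.1) za.2))%:E.
have mF : measurable_fun setT F.
  apply/measurable_EFinP; apply: measurable_funM; first exact: measurableT_comp.
  apply: measurable_heat_ext => //.
    by apply: measurable_funB => //; exact: measurableT_comp.
  apply: measurable_hmul => //; apply: measurable_hopp; exact: measurableT_comp.
have F0 za : 0 <= F za by rewrite lee_fin mulr_ge0 ?heat_ext_ge0.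
rewrite -(fubini_tonelli (m1 := mu) (m2 := lebesgue_heis) F mF F0).
apply: eq_integral => z _; rewrite /F /= EFinM.
under eq_integral => a _ do rewrite EFinM.
have mH : measurable_fun setT
    (fun a : heis R n => (heat_ext h (t - r z) (hmul (- b z) a))%:E).
  apply/measurable_EFinP; apply: measurable_heat_ext => //; exact: measurable_hmul.
rewrite (ge0_integralZl_EFin _ measurableT _ mH (w0 z)); last first.
  by move=> a _; rewrite lee_fin heat_ext_ge0.
congr (_ * _); have [rt|rt] := ltP (r z) t.
  by rewrite heat_ext_mass// subr_gt0.
by apply: integral0_eq => a _; rewrite /heat_ext subr_gt0 ltNge rt.
Qed.

End weighted_mass.

(** * Powers, geometric losses and interpolation *)

Section power_functions.
Context {R : realType}.

Lemma powR_exp (x r : R) j : 0 <= x -> (x ^+ j) `^ r = (x `^ r) ^+ j.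
Proof.
move=> x0; elim: j => [|j IHj]; first by rewrite !expr0 powR1.
by rewrite !exprS powRM ?exprn_ge0// IHj.
Qed.

Lemma isqrt_exp (x : R) j : 0 <= x -> isqrt (x ^+ j) = isqrt x ^+ j.
Proof. exact: powR_exp. Qed.

Lemma isqrt_powR (t e : R) j : 0 < t ->
  (isqrt t ^+ j) `^ e = t `^ (- (j%:R / 2 * e)).
Proof.
move=> t0; rewrite -powR_mulrn ?powR_ge0// /isqrt -!powRrM; congr (_ `^ _).
by ring.
Qed.

Lemma isqrt_nonincreasing (s t : R) : 0 < s -> s <= t -> isqrt t <= isqrt s.
Proof.
move=> s0 st; have t0 : 0 < t by exact: lt_le_trans st.
rewrite (isqrtE (ltW s0)) (isqrtE (ltW t0)).
by rewrite lef_pV2 ?posrE ?sqrtr_gt0// ler_wsqrtr.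
Qed.

Lemma powR_gt1 (x e : R) : 1 < x -> 0 < e -> 1 < x `^ e.
Proof.
move=> x1 e0; rewrite lt_neqAle eq_sym powR_eq1 !negb_or gt_eqF//= gt_eqF// andbT.
rewrite -leNgt (le_trans ler01 (ltW x1))/=.
by rewrite -[leLHS](powRr0 x); apply: ler_powR; rewrite ltW.
Qed.

End power_functions.

Section geometric_decrements.
Context {R : realType}.

(** Relative losses that are summable leave a positive amount. The first of them may exceed 1, so
    positivity of every term is assumed and the estimate starts at a late index. *)
Lemma geometric_decrements_positive (a : nat -> R) (D rho : R) :
  (forall j, 0 < a j) -> (forall j, a j.+1 <= a j) ->
  0 <= D -> 0 <= rho < 1 ->
  (forall j, a j - a j.+1 <= D * rho ^+ j * a j) ->
  exists2 c, 0 < c & forall j, c <= a j.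
Proof.
move=> a0 adec D0 /andP[r0 r1] astep.
have rn : `|rho| < 1 by rewrite ger0_norm.
(* With this threshold for D rho^N, the losses after [N] sum to at most a N / 2. *)
have half0 : 0 < (1 - rho) / 2 by rewrite divr_gt0// subr_gt0.
have /cvgrPdist_le/(_ _ half0) [N _ NP] := cvg_geometric D rn.
have DN : D * rho ^+ N <= (1 - rho) / 2.
  have := NP N (leqnn N); rewrite sub0r normrN /= ger0_norm//.
  by rewrite mulr_ge0// exprn_ge0.
have amono i j : (i <= j)%N -> a j <= a i.
  by move=> ij; apply: (nonincreasing_seqP a).1.
(* The factor (1 + rho^i)/2 decreases at each step by exactly (1 - rho) rho^i / 2, the bound on the
   loss relative to a N. *)
have claim i : a N * (1 + rho ^+ i) / 2 <= a (N + i)%N.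
  elim: i => [|i IHi]; first by rewrite expr0 addn0 -mulrA -[1 + 1]/(2%:R) divff// mulr1.
  have h1 := astep (N + i)%N.
  have h2 : D * rho ^+ (N + i) * a (N + i)%N <= (1 - rho) / 2 * rho ^+ i * a N.
    rewrite exprD mulrA; apply: ler_pM; rewrite ?(ltW (a0 _))//.
    - by rewrite !mulr_ge0 ?exprn_ge0.
    - by rewrite ler_wpM2r ?exprn_ge0.
    - by apply: amono; exact: leq_addr.
  rewrite addnS exprS; move: h1 h2 IHi.
  set x := rho ^+ i; set y := rho ^+ _; nra.
exists (a N / 2); first by rewrite divr_gt0.
move=> j; apply: (le_trans _ (amono j (N + j)%N (leq_addl _ _))).
apply: le_trans (claim j); rewrite ler_pM2r ?invr_gt0// ler_peMr ?(ltW (a0 _))//.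
by rewrite lerDl exprn_ge0.
Qed.

End geometric_decrements.

Section interpolation.
Context d (T : measurableType d) (R : realType).
Variable mu : {measure set T -> \bar R}.

(** Pointwise, |w|^q <= B^(q-1) |w|. *)
Lemma Lnorm_interpolation_le (w : T -> R) (q B X : R) : measurable_fun setT w ->
  1 <= q -> 0 <= B -> (forall a, `|w a| <= B) ->
  (\int[mu]_a `|w a|%:E <= X%:E)%E ->
  ('N[mu]_(q%:E)[(fun a => (w a)%:E)] <= ((B `^ (q - 1) * X) `^ q^-1)%:E)%E.
Proof.
move=> mw q1 B0 wB wX; have q0 : 0 < q by exact: lt_le_trans q1.
have mwn : measurable_fun setT (fun a => `|w a|).
  exact: measurableT_comp.
have X0 : 0 <= X.
  by rewrite -lee_fin; apply: le_trans wX; apply: integral_ge0 => a _; rewrite lee_fin.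
have iq : (\int[mu]_a `|(w a)%:E| `^ q <= (B `^ (q - 1) * X)%:E)%E.
  rewrite EFinM; apply: (@le_trans _ _ (\int[mu]_a ((B `^ (q - 1))%:E * `|w a|%:E))%E).
    apply: ge0_le_integral => //.
    - by move=> a _; exact: poweR_ge0.
    - rewrite (_ : (fun a => _) = fun a => (`|w a| `^ q)%:E); last first.
        by apply/funext.
      apply/measurable_EFinP.
      exact: (measurableT_comp (measurable_powR q) mwn).
    - by apply: measurable_funeM; exact/measurable_EFinP.
    - move=> a _; rewrite /= -EFinM lee_fin -mulr_powRB1// mulrC.
      rewrite ler_wpM2r//; apply: ge0_ler_powR; rewrite ?nnegrE//.
      by rewrite subr_ge0.
  rewrite (ge0_integralZl_EFin _ measurableT).
  - by apply: lee_wpmul2l; rewrite ?lee_fin ?powR_ge0.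
  - by move=> a _; rewrite lee_fin.
  - exact/measurable_EFinP.
  - exact: powR_ge0.
rewrite unlock -poweR_EFin.
have i0 : (0 <= \int[mu]_a `|(w a)%:E| `^ q)%E.
  by apply: integral_ge0 => a _; exact: poweR_ge0.
apply: gt0_ler_poweR; rewrite ?invr_ge0 ?(ltW q0)// in_itv /= leey andbT//.
by rewrite lee_fin mulr_ge0 ?powR_ge0.
Qed.

Lemma cvg_powR0 (f : R -> R) (r : R) : 0 < r -> (forall t, 0 <= f t) ->
  f t @[t --> +oo] --> 0 -> f t `^ r @[t --> +oo] --> 0.
Proof.
move=> r0 f0 /cvgrPdist_lt flt; apply/cvgrPdist_lt => e e0.
have er : 0 < e `^ r^-1 by rewrite powR_gt0.
have := flt _ er; apply: filterS => t; rewrite !sub0r !normrN.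
rewrite !ger0_norm ?powR_ge0// => fe.
rewrite -[ltRHS](powRr1 (ltW e0)) -(mulVf (lt0r_neq0 r0)) powRrM.
by apply: gt0_ltr_powR; rewrite ?nnegrE ?powR_ge0.
Qed.

End interpolation.

(** * Duhamel's formula as a space-time integral *)

Section absorption_equation.
Context {R : realType} {n : nat} (p : R).
Variables (h : R -> heis R n -> R) (k : R -> R)
  (u0 : heis R n -> R) (u : R -> heis R n -> R).
Hypotheses (p_gt1 : 1 < p) (hk : heat_kernel h)
  (u0_ge0 : forall a, 0 <= u0 a)
  (u0_L1 : (@lebesgue_heis R n).-integrable setT (EFin \o u0))
  (u0_C0 : C0 u0)
  (k_gt0 : forall t, 0 < t -> 0 < k t)
  (k_measurable : measurable_fun (`]0, +oo[ : set R) k)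
  (k_bounded : finite_norm (@lebesgue_measure R) +oo%E (k \_ `]0, +oo[))
  (u_mild : global_mild_solution h k p u0 u)
  (u_ge0 : forall t a, 0 <= t -> 0 <= u t a).
Local Notation H := (heat_ext h).

Definition space_time :
    {sigma_finite_measure set (measurableTypeR R * heis R n)%type -> \bar R} :=
  prod_measure (@lebesgue_measure R) (@lebesgue_heis R n).

(* The solution is only controlled at non-negative times, hence the [Num.max]. *)
Definition absorption (z : (measurableTypeR R * heis R n)%type) : R :=
  (k \_ `]0, +oo[) z.1 *
  (`|u (Num.max 0 z.1) z.2| `^ (p - 1) * u (Num.max 0 z.1) z.2).

Let max0 (x : R) : 0 <= Num.max 0 x. Proof. by rewrite le_max lexx. Qed.

Lemma k_ext_ge0 (t : R) : 0 <= (k \_ `]0, +oo[) t.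
Proof.
rewrite /patch; case: ifPn => //; rewrite inE /= in_itv /= andbT => t0.
by rewrite ltW// k_gt0.
Qed.

Lemma absorption_gt0E t b : 0 < t ->
  absorption (t, b) = k t * (`|u t b| `^ (p - 1) * u t b).
Proof.
move=> t0; rewrite /absorption /= /patch.
by rewrite mem_set /= ?in_itv /= ?t0// (max_idPr (ltW t0)).
Qed.

Lemma absorption_le0E t b : t <= 0 -> absorption (t, b) = 0.
Proof.
move=> t0; rewrite /absorption /= /patch ifF ?mul0r//.
by apply/negbTE; rewrite notin_setE /= in_itv /= andbT; apply/negP; rewrite -leNgt.
Qed.

Lemma absorption_ge0 z : 0 <= absorption z.
Proof.
by rewrite /absorption mulr_ge0 ?k_ext_ge0// mulr_ge0 ?powR_ge0// u_ge0.
Qed.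

Lemma measurable_absorption : measurable_fun setT absorption.
Proof.
have mu : measurable_fun setT (fun z : (measurableTypeR R * heis R n)%type =>
    u (Num.max 0 z.1) z.2).
  apply: measurable_time_dependent => //.
  - by move=> T T0; have [] := u_mild T0.
  - by apply: measurable_maxr => //; exact: measurable_fst.
have mk : measurable_fun setT (k \_ `]0, +oo[ : measurableTypeR R -> R).
  by apply/(measurable_restrictT _ _).1.
apply: measurable_funM; first exact: measurableT_comp mk measurable_fst.
apply: measurable_funM => //.
apply: (measurableT_comp (measurable_powR _)).
exact: measurableT_comp.
Qed.

Lemma solution_C0 t : 0 <= t -> C0 (u t).
Proof.
move=> t0; have t1 : 0 < t + 1 by rewrite ltr_wpDl.
by apply: (u_mild t1).1.1; rewrite t0 ltrDl ltr01.
Qed.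

Lemma mild_formula t a : 0 <= t ->
  u t a = heat_semigroup h t u0 a -
      (\int[@lebesgue_measure R]_(s in `]0%R, t[)
        heat_semigroup h (t - s)
          (fun b => k s * (`|u s b| `^ (p - 1) * u s b)) a)%R.
Proof.
move=> t0; have t1 : 0 < t + 1 by rewrite ltr_wpDl.
by apply: (u_mild t1).2; rewrite t0 ltrDl ltr01.
Qed.

Lemma source_ge0 s b : 0 < s -> 0 <= k s * (`|u s b| `^ (p - 1) * u s b).
Proof.
move=> s0; rewrite mulr_ge0//; first by rewrite ltW// k_gt0.
by rewrite mulr_ge0 ?powR_ge0// u_ge0// ltW.
Qed.

Lemma solution_le_heat t a : 0 <= t -> u t a <= heat_semigroup h t u0 a.
Proof.
move=> t0; rewrite mild_formula// gerDl oppr_le0.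
apply: Rintegral_ge0 => s; rewrite /= in_itv /= => /andP[s0 st].
rewrite /heat_semigroup subr_eq0 gt_eqF//.
apply: Rintegral_ge0 => b _; rewrite mulr_ge0 ?source_ge0//.
by apply: heat_kernel_ge0 => //; rewrite subr_gt0.
Qed.

Lemma solution0 a : u 0 a = u0 a.
Proof.
rewrite mild_formula// /heat_semigroup eqxx.
by rewrite set_itv_ge ?bnd_simp// Rintegral_set0 subr0.
Qed.

Lemma measurable_u0 : measurable_fun setT u0.
Proof. exact: continuous_measurable_heis u0_C0.1. Qed.

Lemma measurable_solution t : 0 <= t -> measurable_fun setT (u t).
Proof. by move=> t0; exact: continuous_measurable_heis (solution_C0 t0).1. Qed.

Lemma u0_bound : exists2 M : R, 0 < M & forall a, 0 <= u0 a <= M.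
Proof.
have [M M0 uM] := C0_bound u0_C0; exists M => // a.
by rewrite u0_ge0 (le_trans (ler_norm _) (uM a)).
Qed.

Lemma heat_u0E t a : 0 < t -> (heat_semigroup h t u0 a)%:E =
  (\int[lebesgue_heis]_b (u0 b * H t (hmul (- b) a))%:E)%E.
Proof.
move=> t0; apply: heat_semigroupE => //.
have [M _ uM] := u0_bound.
exact: le_lt_trans (heat_conv_le hk t a measurable_u0 uM) (ltry _).
Qed.

Lemma solution_bound : exists2 M : R, 0 < M & forall t a, 0 <= t -> u t a <= M.
Proof.
have [M M0 uM] := u0_bound; exists M => // t a.
rewrite le_eqVlt => /predU1P[<-|t0].
  by rewrite solution0; have /andP[] := uM a.
apply: (le_trans (solution_le_heat _ (ltW t0))).
rewrite -lee_fin heat_u0E//. exact: (heat_conv_le hk t a measurable_u0 uM).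
Qed.

Lemma k_ae_bound : exists2 C : R, 0 <= C &
  {ae @lebesgue_measure R, forall s, (k \_ `]0, +oo[) s <= C}.
Proof.
have [C C0 kC] := finite_norm_ae_bound k_bounded; exists C => //.
by apply: filterS kC => s; apply: le_trans; exact: ler_norm.
Qed.

Lemma absorption_heat_ge0 t a z :
  (0 <= (absorption z * H (t - z.1) (hmul (- z.2) a))%:E)%E.
Proof. by rewrite lee_fin mulr_ge0 ?absorption_ge0 ?heat_ext_ge0. Qed.

Lemma measurable_absorption_heat t a : measurable_fun setT
  (fun z => (absorption z * H (t - z.1) (hmul (- z.2) a))%:E).
Proof.
apply/measurable_EFinP; apply: measurable_funM; first exact: measurable_absorption.
apply: measurable_heat_ext => //.
  by apply: measurable_funB => //; exact: measurable_fst.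
apply: measurable_hmul => //; apply: measurable_hopp; exact: measurable_snd.
Qed.

Lemma inner_absorption_ge0 s t a : (0 <=
  \int[lebesgue_heis]_b (absorption (s, b) * H (t - s) (hmul (- b) a))%:E)%E.
Proof.
by apply: integral_ge0 => b _; exact: (absorption_heat_ge0 t a (s, b)).
Qed.

Lemma inner_absorption_le s t a (B : R) : 0 < s ->
  (forall b, `|u s b| `^ (p - 1) * u s b <= B) ->
  (\int[lebesgue_heis]_b (absorption (s, b) * H (t - s) (hmul (- b) a))%:E
    <= ((k \_ `]0, +oo[) s * B)%:E)%E.
Proof.
move=> s0 sB.
apply: heat_conv_le => //.
  exact: (measurableT_comp measurable_absorption (measurable_pair1 _)).
move=> b; rewrite absorption_ge0 /= absorption_gt0E//.
rewrite /patch mem_set /= ?in_itv /= ?s0// ler_wpM2l// ltW//; exact: k_gt0.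
Qed.

Lemma absorption_sup_bound : exists2 B : R, 0 <= B &
  forall s b, 0 <= s -> `|u s b| `^ (p - 1) * u s b <= B.
Proof.
have [M M0 uM] := solution_bound; exists (M `^ (p - 1) * M).
  by rewrite mulr_ge0 ?powR_ge0// ltW.
move=> s b s0; rewrite ger0_norm ?u_ge0//.
apply: ler_pM; rewrite ?powR_ge0 ?u_ge0 ?uM//.
by apply: ge0_ler_powR; rewrite ?nnegrE ?u_ge0 ?uM ?(ltW M0)// subr_ge0 ltW.
Qed.

Lemma heat_absorptionE s t a : 0 < s < t ->
  (heat_semigroup h (t - s) (fun b => k s * (`|u s b| `^ (p - 1) * u s b)) a)%:E =
  (\int[lebesgue_heis]_b (absorption (s, b) * H (t - s) (hmul (- b) a))%:E)%E.
Proof.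
move=> /andP[s0 st]; have [B B0 sB] := absorption_sup_bound.
rewrite heat_semigroupE ?subr_gt0//.
- by apply: eq_integral => b _; rewrite absorption_gt0E.
- by move=> b; exact: source_ge0.
- under eq_integral => b _ do rewrite -absorption_gt0E//.
  apply: le_lt_trans (ltry ((k \_ `]0, +oo[) s * B)).
  by apply: inner_absorption_le => // b; rewrite sB// ltW.
Qed.

Lemma space_time_integral (f : (measurableTypeR R * heis R n)%type -> \bar R) :
  measurable_fun setT f -> (forall z, 0 <= f z)%E ->
  (\int[space_time]_z f z =
    \int[@lebesgue_measure R]_s \int[lebesgue_heis]_b f (s, b))%E.
Proof.
move=> mf f0.
exact: (fubini_tonelli1 (m1 := @lebesgue_measure R) (m2 := @lebesgue_heis R n) f mf).
Qed.

(** Outside ]0, t[ the integrand vanishes: the absorption is 0 at times s <= 0, and [heat_ext] is 0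
    when t - s <= 0. *)
Lemma absorption_integral_itv t a :
  (\int[space_time]_z (absorption z * H (t - z.1) (hmul (- z.2) a))%:E =
   \int[@lebesgue_measure R]_(s in `]0%R, t[)
     \int[lebesgue_heis]_b (absorption (s, b) * H (t - s) (hmul (- b) a))%:E)%E.
Proof.
rewrite (space_time_integral (measurable_absorption_heat t a) (absorption_heat_ge0 t a)).
rewrite [RHS]integral_mkcond; apply: eq_integral => s _.
rewrite /patch; case: ifPn => //.
rewrite notin_setE /= in_itv /= => /negP; rewrite negb_and -!leNgt => st.
apply: integral0_eq => b _; case/orP : st => st.
  by rewrite absorption_le0E// mul0r.
by rewrite /heat_ext subr_gt0 ltNge st /= mulr0.
Qed.

Lemma measurable_inner_absorption t a : measurable_fun setT (fun s : measurableTypeR R =>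
  \int[lebesgue_heis]_b (absorption (s, b) * H (t - s) (hmul (- b) a))%:E)%E.
Proof.
exact: (measurable_fun_fubini_tonelli_F (m2 := @lebesgue_heis R n)
  (fun z => (absorption z * H (t - z.1) (hmul (- z.2) a))%:E)
  (measurable_absorption_heat t a) (absorption_heat_ge0 t a)).
Qed.

(** Over the bounded interval ]0, t[ almost every slice is at most C B; [C] bounds k only almost
    everywhere. *)
Lemma absorption_heat_fin t a :
  (\int[space_time]_z (absorption z * H (t - z.1) (hmul (- z.2) a))%:E < +oo)%E.
Proof.
rewrite absorption_integral_itv.
have [B B0 sB] := absorption_sup_bound; have [C C0 kC] := k_ae_bound.
apply: (@le_lt_trans _ _ (\int[@lebesgue_measure R]_(s in `]0%R, t[) (C * B)%:E)%E).
  apply: ae_ge0_le_integral => //.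
  - by move=> s _; exact: inner_absorption_ge0.
  - by apply: measurable_funTS; exact: measurable_inner_absorption.
  - by move=> s _; rewrite lee_fin mulr_ge0.
  case: kC => N [mN N0 kN]; exists N; split => //; apply: subset_trans kN.
  apply: subsetC => s /= kC; rewrite in_itv /= => /andP[s0 _].
  apply: (@le_trans _ _ ((k \_ `]0, +oo[) s * B)%:E).
    by apply: inner_absorption_le => // b; rewrite sB// ltW.
  by rewrite lee_fin ler_wpM2r.
rewrite integral_cst//= lebesgue_measure_itv /=.
by case: ifPn => _; rewrite -?EFinM ?ltry// mule0.
Qed.

(** The iterated real-valued integrals of the mild formulation are finite, so they agree with an
    extended integral over space-time, on which Tonelli's theorem acts. *)
Lemma mild_formulaE t a : 0 < t ->
  ((u t a)%:E = (heat_semigroup h t u0 a)%:E -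
   \int[space_time]_z (absorption z * H (t - z.1) (hmul (- z.2) a))%:E)%E.
Proof.
move=> t0; rewrite mild_formula ?ltW// EFinB; congr (_ - _)%E.
rewrite /Rintegral.
have E : (\int[@lebesgue_measure R]_(s in `]0%R, t[)
    (heat_semigroup h (t - s)
      (fun b => k s * (`|u s b| `^ (p - 1) * u s b)) a)%:E =
    \int[space_time]_z (absorption z * H (t - z.1) (hmul (- z.2) a))%:E)%E.
  rewrite absorption_integral_itv; apply: eq_integral => s.
  by rewrite inE /= in_itv /= => st; exact: heat_absorptionE.
rewrite E fineK// ge0_fin_numE ?absorption_heat_fin//.
by apply: integral_ge0 => z _; exact: absorption_heat_ge0.
Qed.

Definition duhamel t a : R := heat_semigroup h t u0 a - u t a.

Lemma duhamelE t a : 0 < t -> (duhamel t a)%:E =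
  (\int[space_time]_z (absorption z * H (t - z.1) (hmul (- z.2) a))%:E)%E.
Proof.
move=> t0; rewrite /duhamel EFinB mild_formulaE//.
rewrite fin_num_oppeB// ?addeA ?subee ?add0e//.
by rewrite ge0_fin_numE ?absorption_heat_fin//;
  apply: integral_ge0 => z _; exact: absorption_heat_ge0.
Qed.

(** * Mass balance and the limit mass *)

Definition absorbed t : \bar R :=
  (\int[space_time]_z (absorption z * (z.1 < t)%R%:R)%:E)%E.

Lemma measurable_absorption_before t : measurable_fun setT
  (fun z => (absorption z * (z.1 < t)%R%:R)%:E).
Proof.
apply/measurable_EFinP; apply: measurable_funM; first exact: measurable_absorption.
rewrite (_ : (fun _ => _) = fun z : (measurableTypeR R * heis R n)%type =>
   if z.1 < t then 1 else 0); last by apply/funext => z; case: ifP.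
apply: measurable_fun_ifT => //.
apply: measurable_fun_ltr => //; exact: measurable_fst.
Qed.

Lemma absorption_before_ge0 t z : (0 <= (absorption z * (z.1 < t)%R%:R)%:E)%E.
Proof. by rewrite lee_fin mulr_ge0 ?absorption_ge0. Qed.

Lemma heat_u0_weightedE t a : 0 < t -> (heat_semigroup h t u0 a)%:E =
  (\int[lebesgue_heis]_b (u0 b * H (t - 0) (hmul (- b) a))%:E)%E.
Proof. by move=> t0; rewrite subr0 heat_u0E. Qed.

Lemma heat_u0_mass t : 0 < t ->
  (\int[lebesgue_heis]_a (heat_semigroup h t u0 a)%:E =
   \int[lebesgue_heis]_a (u0 a)%:E)%E.
Proof.
move=> t0; under eq_integral => a _ do rewrite heat_u0_weightedE//.
rewrite (weighted_heat_mass hk (w := u0) (r := fun=> 0) (b := id)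
  lebesgue_heis measurable_u0 (measurable_cst _)
  (@measurable_id _ _ _) u0_ge0).
by apply: eq_integral => b _; rewrite t0 mulr1.
Qed.

Lemma duhamel_mass t : 0 < t ->
  (\int[lebesgue_heis]_a (duhamel t a)%:E = absorbed t)%E.
Proof.
move=> t0; under eq_integral => a _ do rewrite duhamelE//.
exact: (weighted_heat_mass hk (w := absorption) (r := fst) (b := snd)
  space_time measurable_absorption measurable_fst measurable_snd absorption_ge0).
Qed.

Lemma duhamel_ge0 t a : 0 <= t -> 0 <= duhamel t a.
Proof. by move=> t0; rewrite subr_ge0 solution_le_heat. Qed.

Lemma measurable_heat_u0 t : 0 < t -> measurable_fun setT (heat_semigroup h t u0).
Proof.
move=> t0; apply/measurable_EFinP.
rewrite (_ : EFin \o _ = fun a =>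
  (\int[lebesgue_heis]_b (u0 b * H t (hmul (- b) a))%:E)%E); last first.
  by apply/funext => a; exact: heat_u0E.
apply: (measurable_fun_fubini_tonelli_G (m1 := @lebesgue_heis R n)
  (fun ba => (u0 ba.1 * H t (hmul (- ba.1) ba.2))%:E)).
- apply/measurable_EFinP; apply: measurable_funM.
    exact: measurableT_comp measurable_u0 measurable_fst.
  apply: measurable_heat_ext => //; apply: measurable_hmul => //.
  by apply: measurable_hopp; exact: measurable_fst.
- by move=> ba; rewrite lee_fin mulr_ge0 ?heat_ext_ge0.
Qed.

Lemma measurable_duhamel t : 0 < t -> measurable_fun setT (duhamel t).
Proof.
move=> t0; apply: measurable_funB; first exact: measurable_heat_u0.
exact: measurable_solution (ltW t0).
Qed.

(** Integrates u(t) + duhamel(t) = S(t)u_0. The additive form avoids a difference of possibly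
    infinite masses, whose finiteness is deduced from it. *)
Lemma mass_balance t : 0 <= t ->
  (mass u t + absorbed t = \int[lebesgue_heis]_a (u0 a)%:E)%E.
Proof.
rewrite le_eqVlt => /predU1P[<-|t0].
  rewrite /mass; under eq_integral => a _ do rewrite solution0.
  rewrite [X in (_ + X)%E](_ : _ = 0%E) ?adde0//.
  apply: integral0_eq => -[s b] _ /=; have [s0|s0] := ltP s 0.
    by rewrite absorption_le0E ?mul0r// ltW.
  by rewrite mulr0.
rewrite -(duhamel_mass t0) -(heat_u0_mass t0) /mass.
rewrite -(ge0_integralD _ measurableT).
- by apply: eq_integral => a _; rewrite -EFinD /duhamel addrC subrK.
- by move=> a _; rewrite lee_fin u_ge0// ltW.
- apply/measurable_EFinP; exact: measurable_solution (ltW t0).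
- by move=> a _; rewrite lee_fin duhamel_ge0// ltW.
- by apply/measurable_EFinP; exact: measurable_duhamel.
Qed.

Definition init_mass : R := fine (\int[lebesgue_heis]_a (u0 a)%:E)%E.

Lemma init_massE : (\int[lebesgue_heis]_a (u0 a)%:E = init_mass%:E)%E.
Proof. by rewrite fineK//; exact: integrable_fin_num u0_L1. Qed.

Lemma mass_ge0 t : 0 <= t -> (0 <= mass u t)%E.
Proof. by move=> t0; apply: integral_ge0 => a _; rewrite lee_fin u_ge0. Qed.

Lemma absorbed_ge0 t : (0 <= absorbed t)%E.
Proof. by apply: integral_ge0 => z _; exact: absorption_before_ge0. Qed.

Definition fin_mass t : R := fine (mass u t).

Lemma fin_massE t : 0 <= t -> mass u t = (fin_mass t)%:E.
Proof.
move=> t0; rewrite fineK// ge0_fin_numE ?mass_ge0//.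
apply: (@le_lt_trans _ _ init_mass%:E); last exact: ltry.
by rewrite -init_massE -(mass_balance t0) leeDl// absorbed_ge0.
Qed.

Lemma fin_mass_ge0 t : 0 <= t -> 0 <= fin_mass t.
Proof. by move=> t0; rewrite fine_ge0// mass_ge0. Qed.

Lemma absorbedE t : 0 <= t -> absorbed t = (init_mass - fin_mass t)%:E.
Proof.
move=> t0; rewrite EFinB -init_massE -(mass_balance t0) (fin_massE t0).
by rewrite [X in (X - _)%E]addeC addeK.
Qed.

Lemma fin_mass0 : fin_mass 0 = init_mass.
Proof.
rewrite /fin_mass /mass /init_mass; congr fine.
by apply: eq_integral => a _; rewrite solution0.
Qed.

(** The mass is never negative, so the absorption before any time is at most the initial mass;
    Fatou's lemma lets that time tend to infinity. *)
Lemma absorption_total_fin :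
  (\int[space_time]_z (absorption z)%:E <= init_mass%:E)%E.
Proof.
apply: (fatou_le (f_ := fun j z => (absorption z * (z.1 < j%:R)%R%:R)%:E)).
- by move=> j; exact: measurable_absorption_before.
- by move=> j z; exact: absorption_before_ge0.
- move=> z; apply: cvg_EFin; first exact: nearW.
  apply: cvg_near_cst; near=> j => /=.
  have -> : z.1 < j%:R by near: j; exact: nbhs_infty_gtr.
  by rewrite mulr1.
- move=> j; rewrite -/(absorbed _) absorbedE ?ler0n// lee_fin gerBl fin_mass_ge0//.
Unshelve. all: by end_near. Qed.

Lemma integrable_absorption : space_time.-integrable setT (EFin \o absorption).
Proof.
apply: ge0_integrable.
- exact: measurable_absorption.
- exact: absorption_ge0.
- exact: le_lt_trans absorption_total_fin (ltry _).
Qed.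

Definition absorbed_total : R := fine (\int[space_time]_z (absorption z)%:E)%E.

Lemma absorbed_totalE : (\int[space_time]_z (absorption z)%:E = absorbed_total%:E)%E.
Proof. by rewrite fineK//; exact: integrable_fin_num integrable_absorption. Qed.

(** Written through the total absorption rather than as a limit: [solution_error] uses this
    decomposition to separate u_0 from the absorption. *)
Definition limit_mass : R := init_mass - absorbed_total.

Lemma cvg_fin_mass : fin_mass t @[t --> +oo] --> limit_mass.
Proof.
apply/cvg_pinftyP => t_ ty.
have tpos : \forall j \near \oo, 0 <= t_ j by exact: cvgry_ge.
have cvgA : absorbed (t_ j) @[j --> \oo] --> absorbed_total%:E.
  rewrite -absorbed_totalE.
  have mf_ j : measurable_fun setT (fun z => (absorption z * (z.1 < t_ j)%R%:R)%:E).
    exact: measurable_absorption_before.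
  have ff z : setT z -> (absorption z * (z.1 < t_ j)%R%:R)%:E @[j --> \oo] -->
      (absorption z)%:E.
    move=> _; apply: cvg_EFin; first exact: nearW.
    apply: cvg_near_cst; near=> j => /=.
    have -> : z.1 < t_ j by near: j; exact: cvgry_gt.
    by rewrite mulr1.
  have fg z j : setT z -> (`|(absorption z * (z.1 < t_ j)%R%:R)%:E| <=
      (absorption z)%:E)%E.
    move=> _; rewrite gee0_abs ?absorption_before_ge0// lee_fin.
    by case: (_ < _); rewrite ?mulr1// mulr0 absorption_ge0.
  have mA : measurable_fun setT (EFin \o absorption).
    by apply/measurable_EFinP; exact: measurable_absorption.
  by have [_ _] := dominated_convergence measurableT mf_ mA
    (aeW space_time ff) integrable_absorption (aeW space_time fg).
have cvgR : init_mass - fine (absorbed (t_ j)) @[j --> \oo] --> limit_mass.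
  apply: cvgB; first exact: cvg_cst.
  by have /fine_cvgP[] := cvgA.
apply: cvg_trans cvgR; apply: near_eq_cvg; near=> j.
have t0 : 0 <= t_ j by near: j.
by rewrite absorbedE//= subKr.
Unshelve. all: by end_near. Qed.

Lemma cvg_mass : mass u t @[t --> +oo] --> limit_mass%:E.
Proof.
apply: cvg_EFin; last exact: cvg_fin_mass.
near=> t; have t0 : 0 <= t by near: t; exact: nbhs_pinfty_ge.
by rewrite fin_massE.
Unshelve. all: by end_near. Qed.

(** * Rates of mass loss *)

Lemma absorbed_incr s t : s <= t ->
  (absorbed t = absorbed s + \int[@lebesgue_measure R]_(r in `[s, t[)
     \int[lebesgue_heis]_b (absorption (r, b))%:E)%E.
Proof.
move=> st.
pose between z := absorption z * (s <= z.1 < t)%R%:R.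
have mb : measurable_fun setT (EFin \o between).
  apply/measurable_EFinP; apply: measurable_funM; first exact: measurable_absorption.
  rewrite (_ : (fun _ => _) = fun z : (measurableTypeR R * heis R n)%type =>
     if s <= z.1 then if z.1 < t then 1 else 0 else 0); last first.
    by apply/funext => z /=; case: (s <= _) => //=; case: (_ < t).
  apply: measurable_fun_ifT => //.
    by apply: measurable_fun_ler => //; exact: measurable_fst.
  apply: measurable_fun_ifT => //.
  by apply: measurable_fun_ltr => //; exact: measurable_fst.
have b0 z : (0 <= (between z)%:E)%E by rewrite lee_fin mulr_ge0 ?absorption_ge0.
have -> : (\int[@lebesgue_measure R]_(r in `[s, t[)
     \int[lebesgue_heis]_b (absorption (r, b))%:E =
     \int[space_time]_z (between z)%:E)%E.
  rewrite (space_time_integral mb b0) [LHS]integral_mkcond.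
  apply: eq_integral => r _; rewrite /patch mem_setE in_itv /=.
  case: ifPn => rst.
    by apply: eq_integral => b _; rewrite /between /= rst mulr1.
  by rewrite integral0_eq// => b _; rewrite /between /= (negbTE rst) mulr0.
rewrite -(ge0_integralD _ measurableT).
- apply: eq_integral => z _; rewrite -EFinD -mulrDr /=; congr (_ * _)%:E.
  have [zs|zs] := ltP z.1 s; first by rewrite (lt_le_trans zs st) addr0.
  by rewrite add0r.
- by move=> z _; exact: absorption_before_ge0.
- exact: measurable_absorption_before.
- by move=> z _; exact: b0.
- exact: mb.
Qed.

Lemma fin_mass_incr s t : 0 <= s <= t ->
  (\int[@lebesgue_measure R]_(r in `[s, t[)
     \int[lebesgue_heis]_b (absorption (r, b))%:E = (fin_mass s - fin_mass t)%:E)%E.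
Proof.
move=> /andP[s0 st]; have := absorbed_incr st.
rewrite !absorbedE ?(le_trans s0)//.
move=> /(congr1 (fun x => x - (init_mass - fin_mass s)%:E)%E).
rewrite [X in _ = (X - _)%E]addeC addeK// => <-.
by rewrite -EFinB; congr EFin; ring.
Qed.

Lemma inner_absorption0_ge0 r : (0 <= \int[lebesgue_heis]_b (absorption (r, b))%:E)%E.
Proof. by apply: integral_ge0 => b _; rewrite lee_fin absorption_ge0. Qed.

Lemma measurable_inner_absorption0 : measurable_fun setT
  (fun r : measurableTypeR R => \int[lebesgue_heis]_b (absorption (r, b))%:E)%E.
Proof.
apply: (measurable_fun_fubini_tonelli_F (m2 := @lebesgue_heis R n)
  (EFin \o absorption)).
- by apply/measurable_EFinP; exact: measurable_absorption.
- by move=> z; rewrite /= lee_fin absorption_ge0.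
Qed.

Lemma fin_mass_nonincreasing s t : 0 <= s <= t -> fin_mass t <= fin_mass s.
Proof.
move=> st; rewrite -subr_ge0 -lee_fin -fin_mass_incr//.
by apply: integral_ge0 => r _; exact: inner_absorption0_ge0.
Qed.

Lemma limit_mass_le t : 0 <= t -> limit_mass <= fin_mass t.
Proof.
move=> t0; rewrite /limit_mass -[leRHS](subKr init_mass) lerD2l lerN2 -lee_fin.
rewrite -absorbedE// -absorbed_totalE; apply: ge0_le_integral => //.
- by move=> z _; exact: absorption_before_ge0.
- exact: measurable_absorption_before.
- by apply/measurable_EFinP; exact: measurable_absorption.
- by move=> z _; rewrite lee_fin; case: (_ < _); rewrite ?mulr1// mulr0 absorption_ge0.
Qed.

Lemma integral_itv_cst (s t c : R) : s <= t ->
  (\int[@lebesgue_measure R]_(r in `[s, t[) c%:E = ((t - s) * c)%:E)%E.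
Proof.
move=> st; rewrite integral_cst//= lebesgue_measure_itv /= lte_fin.
case: ifPn => [_|]; first by rewrite -EFinB -EFinM mulrC.
rewrite -leNgt => ts; have -> : t = s by apply/le_anti; rewrite st ts.
by rewrite subrr mul0r mule0.
Qed.

Lemma fin_mass_decay_le s t (B C : R) : 0 <= s <= t -> 0 <= B -> 0 <= C ->
  {ae @lebesgue_measure R, forall r, (k \_ `]0, +oo[) r <= C} ->
  (forall r b, s <= r < t -> u r b <= B) ->
  fin_mass s - fin_mass t <= (t - s) * (C * B `^ (p - 1) * fin_mass s).
Proof.
move=> st B0 C0 kC uB; have /andP[s0 st'] := st.
rewrite -lee_fin -fin_mass_incr// -integral_itv_cst//.
apply: ae_ge0_le_integral => //.
- by move=> r _; exact: inner_absorption0_ge0.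
- by apply: measurable_funTS; exact: measurable_inner_absorption0.
- by move=> r _; rewrite lee_fin !mulr_ge0 ?powR_ge0// fin_mass_ge0.
case: kC => N [mN N0 kN]; exists N; split => //; apply: subset_trans kN.
apply: subsetC => r /= kC; rewrite in_itv /= => rst.
have /andP[sr rt] := rst; have r0 : 0 <= r by exact: le_trans sr.
apply: (@le_trans _ _ (\int[lebesgue_heis]_b ((C * B `^ (p - 1))%:E * (u r b)%:E))%E).
  apply: ge0_le_integral => //.
  - by move=> b _; rewrite lee_fin absorption_ge0.
  - apply/measurable_EFinP.
    exact: (measurableT_comp measurable_absorption (measurable_pair1 _)).
  - apply: measurable_funeM; apply/measurable_EFinP; exact: measurable_solution.
  - move=> b _; rewrite -EFinM lee_fin /absorption /= (max_idPr r0) mulrA.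
    rewrite ler_wpM2r ?u_ge0//; apply: ler_pM; rewrite ?k_ext_ge0 ?powR_ge0//.
    rewrite ger0_norm ?u_ge0//; apply: ge0_ler_powR; rewrite ?nnegrE ?u_ge0 ?uB//.
    by rewrite subr_ge0 ltW.
rewrite (ge0_integralZl_EFin _ measurableT).
- rewrite -/(mass u r) fin_massE// -EFinM lee_fin ler_wpM2l ?mulr_ge0 ?powR_ge0//.
  by rewrite fin_mass_nonincreasing// s0.
- by move=> b _; rewrite lee_fin u_ge0.
- by apply/measurable_EFinP; exact: measurable_solution.
- by rewrite mulr_ge0 ?powR_ge0.
Qed.

Lemma fin_mass_decay_ge s t (c : R) : 0 <= s <= t -> 0 <= c ->
  (forall r, s <= r < t ->
    (c%:E <= \int[lebesgue_heis]_b (absorption (r, b))%:E)%E) ->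
  (t - s) * c <= fin_mass s - fin_mass t.
Proof.
move=> st c0 uB; have /andP[s0 st'] := st.
rewrite -lee_fin -fin_mass_incr// -integral_itv_cst//.
apply: ge0_le_integral => //.
by apply: measurable_funTS; exact: measurable_inner_absorption0.
Qed.

(** If u_0 had integral zero it would vanish almost everywhere, hence S(t)u_0 and with it u(t) would
    vanish for every t > 0. *)
Lemma init_mass_gt0 : (exists t a, 0 <= t /\ u t a != 0) -> 0 < init_mass.
Proof.
move=> [t [a [t0 /eqP ut]]]; rewrite lt_neqAle -fin_mass0 fin_mass_ge0// andbT fin_mass0.
apply/negP => /eqP m00; apply: ut.
have mE0 : measurable_fun setT (EFin \o u0).
  by apply/measurable_EFinP; exact: measurable_u0.
have u00 : ae_eq lebesgue_heis setT (EFin \o u0) (cst 0%E).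
  apply/(ae_eq_integral_abs _ measurableT mE0).
  under eq_integral => b _ do rewrite /= ger0_norm ?u0_ge0//.
  by rewrite init_massE -m00.
have ut0 s b : 0 < s -> u s b = 0.
  move=> s0; apply/le_anti/andP; split; last by rewrite u_ge0// ltW.
  apply: (le_trans (solution_le_heat b (ltW s0))).
  rewrite -lee_fin heat_u0E//.
  rewrite (@ae_eq_integral _ _ _ lebesgue_heis setT (cst 0%E)) ?integral0//.
  - exact: measurable_heat_conv measurable_u0.
  - by apply: filterS u00 => c /= /(_ I) [->] _; rewrite mul0r.
(* The witness may sit at t = 0, which [ut0] does not cover; continuity in time passes from small s
   > 0 to 0. *)
move: t0; rewrite le_eqVlt => /predU1P[<-|]; last exact: ut0.
apply/eqP; rewrite -normr_le0; apply/ler_addgt0Pr => e e0; rewrite add0r.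
have [|d d0 ud] := continuous_C0_uniform (u_mild ltr01).1 _ e0 (t := 0).
  by rewrite lexx ltr01.
pose s := Num.min (d / 2) (2^-1).
have s0 : 0 < s by rewrite lt_min divr_gt0//= invr_gt0.
have s1 : 0 <= s < 1 by rewrite ltW//= gt_min invf_lt1 ?ltr1n ?orbT.
have sd : `|0 - s| < d.
  by rewrite sub0r normrN gtr0_norm// gt_min ltr_pdivrMr// ltr_pMr// ltr1n.
by have := ud s s1 sd a; rewrite (ut0 s a s0) subr0 => /ltW.
Qed.

(** The relative loss rate is at most [K], so a step of length [d] removes at most half of the mass,
    and finitely many steps reach any time. *)
Lemma fin_mass_gt0 : 0 < init_mass -> forall t, 0 <= t -> 0 < fin_mass t.
Proof.
move=> m00; have [M M0 uM] := solution_bound; have [C C0 kC] := k_ae_bound.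
pose K := C * M `^ (p - 1); have K0 : 0 <= K by rewrite mulr_ge0 ?powR_ge0.
(* Chosen so that d K <= 1/2; the + 1 covers K = 0. *)
pose d := (2 * (K + 1))^-1.
have d0 : 0 < d by rewrite invr_gt0 mulr_gt0// ltr_wpDl.
have dK : d * K <= 2^-1.
  rewrite /d invfM -mulrA ler_piMr// mulrC ler_pdivrMr ?mul1r ?lerDl//.
  by rewrite ltr_wpDl.
have step s : 0 <= s -> 0 < fin_mass s -> 0 < fin_mass (s + d).
  move=> s0 ms; have ssd : 0 <= s <= s + d by rewrite s0 lerDl ltW.
  have := fin_mass_decay_le ssd (ltW M0) C0 kC _.
  have -> : s + d - s = d by rewrite addrC addKr.
  rewrite -/K mulrA => h1.
  have {h1} : fin_mass s - fin_mass (s + d) <= d * K * fin_mass s.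
    by apply: h1 => r b /andP[sr _]; rewrite uM// (le_trans s0).
  have : d * K * fin_mass s <= 2^-1 * fin_mass s by rewrite ler_wpM2r// ltW.
  lra.
have mj j : 0 < fin_mass (j%:R * d).
  elim: j => [|j IHj]; first by rewrite mul0r fin_mass0.
  by rewrite mulrSr mulrDl mul1r; apply: step => //; rewrite mulr_ge0// ltW.
move=> t t0; pose j := Num.truncn (t / d).
have tj : t <= j.+1%:R * d.
  by rewrite -ler_pdivrMr// ltW// truncnS_gt.
apply: (lt_le_trans (mj j.+1)); apply: fin_mass_nonincreasing; rewrite t0//.
Qed.

(** The test function is the positive part of u_0 - 1/(j+1). It vanishes off a compact set because
    u_0 is in C_0, and for some j its integral is positive since these functions tend to u_0. *)
Lemma heat_bound : 0 < init_mass -> exists2 C : R, 0 < C &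
  forall t a, 0 < t -> h t a <= C * isqrt t ^+ hdim n.
Proof.
move=> m00.
pose v (j : nat) a := u0 a - j.+1%:R^-1.
pose f j a := (`|v j a| + v j a) / 2.
have cv j : continuous (v j).
  by move=> a; apply: cvgB; [exact: u0_C0.1|exact: cvg_cst].
have cf j : continuous (f j).
  move=> a; apply: cvgM; last exact: cvg_cst.
  apply: cvgD; last exact: cv.
  by apply: cvg_norm; exact: cv.
have mf j : measurable_fun setT (f j) by exact: continuous_measurable_heis.
have f0 j a : 0 <= f j a.
  by rewrite divr_ge0// -(opprK (v j a)) subr_ge0 normrN ler_norm.
have fu j a : f j a <= u0 a.
  rewrite ler_pdivrMr// /v; have := u0_ge0 a.
  have : 0 < j.+1%:R^-1 :> R by rewrite invr_gt0.
  move: (j.+1%:R^-1) (u0 a) => q y q0 y0.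
  by case: (ger0P (y - q)) => _; rewrite ?addNr; lra.
have fv j a : u0 a < j.+1%:R^-1 -> f j a = 0.
  by move=> uj; rewrite /f ltr0_norm ?subr_lt0// addNr mul0r.
have [j fj] : exists j, (0 < \int[lebesgue_heis]_a (f j a)%:E)%E.
  apply/not_existsP => fle.
  have : (\int[lebesgue_heis]_a (u0 a)%:E <= 0)%E.
    apply: (fatou_le (f_ := fun j a => (f j a)%:E)).
    - by move=> j; exact/measurable_EFinP.
    - by move=> j a; rewrite lee_fin.
    - move=> a; apply: cvg_EFin; first exact: nearW.
      have vu : v j a @[j --> \oo] --> u0 a.
        rewrite -[X in _ --> X]subr0; apply: cvgB; first exact: cvg_cst.
        exact: cvg_harmonic.
      have -> : u0 a = (`|u0 a| + u0 a) / 2.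
        by rewrite ger0_norm ?u0_ge0//; field.
      apply: cvgM; last exact: cvg_cst.
      by apply: cvgD => //; exact: cvg_norm.
    - by move=> j; rewrite leNgt; exact/negP/fle.
  by rewrite init_massE lee_fin leNgt m00.
have [K cK Kj] := u0_C0.2 j.+1%:R^-1 (ltac:(by rewrite invr_gt0)).
have fK a : f j a != 0 -> K a.
  move=> fa; apply: contrapT => /Kj; rewrite ger0_norm ?u0_ge0// => /fv.
  by move/eqP; apply/negP.
apply: (heat_kernel_bounded hk (f := f j) _ (f0 j) cK fK fj).
  split=> // e e0; exists K => // a nKa.
  have [->|/fK//] := eqVneq (f j a) 0; by rewrite normr0.
apply: (@le_lt_trans _ _ init_mass%:E); last exact: ltry.
rewrite -init_massE; apply: ge0_le_integral => //.
- by move=> a _; rewrite lee_fin.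
- exact/measurable_EFinP.
- by apply/measurable_EFinP; exact: measurable_u0.
- by move=> a _; rewrite lee_fin.
Qed.

Lemma heat_u0_le (C : R) : 0 < C ->
  (forall t a, 0 < t -> h t a <= C * isqrt t ^+ hdim n) ->
  forall t a, 0 < t -> heat_semigroup h t u0 a <= C * isqrt t ^+ hdim n * init_mass.
Proof.
move=> C0 hC t a t0; rewrite -lee_fin heat_u0E//.
have B0 : 0 <= C * isqrt t ^+ hdim n.
  by rewrite mulr_ge0 ?exprn_ge0 ?ltW// isqrt_gt0.
have mE0 : measurable_fun setT (EFin \o u0).
  by apply/measurable_EFinP; exact: measurable_u0.
rewrite EFinM -init_massE -(ge0_integralZl_EFin _ measurableT _ mE0 B0); last first.
  by move=> b _; rewrite lee_fin.
apply: ge0_le_integral => //.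
- by move=> b _; rewrite lee_fin mulr_ge0 ?heat_ext_ge0.
- exact: measurable_heat_conv measurable_u0.
- exact: measurable_funeM.
- by move=> b _; rewrite -EFinM lee_fin mulrC ler_wpM2r// heat_ext_gt0// hC.
Qed.

(** * Asymptotics in L^1 *)

Definition heat_error t : \bar R :=
  (\int[lebesgue_heis]_b ((u0 b)%:E * heat_defect h t 0%R (- b)%R) +
   \int[space_time]_z ((absorption z)%:E * heat_defect h t z.1 (- z.2)%R))%E.

Let u0_integral_ge0 t :
  (0 <= \int[lebesgue_heis]_b ((u0 b)%:E * heat_defect h t 0%R (- b)%R))%E.
Proof.
by apply: integral_ge0 => b _; rewrite mule_ge0 ?lee_fin// heat_defect_ge0.
Qed.

Let absorption_integral_ge0 t :
  (0 <= \int[space_time]_z ((absorption z)%:E * heat_defect h t z.1 (- z.2)%R))%E.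
Proof.
apply: integral_ge0 => z _.
by rewrite mule_ge0 ?lee_fin ?absorption_ge0// heat_defect_ge0.
Qed.

Lemma heat_error_ge0 t : (0 <= heat_error t)%E.
Proof. exact: adde_ge0. Qed.

Let mfst : measurable_fun setT
  (fst : (measurableTypeR R * heis R n)%type -> R).
Proof. exact: measurable_fst. Qed.

Let msnd : measurable_fun setT
  (snd : (measurableTypeR R * heis R n)%type -> heis R n).
Proof. exact: measurable_snd. Qed.

Let mid : measurable_fun setT (id : heis R n -> heis R n).
Proof. exact: measurable_id. Qed.

Lemma heat_error_le t : (heat_error t <= (2 * init_mass + 2 * absorbed_total)%:E)%E.
Proof.
have u0E : measurable_fun setT (EFin \o u0).
  by apply/measurable_EFinP; exact: measurable_u0.
have aE : measurable_fun setT (EFin \o absorption).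
  by apply/measurable_EFinP; exact: measurable_absorption.
rewrite EFinD; apply: leeD.
- rewrite EFinM -init_massE.
  rewrite -(ge0_integralZl_EFin lebesgue_heis measurableT _ u0E); last 2 first.
  + by move=> b _; rewrite lee_fin.
  + by [].
  apply: ge0_le_integral => //.
  + by move=> b _; rewrite mule_ge0 ?lee_fin// heat_defect_ge0.
  + apply: emeasurable_funM => //.
    exact: (measurable_heat_defect hk (r := fun=> 0) (b := id)).
  + exact: measurable_funeM.
  + move=> b _; rewrite muleC; apply: lee_wpmul2r; rewrite ?lee_fin//.
    exact: heat_defect_le2.
- rewrite EFinM -absorbed_totalE.
  rewrite -(ge0_integralZl_EFin space_time measurableT _ aE); last 2 first.
  + by move=> b _; rewrite lee_fin absorption_ge0.
  + by [].
  apply: ge0_le_integral => //.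
  + by move=> b _; rewrite mule_ge0 ?lee_fin ?absorption_ge0// heat_defect_ge0.
  + apply: emeasurable_funM => //.
    exact: (measurable_heat_defect hk (r := fst) (b := snd) mfst msnd).
  + exact: measurable_funeM.
  + move=> b _; rewrite muleC; apply: lee_wpmul2r; rewrite ?lee_fin ?absorption_ge0//.
    exact: heat_defect_le2.
Qed.

Lemma heat_error_fin t : heat_error t \is a fin_num.
Proof.
by rewrite ge0_fin_numE ?heat_error_ge0// (le_lt_trans (heat_error_le t))// ltry.
Qed.

Lemma cvg_heat_error : fine (heat_error t) @[t --> +oo] --> 0.
Proof.
apply/cvg_pinftyP => t_ ty.
have : heat_error (t_ j) @[j --> \oo] --> 0%E.
  rewrite -(adde0 0%E); apply: cvgeD => //.
  - exact: (weighted_heat_defect_cvg hk (r := fun=> 0) (b := id) measurable_u0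
      (measurable_cst _) mid u0_ge0 u0_L1 ty).
  - exact (@weighted_heat_defect_cvg _ _ _ hk _ _ space_time absorption fst snd
      measurable_absorption mfst msnd absorption_ge0 integrable_absorption _ ty).
by move=> /fine_cvgP[].
Qed.

Lemma heat_u0_error t : 0 < t ->
  (\int[lebesgue_heis]_a `|heat_semigroup h t u0 a - init_mass * h t a|%:E
    <= \int[lebesgue_heis]_b ((u0 b)%:E * heat_defect h t 0%R (- b)%R))%E.
Proof.
move=> t0; under eq_integral => a _ do rewrite -(heat_ext_gt0 h a t0).
apply: (weighted_heat_le hk (w := u0) (r := fun=> 0) (b := id)
  measurable_u0 (measurable_cst _) mid u0_ge0 u0_L1) => //.
- exact: measurable_heat_u0.
- exact: init_massE.
- by move=> a; exact: heat_u0_weightedE.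
Qed.

Lemma duhamel_error t : 0 < t ->
  (\int[lebesgue_heis]_a `|duhamel t a - absorbed_total * h t a|%:E
    <= \int[space_time]_z ((absorption z)%:E * heat_defect h t z.1 (- z.2)%R))%E.
Proof.
move=> t0; under eq_integral => a _ do rewrite -(heat_ext_gt0 h a t0).
apply: (weighted_heat_le hk (w := absorption) (r := fst) (b := snd)
  measurable_absorption mfst msnd absorption_ge0 integrable_absorption) => //.
- exact: measurable_duhamel.
- exact: absorbed_totalE.
- by move=> a; exact: duhamelE.
Qed.

Lemma measurable_heat_kernel t : 0 < t -> measurable_fun setT (h t).
Proof.
by move=> t0; apply: continuous_measurable_heis; exact: continuous_heat_kernel.
Qed.

Lemma measurable_normB (f : heis R n -> R) t (c : R) : 0 < t ->
  measurable_fun setT f -> measurable_fun setT (fun a => `|f a - c * h t a|%:E).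
Proof.
move=> t0 mf; apply/measurable_EFinP; apply: measurableT_comp => //.
apply: measurable_funB => //; apply: measurable_funM => //.
exact: measurable_heat_kernel.
Qed.

Lemma solution_error t : 0 < t ->
  (\int[lebesgue_heis]_a `|u t a - limit_mass * h t a|%:E <= heat_error t)%E.
Proof.
move=> t0; have m1 := measurable_normB init_mass t0 (measurable_heat_u0 t0).
have m2 := measurable_normB absorbed_total t0 (measurable_duhamel t0).
apply: (@le_trans _ _ (\int[lebesgue_heis]_a
    (`|heat_semigroup h t u0 a - init_mass * h t a|%:E +
     `|duhamel t a - absorbed_total * h t a|%:E))%E).
  apply: ge0_le_integral => //.
  - apply: measurable_normB => //; exact: measurable_solution (ltW t0).
  - exact: emeasurable_funD.
  - move=> a _; rewrite -EFinD lee_fin.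
    have -> : u t a - limit_mass * h t a = heat_semigroup h t u0 a - init_mass * h t a -
        (duhamel t a - absorbed_total * h t a).
      by rewrite /duhamel /limit_mass; ring.
    exact: ler_normB.
rewrite (ge0_integralD _ measurableT _ m1 _ m2); last 2 first.
- by move=> a _; rewrite lee_fin.
- by move=> a _; rewrite lee_fin.
by apply: leeD; [exact: heat_u0_error|exact: duhamel_error].
Qed.

(** * Supercritical exponents *)

Lemma limit_mass_gt0 : 0 < init_mass -> 1 + 2 / (hdim n)%:R < p -> 0 < limit_mass.
Proof.
move=> m00 pQ; have [C C0 hC] := heat_bound m00; have [K K0 kK] := k_ae_bound.
have Q0 : 0 < (hdim n)%:R :> R by rewrite ltr0n /hdim addn2.
(* The fraction of mass lost on [t, 2t] is of order t^(-e), and e > 0 is the supercriticality of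
   p. *)
pose e := (hdim n)%:R / 2 * (p - 1) - 1 : R.
have e0 : 0 < e.
  rewrite subr_gt0 mulrAC ltr_pdivlMr// mul1r mulrC -ltr_pdivrMr//; lra.
(* This is 2^(-e): the factor 2 comes from the length 2^j of the j-th interval, the other from the
   decay of the sup bound, raised to the power p - 1. *)
pose rho : R := 2 * (isqrt 2 ^+ hdim n) `^ (p - 1).
have rho0 : 0 <= rho by rewrite mulr_ge0 ?powR_ge0.
have rho1 : rho < 1.
  have -> : rho = (2 `^ e)^-1.
    rewrite /rho isqrt_powR// -powRN -[X in X * _](@powRr1 R)// -powRD; last first.
      by apply/implyP => _; rewrite gt_eqF.
    by congr (_ `^ _); rewrite /e; ring.
  by rewrite invf_lt1 ?powR_gt0// powR_gt1// ltr1n.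
have pow0 j : 0 < 2 ^+ j :> R by rewrite exprn_gt0.
have [| | | | |c c0 cm] := @geometric_decrements_positive R (fun j => fin_mass (2 ^+ j))
    (K * (C * init_mass) `^ (p - 1)) rho.
- by move=> j; apply: fin_mass_gt0 => //; exact: ltW.
- move=> j; apply: fin_mass_nonincreasing; rewrite ltW//= exprS ler_peMl ?ltW//.
  by rewrite ltr1n.
- by rewrite mulr_ge0 ?powR_ge0.
- by rewrite rho0.
(* [B] is the bound on S(t)u_0 at t = 2^j, valid on the whole interval up to 2^(j+1) because it
   decreases in t. *)
- move=> j; pose B := C * init_mass * (isqrt 2 ^+ hdim n) ^+ j.
  have Cm : 0 <= C * init_mass by rewrite mulr_ge0// ltW.
  have i2 : 0 <= (isqrt 2 : R) ^+ hdim n by rewrite exprn_ge0 ?powR_ge0.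
  have B0 : 0 <= B by rewrite !mulr_ge0 ?exprn_ge0 ?powR_ge0 ?ltW.
  have st : 0 <= (2 : R) ^+ j <= 2 ^+ j.+1.
    by rewrite ltW//= exprS ler_peMl ?ltW// ltr1n.
  apply: (le_trans (fin_mass_decay_le st B0 K0 kK _)).
    move=> r b /andP[jr _]; have r0 : 0 < r by exact: lt_le_trans jr.
    apply: (le_trans (solution_le_heat b (ltW r0))).
    apply: (le_trans (heat_u0_le C0 hC b r0)).
    rewrite /B mulrAC ler_wpM2l//.
    rewrite -exprM mulnC exprM -(@isqrt_exp _ 2 j)//.
    by apply: lerXn2r; rewrite ?nnegrE ?powR_ge0//; exact: isqrt_nonincreasing.
  have -> : 2 ^+ j.+1 - 2 ^+ j = 2 ^+ j :> R by rewrite exprS; ring.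
  rewrite /B (powRM _ Cm (exprn_ge0 j i2)) (powR_exp _ _ i2) /rho exprMn.
  rewrite [leLHS](_ : _ = K * (C * init_mass) `^ (p - 1) *
    (2 ^+ j * (isqrt 2 ^+ hdim n) `^ (p - 1) ^+ j) * fin_mass (2 ^+ j))//.
  ring.
apply: (lt_le_trans c0); apply: (cvgr_to_ge cvg_fin_mass).
near=> t; have t0 : 0 <= t by near: t; exact: nbhs_pinfty_ge.
have [j tj] : exists j, t <= 2 ^+ j.
  exists (Num.truncn t).+1.
  apply: (le_trans (ltW (truncnS_gt t))); rewrite -natrX ler_nat.
  by rewrite ltnW// ltn_expl.
by apply: (le_trans (cm j)); apply: fin_mass_nonincreasing; rewrite t0.
Unshelve. all: by end_near. Qed.

Lemma limit_mass_ge0 : 0 <= limit_mass.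
Proof.
apply: (cvgr_to_ge cvg_fin_mass); near=> t; apply: fin_mass_ge0.
by near: t; exact: nbhs_pinfty_ge.
Unshelve. all: by end_near. Qed.

(** * Critical and subcritical exponents *)

Lemma measurable_truncated t (c l : R) :
  measurable_fun setT (fun a => (Num.min (c * H t a) l)%:E).
Proof.
apply/measurable_EFinP; apply: measurable_minr => //.
by apply: measurable_funM => //; exact: measurable_heat_ext.
Qed.

(** A level of the order t^(-Q/2) scales like the kernel itself, so the truncated mass does not
    depend on t. *)
Lemma truncated_heat_scale t (c e : R) : 0 < t -> 0 <= c -> 0 <= e ->
  (\int[lebesgue_heis]_a (Num.min (c * H t a) (e * isqrt t ^+ hdim n))%:E =
   \int[lebesgue_heis]_a (Num.min (c * H 1 a) e)%:E)%E.
Proof.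
move=> t0 c0 e0; set s := isqrt t; have s0 : 0 < s by exact: isqrt_gt0.
have si0 : 0 < s^-1 by rewrite invr_gt0.
have sQ : 0 < s ^+ hdim n by rewrite exprn_gt0.
have F0 a : (0 <= (Num.min (c * H t a) (e * s ^+ hdim n))%:E)%E.
  by rewrite lee_fin le_min !mulr_ge0 ?heat_ext_ge0// ltW.
have := ge0_integral_hdil si0 (measurable_truncated t c (e * s ^+ hdim n)) F0.
have -> : s^-1 ^- hdim n = s ^+ hdim n by rewrite exprVn invrK.
have E a : (Num.min (c * H t (hdil s^-1 a)) (e * s ^+ hdim n))%:E =
    ((s ^+ hdim n)%:E * (Num.min (c * H 1 a) e)%:E)%E.
  rewrite -EFinM minr_pMr ?ltW//; congr (Num.min _ _)%:E; last by rewrite mulrC.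
  have -> : H t (hdil s^-1 a) = H (s^-1 ^+ 2 * 1) (hdil s^-1 a).
    by rewrite mulr1 exprVn /s sqr_isqrt// invrK.
  by rewrite heat_ext_dil// exprVn invrK mulrCA.
under eq_integral => a _ do rewrite E.
have G0 a : (0 <= (Num.min (c * H 1 a) e)%:E)%E.
  by rewrite lee_fin le_min mulr_ge0 ?heat_ext_ge0//=.
rewrite (ge0_integralZl_EFin _ measurableT (fun a _ => G0 a)
  (measurable_truncated 1 c e) (ltW sQ)).
move=> /(congr1 (fun z => ((s ^+ hdim n)^-1)%:E * z)%E).
by rewrite !muleA -!EFinM mulVf ?gt_eqF// !mul1e => ->.
Qed.

(** Provides the level: a small multiple of t^(-Q/2) leaves as little truncated mass as desired,
    uniformly in t by [truncated_heat_scale]. *)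
Lemma truncated_heat_cvg (c : R) : 0 <= c ->
  (\int[lebesgue_heis]_a (Num.min (c * H 1 a) j.+1%:R^-1)%:E @[j --> \oo] --> 0)%E.
Proof.
move=> c0.
have H0 j a : 0 <= Num.min (c * H 1 a) j.+1%:R^-1.
  by rewrite le_min invr_ge0 ler0n mulr_ge0 ?heat_ext_ge0.
have ci : lebesgue_heis.-integrable setT (EFin \o (fun a => c * H 1 a)).
  have mH : measurable_fun setT (EFin \o H 1).
    by apply/measurable_EFinP; exact: measurable_heat_ext.
  apply: ge0_integrable.
  - by apply: measurable_funM => //; exact: measurable_heat_ext.
  - by move=> a; rewrite mulr_ge0 ?heat_ext_ge0.
  under eq_integral => a _ do rewrite EFinM.
  rewrite (ge0_integralZl_EFin _ measurableT _ mH c0); last first.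
    by move=> a _; rewrite lee_fin heat_ext_ge0.
  have -> : (\int[lebesgue_heis]_a (H 1 a)%:E = 1)%E.
    rewrite -[RHS](heat_ext_mass hk 0 ltr01).
    by apply: eq_integral => a _; rewrite hmul0l.
  by rewrite mule1 ltry.
have ff a : setT a -> (Num.min (c * H 1 a) j.+1%:R^-1)%:E @[j --> \oo] --> 0%E.
  move=> _; apply: (@squeeze_cvge _ _ _ _ (cst 0%E) _ (fun j => (j.+1%:R^-1)%:E)).
  - by apply: nearW => j; rewrite !lee_fin H0 ge_min lexx orbT.
  - exact: cvg_cst.
  - by apply: cvg_EFin; [exact: nearW|exact: cvg_harmonic].
have fg a j : setT a -> (`|(Num.min (c * H 1 a) j.+1%:R^-1)%:E| <=
    (c * H 1 a)%:E)%E.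
  by move=> _; rewrite /= lee_fin ger0_norm// ge_min lexx.
have [_ _] := dominated_convergence measurableT
  (fun j => measurable_truncated 1 c j.+1%:R^-1) (measurable_cst 0%E)
  (aeW lebesgue_heis ff) ci (aeW lebesgue_heis fg).
by rewrite integral0.
Qed.

(* Either [u <= l], or [u <= l^(1-p) u^p]. *)
Lemma solution_pointwise_le r a (l k0 : R) : 0 < r -> 0 < l -> 0 < k0 -> k0 <= k r ->
  u r a <= Num.min (init_mass * h r a) l +
    `|heat_semigroup h r u0 a - init_mass * h r a| +
    l `^ (1 - p) / k0 * absorption (r, a).
Proof.
move=> r0 l0 k00 kr; set v := heat_semigroup h r u0 a.
have uv : u r a <= v by exact: solution_le_heat (ltW r0).
have ur0 : 0 <= u r a by rewrite u_ge0// ltW.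
have last0 : 0 <= l `^ (1 - p) / k0 * absorption (r, a).
  by rewrite mulr_ge0 ?absorption_ge0// divr_ge0 ?powR_ge0// ltW.
have first0 : u r a <= l ->
    u r a <= Num.min (init_mass * h r a) l + `|v - init_mass * h r a|.
  move=> ul; have := ler_norm (v - init_mass * h r a).
  have := normr_ge0 (v - init_mass * h r a).
  by case: (leP (init_mass * h r a) l) => _; lra.
have [ul|lu] := leP (u r a) l; first by rewrite ler_wpDr// first0.
apply: ler_wpDl.
  rewrite addr_ge0// le_min (ltW l0) andbT mulr_ge0//; last exact: heat_kernel_ge0.
  by rewrite -fin_mass0 fin_mass_ge0.
rewrite absorption_gt0E// ger0_norm//.
have lp : l `^ (1 - p) * u r a `^ (p - 1) >= 1.
  rewrite -[1 - p]opprB powRN mulrC ler_pdivlMr ?powR_gt0// mul1r.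
  apply: ge0_ler_powR; [by rewrite subr_ge0 ltW|by rewrite nnegrE ltW| |].
    by rewrite nnegrE.
  exact: ltW.
(* The lower bound on k enters here: u^p is at most the absorption divided by [k0]. *)
have kk : 1 <= k r / k0 by rewrite ler_pdivlMr// mul1r.
rewrite [leRHS](_ : _ = (l `^ (1 - p) * u r a `^ (p - 1)) * (k r / k0) * u r a).
  by rewrite ler_peMl//; nra.
by field; rewrite gt_eqF.
Qed.

Lemma limit_mass_le_absorption r (e k0 : R) : 0 < r -> 0 < e -> 0 < k0 -> k0 <= k r ->
  (limit_mass%:E <=
    \int[lebesgue_heis]_a (Num.min (init_mass * H 1 a) e)%:E + heat_error r +
    ((e * isqrt r ^+ hdim n) `^ (1 - p) / k0)%:E *
      \int[lebesgue_heis]_b (absorption (r, b))%:E)%E.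
Proof.
move=> r0 e0 k00 kr; set l := e * _.
have l0 : 0 < l by rewrite mulr_gt0// exprn_gt0// isqrt_gt0.
have m00 : 0 <= init_mass by rewrite -fin_mass0 fin_mass_ge0.
pose c := l `^ (1 - p) / k0.
have c0 : 0 <= c by rewrite divr_ge0 ?powR_ge0// ltW.
have m1 := measurable_truncated r init_mass l.
have m2 := measurable_normB init_mass r0 (measurable_heat_u0 r0).
have mA : measurable_fun setT (fun b => (absorption (r, b))%:E).
  apply/measurable_EFinP.
  exact: (measurableT_comp measurable_absorption (measurable_pair1 _)).
have A0 b : (0 <= (absorption (r, b))%:E)%E by rewrite lee_fin absorption_ge0.
have m3 := measurable_funeM c%:E mA.
have p1 a : (0 <= (Num.min (init_mass * H r a) l)%:E)%E.
  by rewrite lee_fin le_min (ltW l0) andbT mulr_ge0 ?heat_ext_ge0.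
have p2 a : (0 <= `|heat_semigroup h r u0 a - init_mass * h r a|%:E)%E by rewrite lee_fin.
have p3 b : (0 <= c%:E * (absorption (r, b))%:E)%E by rewrite mule_ge0// lee_fin.
apply: (@le_trans _ _ (mass u r)).
  by rewrite (fin_massE (ltW r0)) lee_fin limit_mass_le// ltW.
apply: (@le_trans _ _ (\int[lebesgue_heis]_a
    ((Num.min (init_mass * H r a) l)%:E +
     `|heat_semigroup h r u0 a - init_mass * h r a|%:E +
     c%:E * (absorption (r, a))%:E))%E).
  apply: ge0_le_integral => //.
  - by move=> a _; rewrite lee_fin u_ge0// ltW.
  - by apply/measurable_EFinP; exact: measurable_solution (ltW r0).
  - by apply: emeasurable_funD => //; exact: emeasurable_funD.
  - move=> a _; rewrite -EFinM -!EFinD lee_fin heat_ext_gt0//.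
    exact: solution_pointwise_le.
rewrite (ge0_integralD _ measurableT (fun a _ => adde_ge0 (p1 a) (p2 a))
  (emeasurable_funD m1 m2) (fun a _ => p3 a) m3).
rewrite (ge0_integralD _ measurableT (fun a _ => p1 a) m1 (fun a _ => p2 a) m2).
rewrite (ge0_integralZl_EFin _ measurableT (fun a _ => A0 a) mA c0).
rewrite (truncated_heat_scale r0 m00 (ltW e0)).
apply: leeD => //; apply: leeD => //; apply: (le_trans (heat_u0_error r0)).
by rewrite leeDl.
Qed.

Lemma limit_mass_eq0 : 0 < inf (k @` `]0, +oo[) ->
  p <= 1 + 2 / (hdim n)%:R -> limit_mass = 0.
Proof.
set k0 := inf _ => k00 pQ.
have kk0 t : 0 < t -> k0 <= k t.
  move=> t0; apply: ge_inf; last by exists t => //=; rewrite in_itv /= t0.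
  exists 0 => x [s + <-]; rewrite /= in_itv /= andbT => s0; apply/ltW; exact: k_gt0.
apply/eqP; rewrite eq_le limit_mass_ge0 andbT leNgt; apply/negP => Mi.
have m00 : 0 <= init_mass by rewrite -fin_mass0 fin_mass_ge0.
have Mi4 : 0 < limit_mass / 4 by rewrite divr_gt0.
(* One quarter of the limit mass is left to the truncated kernel through [e], another to
   [heat_error] at late times; absorption must account for the remaining half. *)
have [e e0 he] : exists2 e : R, 0 < e &
    (\int[lebesgue_heis]_a (Num.min (init_mass * H 1 a) e)%:E <= (limit_mass / 4)%:E)%E.
  have /fine_cvgP[fnum /cvgrPdist_le/(_ _ Mi4) fle] := truncated_heat_cvg m00.
  have [N _ NP] := filterI fnum fle.
  have [f1 f2] := NP N (leqnn N).
  exists N.+1%:R^-1; first by rewrite invr_gt0.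
  rewrite -(fineK f1) lee_fin; move: f2; rewrite /= sub0r normrN.
  exact: le_trans (ler_norm _).
have Q0 : 0 < (hdim n)%:R :> R by rewrite ltr0n /hdim addn2.
(* Solving for the absorption gives at least k0 l^(p-1) times half the limit mass, with l = e
   r^(-Q/2). *)
pose c := k0 * e `^ (p - 1) * (limit_mass / 2).
have c0 : 0 < c by rewrite !mulr_gt0 ?powR_gt0// invr_gt0.
have lower r : 1 <= r -> (heat_error r <= (limit_mass / 4)%:E)%E ->
    ((c / r)%:E <= \int[lebesgue_heis]_b (absorption (r, b))%:E)%E.
  move=> r1 hr; have r0 : 0 < r by exact: lt_le_trans r1.
  have := limit_mass_le_absorption r0 e0 k00 (kk0 _ r0).
  set l := e * _; set A := (\int[_]_b (absorption (r, b))%:E)%E.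
  have l0 : 0 < l by rewrite mulr_gt0// exprn_gt0// isqrt_gt0.
  have A0 : (0 <= A)%E by exact: inner_absorption0_ge0.
  move=> ML.
  have {ML} : (limit_mass%:E <= (limit_mass / 4)%:E + (limit_mass / 4)%:E +
      (l `^ (1 - p) / k0)%:E * A)%E.
    apply: (le_trans ML); apply: leeD => //; exact: leeD.
  case: (A) A0 => [x x0|_ _|//]; last by rewrite leey.
  rewrite -EFinM -!EFinD !lee_fin => Mx.
  have lp : 0 < l `^ (p - 1) by rewrite powR_gt0.
  have lpE : l `^ (1 - p) = (l `^ (p - 1))^-1 by rewrite -powRN opprB.
  have xge : k0 * l `^ (p - 1) * (limit_mass / 2) <= x.
    rewrite -ler_pdivlMl ?mulr_gt0// invfM mulrC.
    by move: Mx; rewrite lpE mulrC; lra.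
  apply: le_trans xge.
  (* Here p <= 1 + 2/Q makes the exponent Q(p-1)/2 at most 1, and r >= 1 lets the powers compare. *)
  have rp : r^-1 <= r `^ (- ((hdim n)%:R / 2 * (p - 1))).
    rewrite -(powR_inv1 (ltW r0)); apply: ler_powR => //; rewrite lerN2.
    rewrite mulrAC ler_pdivrMr// mul1r mulrC -ler_pdivlMr//; lra.
  have -> : l `^ (p - 1) = e `^ (p - 1) * r `^ (- ((hdim n)%:R / 2 * (p - 1))).
    by rewrite /l powRM ?(ltW e0) ?exprn_ge0 ?powR_ge0// isqrt_powR.
  have -> : c / r = k0 * (e `^ (p - 1) * r^-1) * (limit_mass / 2) by rewrite /c; ring.
  rewrite ler_wpM2r ?divr_ge0 ?(ltW Mi)// ler_wpM2l ?(ltW k00)//.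
  by rewrite ler_wpM2l ?powR_ge0.
have [T T1 hT] : exists2 T, 1 <= T &
    forall r, T <= r -> (heat_error r <= (limit_mass / 4)%:E)%E.
  have /cvgrPdist_le/(_ _ Mi4)[T [_ TP]] := cvg_heat_error.
  (* Convergence at infinity gives the bound strictly above [T], hence the + 1. *)
  exists (Num.max 1 (T + 1)); first by rewrite le_max lexx.
  move=> r; rewrite ge_max => /andP[_ Tr].
  rewrite -(fineK (heat_error_fin r)) lee_fin.
  have Tr' : T < r by rewrite (lt_le_trans _ Tr)// ltrDl.
  by have := TP r Tr'; rewrite sub0r normrN; apply: le_trans (ler_norm _).
(* On [t, 2t] the mass loses at least t c/(2t) = c/2, yet beyond [S] it is within c/4 of its limit
   and never below it. *)
have c4 : 0 < c / 4 by rewrite divr_gt0.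
have /cvgrPdist_lt/(_ _ c4)[S [_ SP]] := cvg_fin_mass.
pose t := Num.max T (S + 1).
have Tt : T <= t by rewrite le_max lexx.
have St : S < t by rewrite lt_max ltrDl ltr01 orbT.
have t1 : 1 <= t by exact: le_trans Tt.
have t0 : 0 < t by exact: lt_le_trans t1.
have tt : 0 <= t <= 2 * t by rewrite ltW//= ler_peMl ?ler1n// ltW.
have ct0 : 0 <= c / (2 * t) by rewrite divr_ge0 ?(ltW c0) ?mulr_ge0 ?(ltW t0).
have := fin_mass_decay_ge tt ct0.
have -> : (2 * t - t) * (c / (2 * t)) = c / 2 by field; rewrite gt_eqF.
have cm : c / 2 <= fin_mass t - fin_mass (2 * t) -> False.
  have := SP t St; rewrite ltr_norml => /andP[+ _].
  have : limit_mass <= fin_mass (2 * t) by apply: limit_mass_le; rewrite mulr_ge0// ltW.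
  lra.
move=> h1; apply: cm; apply: h1 => r /andP[tr rt].
have r1 : 1 <= r by exact: le_trans tr.
apply: le_trans (lower r r1 (hT r (le_trans Tt tr))).
have r0 : 0 < r by exact: lt_le_trans r1.
by rewrite lee_fin ler_wpM2l ?(ltW c0)// lef_pV2 ?posrE ?mulr_gt0// ltW.
Qed.

(** * Decay in L^q *)

Lemma heat_remainder_bound : 0 < init_mass -> exists2 C : R, 0 < C &
  forall t a, 0 < t -> `|u t a - limit_mass * h t a| <= C * isqrt t ^+ hdim n.
Proof.
move=> m00; have [C C0 hC] := heat_bound m00; have Mi := limit_mass_ge0.
exists (C * init_mass + limit_mass * C).
  by rewrite ltr_wpDr ?mulr_gt0// mulr_ge0// ltW.
move=> t a t0; have ub : u t a <= C * isqrt t ^+ hdim n * init_mass.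
  exact: le_trans (solution_le_heat a (ltW t0)) (heat_u0_le C0 hC a t0).
have hb : limit_mass * h t a <= limit_mass * (C * isqrt t ^+ hdim n).
  by rewrite ler_wpM2l// hC.
apply: (le_trans (ler_normB _ _)).
have h0 : 0 <= limit_mass * h t a by rewrite mulr_ge0// heat_kernel_ge0.
rewrite (ger0_norm h0) (ger0_norm (u_ge0 a (ltW t0))).
have -> : (C * init_mass + limit_mass * C) * isqrt t ^+ hdim n =
    C * isqrt t ^+ hdim n * init_mass + limit_mass * (C * isqrt t ^+ hdim n) by ring.
exact: lerD.
Qed.

(** The sup bound C t^(-Q/2) enters the interpolation with exponent 1 - 1/q, so its power of t
    cancels the weight and leaves C^(1-1/q) times the L^1 error to the power 1/q. *)
Lemma Lq_decay (q : R) : 0 < init_mass -> 1 <= q ->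
  ((t `^ ((hdim n)%:R / 2 * (1 - q^-1)))%:E *
     'N[@lebesgue_heis R n]_(q%:E)[(fun a => (u t a - limit_mass * h t a)%:E)])%E
    @[t --> +oo] --> 0%E.
Proof.
move=> m00 q1; have [C C0 wC] := heat_remainder_bound m00.
have q0 : 0 < q by exact: lt_le_trans q1.
pose d t := fine (heat_error t).
have d0 t : 0 <= d t by rewrite fine_ge0// heat_error_ge0.
apply: (@squeeze_cvge _ _ _ _ (cst 0%E) _
  (fun t => (C `^ (1 - q^-1) * d t `^ q^-1)%:E)).
- near=> t; have t0 : 0 < t by near: t; exact: nbhs_pinfty_gt.
  rewrite mule_ge0 ?Lnorm_ge0 ?lee_fin ?powR_ge0//=.
  pose B := C * isqrt t ^+ hdim n.
  have B0 : 0 <= B by rewrite mulr_ge0 ?exprn_ge0 ?powR_ge0// ltW.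
  have mw : measurable_fun setT (fun a => u t a - limit_mass * h t a).
    apply: measurable_funB; first exact: measurable_solution (ltW t0).
    by apply: measurable_funM => //; exact: measurable_heat_kernel.
  have wd : (\int[lebesgue_heis]_a `|u t a - limit_mass * h t a|%:E <= (d t)%:E)%E.
    by rewrite fineK ?heat_error_fin// solution_error.
  have Nle := Lnorm_interpolation_le mw q1 B0 (fun a => wC t a t0) wd.
  apply: (le_trans (lee_wpmul2l _ Nle)); first by rewrite lee_fin powR_ge0.
  rewrite -EFinM lee_fin powRM ?powR_ge0// mulrA ler_wpM2r ?powR_ge0//.
  rewrite -powRrM mulrBl mulfV ?gt_eqF// mul1r.
  rewrite /B powRM ?exprn_ge0 ?powR_ge0 ?(ltW C0)// isqrt_powR// powRN mulrCA.
  by rewrite mulfV ?mulr1// gt_eqF// powR_gt0.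
- exact: cvg_cst.
- apply: cvg_EFin; first exact: nearW.
  rewrite -[X in _ --> X](mulr0 (C `^ (1 - q^-1))); apply: cvgM; first exact: cvg_cst.
  apply: cvg_powR0 => //; first by rewrite invr_gt0.
  exact: cvg_heat_error.
Unshelve. all: by end_near. Qed.

End absorption_equation.

Theorem theorem5 (R : realType) (n : nat) (p : R)
    (h : R -> heis R n -> R) (k : R -> R)
    (u0 : heis R n -> R) (u : R -> heis R n -> R)
    (n_gt0 : (0 < n)%N) (p_gt1 : 1 < p)
    (h_heat_kernel : heat_kernel h)
    (u0_ge0 : forall a, 0 <= u0 a)
    (u0_L1 : (@lebesgue_heis R n).-integrable setT (EFin \o u0))
    (u0_C0 : C0 u0)
    (k_gt0 : forall t, 0 < t -> 0 < k t)
    (k_measurable : measurable_fun (`]0, +oo[ : set R) k)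
    (k_bounded : finite_norm (@lebesgue_measure R) +oo%E (k \_ `]0, +oo[))
    (k_inf : 0 < inf (k @` `]0, +oo[))
    (u_mild : global_mild_solution h k p u0 u)
    (u_ge0 : forall t a, 0 <= t -> 0 <= u t a)
    (u_nontrivial : exists t, exists a, 0 <= t /\ u t a != 0) :
  exists Minf : R,
    [/\ mass u t @[t --> +oo%R] --> Minf%:E,
        1 + 2 / (hdim n)%:R < p ->
          0 < Minf /\
          forall q : R, 1 <= q ->
            ((t `^ ((hdim n)%:R / 2 * (1 - q^-1)))%:E *
               'N[@lebesgue_heis R n]_(q%:E)
                 [(fun a => (u t a - Minf * h t a)%:E)])%E
              @[t --> +oo%R] --> 0%E &
        p <= 1 + 2 / (hdim n)%:R -> Minf = 0].
Proof.
have m0 := init_mass_gt0 h_heat_kernel u0_ge0 u0_L1 u0_C0 k_gt0 u_mild u_ge0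
  u_nontrivial.
exists (limit_mass p k u0 u); split => [|p_gt|p_le].
- exact (cvg_mass p_gt1 h_heat_kernel u0_ge0 u0_L1 u0_C0 k_gt0 k_measurable
    k_bounded u_mild u_ge0).
- split=> [|q q_ge1].
    exact (limit_mass_gt0 p_gt1 h_heat_kernel u0_ge0 u0_L1 u0_C0 k_gt0
      k_measurable k_bounded u_mild u_ge0 m0 p_gt).
  exact (Lq_decay p_gt1 h_heat_kernel u0_ge0 u0_L1 u0_C0 k_gt0 k_measurable
    k_bounded u_mild u_ge0 m0 q_ge1).
- exact (limit_mass_eq0 p_gt1 h_heat_kernel u0_ge0 u0_L1 u0_C0 k_gt0
    k_measurable k_bounded u_mild u_ge0 k_inf p_le).
Qed.
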